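(* Let $g(z)=\sum_{n=0}^\infty \eta_n z^n$ be analytic in the unit disc $\mathbb D$, and let $\mathcal R_\eta$ and $\mathcal H_g$ be the associated Rhaly and generalized Hilbert operators. If $1\le p<\infty$ and $1<q<\infty$, then the following are equivalent: (i) $\mathcal H_g\in\mathcal B(S^p,S^q)$; (ii) $\mathcal R_\eta\in\mathcal B(S^p,S^q)$; (iii) $\mathcal H_g\in\mathcal K(S^p,S^q)$; (iv) $\mathcal R_\eta\in\mathcal K(S^p,S^q)$; (v) $g\in S^q$.
   Context: $\mathbb D=\{z\in\mathbb C:|z|<1\}$ and $\mathrm{Hol}(\mathbb D)$ is the space of analytic functions in $\mathbb D$. The Hardy space $H^p$ ($0<p<\infty$) consists of those $f\in\mathrm{Hol}(\mathbb D)$ with $\|f\|_{H^p}=\sup_{0<r<1}\left(\frac1{2\pi}\int_0^{2\pi}|f(re^{it})|^p\,dt\right)^{1/p}<\infty$. For $1\le p<\infty$, $S^p$ is the space of those $f\in\mathrm{Hol}(\mathbb D)$ with $f'\in H^p$, a Banach space with the norm $|f(0)|+\|f'\|_{H^p}$. Rhaly operator: for $f(z)=\sum_{k=0}^\infty a_kz^k\in\mathrm{Hol}(\mathbb D)$, $\mathcal R_{\eta}(f)(z)=\sum_{n=0}^\infty\eta_n\left(\sum_{k=0}^n a_k\right)z^n$, $z\in\mathbb D$. Generalized Hilbert operator: for $f(z)=\sum_{k=0}^\infty a_kz^k\in H^1$ (in particular for $f\in S^p$, $p\ge1$), $\mathcal H_g(f)(z)=\sum_{n=0}^\infty(n+1)\eta_{n+1}\left(\sum_{k=0}^\infty\frac{a_k}{n+k+1}\right)z^n=\int_0^1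 f(t)\,g'(tz)\,dt$, $z\in\mathbb D$ (the integral converges absolutely, the two expressions agree, and they define an analytic function in $\mathbb D$). For Banach spaces $X,Y$ of analytic functions in $\mathbb D$, $\mathcal B(X,Y)$ denotes the continuous linear operators from $X$ into $Y$, and $\mathcal K(X,Y)$ the compact linear operators from $X$ into $Y$; membership of an operator means that it maps $X$ into $Y$ and is bounded (resp. compact). *)

(* Defs.v *)
From Stdlib Require Import Reals Factorial.
From Coquelicot Require Import Coquelicot.

Local Open Scope R_scope.

(* Functions in the unit disc are represented by total functions C -> C whose
   values outside the disc are irrelevant. *)
Definition in_disc (z : C) : Prop := Cmod z < 1.

(* ex_derive is used here over the field C_AbsRing, i.e. it is complex
   differentiability. *)
Definition Hol (f : C -> C) : Prop := forall z : C, in_disc z -> ex_derive f z.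

(* Stdlib's Rpower 0 p is 1 (because ln 0 = 0), hence the case distinction. *)
Definition rpow (x p : R) : R :=
  if Req_dec_T x 0 then 0 else Rpower x p.

Definition circle_pt (r t : R) : C := (r * cos t, r * sin t).

Definition integral_mean (p : R) (f : C -> C) (r : R) : R :=
  rpow (/ (2 * PI) *
        RInt (fun t : R => rpow (Cmod (f (circle_pt r t))) p) 0 (2 * PI))
       (/ p).

Definition hardy_norm (p : R) (f : C -> C) : Rbar :=
  Lub_Rbar (fun y : R => exists r : R, 0 < r < 1 /\ y = integral_mean p f r).

Definition Hardy (p : R) (f : C -> C) : Prop :=
  Hol f /\ Rbar_lt (hardy_norm p f) p_infty.

(* A normed space of analytic functions, given by its underlying set and its
   norm. *)
Record fun_space : Type := FunSpace {
  fs_mem : (C -> C) -> Prop;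
  fs_norm : (C -> C) -> R
}.

Definition S_space (p : R) : fun_space := {|
  fs_mem := fun f => Hol f /\ Hardy p (C_derive f);
  fs_norm := fun f => Cmod (f (RtoC 0)) + real (hardy_norm p (C_derive f))
|}.

Definition linear_op (X Y : fun_space) (T : (C -> C) -> (C -> C)) : Prop :=
  (forall f, fs_mem X f -> fs_mem Y (T f)) /\
  (forall f h, fs_mem X f -> fs_mem X h -> forall z, in_disc z ->
     T (fun w => Cplus (f w) (h w)) z = Cplus (T f z) (T h z)) /\
  (forall (c : C) f, fs_mem X f -> forall z, in_disc z ->
     T (fun w => Cmult c (f w)) z = Cmult c (T f z)).

Definition bounded_op (X Y : fun_space) (T : (C -> C) -> (C -> C)) : Prop :=
  linear_op X Y T /\
  exists M : R, forall f, fs_mem X f -> fs_norm Y (T f) <= M * fs_norm X f.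

Definition compact_op (X Y : fun_space) (T : (C -> C) -> (C -> C)) : Prop :=
  linear_op X Y T /\
  forall (u : nat -> C -> C) (M : R),
    (forall n, fs_mem X (u n) /\ fs_norm X (u n) <= M) ->
    exists (phi : nat -> nat) (h : C -> C),
      (forall n, (phi n < phi (S n))%nat) /\ fs_mem Y h /\
      is_lim_seq (fun n => fs_norm Y (fun z => Cminus (T (u (phi n)) z) (h z)))
                 0.

(* The sum of the series a_0 + a_1 + ... when it converges; like Coquelicot's
   Series it is a total function. *)
Definition C_series (a : nat -> C) : C :=
  (Series (fun n => Re (a n)), Series (fun n => Im (a n))).

Fixpoint C_derive_n (f : C -> C) (n : nat) : C -> C :=
  match n with
  | O => f
  | S m => C_derive (C_derive_n f m)
  end.

Definition taylor_coef (f : C -> C) (k : nat) : C :=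
  Cdiv (C_derive_n f k (RtoC 0)) (RtoC (INR (fact k))).

Definition Rhaly (eta : nat -> C) (f : C -> C) (z : C) : C :=
  C_series (fun n =>
    Cmult (Cmult (eta n) (sum_n (taylor_coef f) n)) (Cpow z n)).

(* Here eta is the sequence of Taylor coefficients of the symbol g. *)
Definition gen_Hilbert (eta : nat -> C) (f : C -> C) (z : C) : C :=
  C_series (fun n =>
    Cmult
      (Cmult (Cmult (RtoC (INR (n + 1))) (eta (n + 1)%nat))
             (C_series (fun k =>
                Cdiv (taylor_coef f k) (RtoC (INR (n + k + 1))))))
      (Cpow z n)).

(* Main.v *)
Require Import Defs.
From Stdlib Require Import Reals Arith Factorial ClassicalEpsilon Lra Lia Psatz.
From Coquelicot Require Import Coquelicot.
Local Open Scope R_scope.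

(** Each of the four conditions on the operators is equivalent to g in S^q.

    Necessity of g in S^q. Both operators are tested on the constant function 1:
    [Rhaly eta 1] is g itself ([Rhaly_one]) and [gen_Hilbert eta 1] is
    (g - g(0))/z ([gen_Hilbert_one]). If h = (g - g(0))/z lies in S^q, then h is
    bounded, because its Taylor coefficients are absolutely summable, and
    g' = h + z h' lies in H^q.

    Sufficiency of g in S^q. For f in S^p the Taylor coefficients a_k are absolutely
    summable, with sum at most a constant times the norm of f ([S_l1]): this is
    Hardy's inequality for f', which lies in H^1. Both operators then have the
    form

      T f (z) = sum_n h_n (alpha_0 + ... + alpha_n) z^n

    with a sequence alpha that depends linearly on f and whose l^1 norm is
    controlled by the norm of f, and a fixed h with z h' in H^q. For the Rhaly
    operator alpha_k = a_k and h = eta. For the Hilbert operator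
    h_n = (n+1) eta_{n+1} / n, and alpha consists of the increments in n of
    sum_k a_k n/(n+k+1); it is in l^1 because n/(n+k+1) is monotone and bounded
    in n, uniformly in k ([omega_diff_sum], [l1_kernel]). Exchanging the two
    summations,

      z (T f)'(z) = sum_m alpha_m (tail of z h' from the degree m on),

    so that T f is an l^1 combination of Taylor tails of one H^q function
    ([weighted_bound]). By M. Riesz these tails are bounded in H^q
    ([tails_bounded]), which gives boundedness ([core_bound]). Moreover they
    tend to 0 ([tails_vanish]), which gives compactness ([core_compact]): from a
    bounded sequence of f's one extracts a subsequence along which every alpha_m
    converges; the low tails then have small weights, and the high tails are
    small themselves. [weighted_operator] packages both.

    The three classical facts about Hardy spaces are proved from averages over
    circles of radius r < 1, on which all functions are continuous.

    Hardy's inequality ([hardy_inequality]). For F analytic across the unit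
    circle put w = |F| + eps there. The outer function exp(H/2), where H is the
    Herglotz transform of log w, splits F into two factors whose H^2 norms
    squared are at most the mean of w ([l1_factorisation]): the second factor
    F exp(-H/2) is controlled by |F| <= exp(Re H), a consequence of the maximum
    principle ([outer_majorant]). Hilbert's inequality applied to the
    coefficients of the two factors finishes the proof. The summand eps keeps
    log w Lipschitz, and the inequality |F| <= exp(Re H) in place of an equality
    leaves the zeros of F where they are, in the second factor.

    The theorem of M. Riesz ([partial_sums]). For 1 < q <= 2 and u > 0 the
    Herglotz transform F of u has positive real part, the Poisson integral of u;
    the pointwise inequality |F|^q <= A (Re F)^q - B Re(F^q) is averaged over a
    circle, where the mean of F^q is F(0)^q >= 0 ([riesz_positive]). A general
    function is split into four positive ones, and the partial sums are obtained
    from two projections, one of them modulated. The case q > 2 follows by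
    duality.

    Vanishing of tails ([tails_vanish]). A quantitative uniform convexity of the
    q-th power of the modulus makes the dilations F(r z) a Cauchy family in H^q
    as r tends to 1 ([dilations_converge]), and the tails of a dilation tend to 0
    uniformly on the disc.

    Jensen's inequality for q-th powers, in all the forms used, is the average of
    the single scalar inequality [young]. *)

(** * Real powers and Young's inequality *)

Lemma rpow_0 p : rpow 0 p = 0.
Proof. unfold rpow. destruct (Req_dec_T 0 0); [easy | lra]. Qed.

Lemma rpow_pos x p : 0 < x -> rpow x p = Rpower x p.
Proof. intros H. unfold rpow. destruct (Req_dec_T x 0); [lra | easy]. Qed.

Lemma rpow_gt0 x p : 0 < x -> 0 < rpow x p.
Proof. intros H. rewrite rpow_pos by easy. apply exp_pos. Qed.

Lemma rpow_ge0 x p : 0 <= rpow x p.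
Proof.
  unfold rpow. destruct (Req_dec_T x 0); [lra | left; apply exp_pos].
Qed.

Lemma rpow_1 x : 0 <= x -> rpow x 1 = x.
Proof.
  intros [H | <-]; [ | apply rpow_0].
  rewrite rpow_pos by easy. now apply Rpower_1.
Qed.

Lemma rpow_one p : rpow 1 p = 1.
Proof.
  rewrite rpow_pos by lra. unfold Rpower. rewrite ln_1, Rmult_0_r. apply exp_0.
Qed.

Lemma rpow_mult_distr x y p :
  0 <= x -> 0 <= y -> rpow (x * y) p = rpow x p * rpow y p.
Proof.
  intros [Hx | <-] [Hy | <-]; rewrite ?Rmult_0_l, ?Rmult_0_r, ?rpow_0; try ring.
  rewrite !rpow_pos by (try easy; now apply Rmult_lt_0_compat).
  symmetry. now apply Rpower_mult_distr.
Qed.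

Lemma rpow_rpow x p q : 0 <= x -> rpow (rpow x p) q = rpow x (p * q).
Proof.
  intros [Hx | <-]; [ | now rewrite !rpow_0].
  rewrite (rpow_pos x), (rpow_pos x) by easy.
  rewrite rpow_pos by apply exp_pos. apply Rpower_mult.
Qed.

Lemma rpow_plus x p q : 0 <= x -> rpow x (p + q) = rpow x p * rpow x q.
Proof.
  intros [Hx | <-]; [ | rewrite !rpow_0; ring].
  rewrite !rpow_pos by easy. apply Rpower_plus.
Qed.

Lemma rpow_pred x q : 0 <= x -> rpow x q = x * rpow x (q - 1).
Proof.
  intros Hx. rewrite <- (rpow_1 x) at 2 by easy. rewrite <- rpow_plus by easy.
  f_equal. ring.
Qed.

Lemma rpow_lt x y p : 0 <= x -> x < y -> 0 < p -> rpow x p < rpow y p.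
Proof.
  intros [Hx | <-] Hy Hp.
  - rewrite !rpow_pos by lra. apply exp_increasing.
    apply Rmult_lt_compat_l; [easy | apply ln_increasing; easy].
  - rewrite rpow_0. now apply rpow_gt0.
Qed.

Lemma rpow_le x y p : 0 <= x -> x <= y -> 0 < p -> rpow x p <= rpow y p.
Proof.
  intros Hx [Hy | <-] Hp; [left; now apply rpow_lt | apply Rle_refl].
Qed.

Lemma rpow_inv_le x y p :
  0 <= x -> 0 <= y -> 0 < p -> rpow x p <= y -> x <= rpow y (/ p).
Proof.
  intros Hx Hy Hp H.
  rewrite <- (rpow_1 x) by easy. replace 1 with (p * / p) by (field; lra).
  rewrite <- rpow_rpow by easy.
  apply rpow_le; [apply rpow_ge0 | easy | now apply Rinv_0_lt_compat].
Qed.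

Lemma rpow_inv_K x p : 0 <= x -> 0 < p -> rpow (rpow x (/ p)) p = x.
Proof.
  intros Hx Hp. rewrite rpow_rpow by easy.
  replace (/ p * p) with 1 by (field; lra). now apply rpow_1.
Qed.

Lemma rpow_K_inv x p : 0 <= x -> 0 < p -> rpow (rpow x p) (/ p) = x.
Proof.
  intros Hx Hp. rewrite rpow_rpow by easy.
  replace (p * / p) with 1 by (field; lra). now apply rpow_1.
Qed.

Lemma rpow_le_inv x y p :
  0 <= x -> 0 <= y -> 0 < p -> x <= rpow y (/ p) -> rpow x p <= y.
Proof.
  intros Hx Hy Hp H. rewrite <- (rpow_inv_K y p) by easy. now apply rpow_le.
Qed.

Lemma rpow_two_max a b q : 0 <= a -> 0 <= b -> 0 < q ->
  rpow (a + b) q <= rpow 2 q * (rpow a q + rpow b q).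
Proof.
  intros Ha Hb Hq.
  assert (H : forall x y, 0 <= x <= y ->
     rpow (x + y) q <= rpow 2 q * (rpow x q + rpow y q)).
  { intros x y Hxy. apply Rle_trans with (rpow 2 q * rpow y q).
    - rewrite <- rpow_mult_distr by lra. apply rpow_le; lra.
    - apply Rmult_le_compat_l; [apply rpow_ge0 | ].
      generalize (rpow_ge0 x q). lra. }
  destruct (Rle_dec a b).
  - apply H. lra.
  - rewrite (Rplus_comm a), (Rplus_comm (rpow a q)). apply H. lra.
Qed.

Lemma ln_le_sub1 x : 0 < x -> ln x <= x - 1.
Proof.
  intros Hx. destruct (Req_dec (ln x) 0) as [E | E].
  - rewrite E. assert (x = 1) by (apply ln_inv; [easy | lra | now rewrite ln_1]). lra.
  - generalize (exp_ineq1 (ln x) E). rewrite exp_ln by easy. lra.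
Qed.

Lemma ln_lt_sub1 x : 0 < x -> x <> 1 -> ln x < x - 1.
Proof.
  intros Hx Hn. assert (E : ln x <> 0).
  { intros E. apply Hn. apply ln_inv; [easy | lra | now rewrite ln_1]. }
  generalize (exp_ineq1 (ln x) E). rewrite exp_ln by easy. lra.
Qed.

(** Weighted arithmetic-geometric mean of t^q and 1 with weights 1/q and
    1 - 1/q: concavity of ln at the mean m, used in the form ln x <= x - 1 at
    t^q / m and 1 / m. *)
Lemma bernoulli_strict t q : 1 < q -> 0 < t -> t <> 1 ->
  q * t < rpow t q + (q - 1).
Proof.
  intros Hq Ht Hn. rewrite rpow_pos by easy. set (a := Rpower t q).
  assert (Ha : 0 < a) by apply exp_pos.
  (* The assertion is t < m, which is compared through logarithms. *)
  set (m := (a + (q - 1)) / q).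
  assert (Hm : 0 < m) by (apply Rdiv_lt_0_compat; lra).
  assert (Hla : ln a = q * ln t) by apply ln_exp.
  assert (Hna : a <> 1).
  { intros E. rewrite E, ln_1 in Hla.
    assert (ln t = 0) by nra. apply Hn. apply ln_inv; [easy | lra | now rewrite ln_1]. }
  assert (H1 : ln (a / m) <= a / m - 1) by (apply ln_le_sub1; now apply Rdiv_lt_0_compat).
  assert (H2 : ln (/ m) <= / m - 1) by (apply ln_le_sub1; now apply Rinv_0_lt_compat).
  assert (H3 : ln (/ m) < / m - 1).
  { apply ln_lt_sub1; [now apply Rinv_0_lt_compat | ]. intros E.
    apply Hna. assert (m = 1) by (rewrite <- (Rinv_inv m), E; field).
    unfold m in H. apply (f_equal (fun x => x * q)) in H.
    unfold Rdiv in H. rewrite Rmult_assoc, Rinv_l in H by lra. lra. }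
  unfold Rdiv in H1. rewrite ln_mult in H1 by (try easy; now apply Rinv_0_lt_compat).
  rewrite ln_Rinv in H1, H3 by easy.
  assert (E : a * / m + (q - 1) * / m = q) by (unfold m; field; lra).
  assert (Hl : ln t < ln m).
  { apply Rmult_lt_reg_l with q; [lra | ]. rewrite <- Hla.
    assert ((q - 1) * (- ln m) < (q - 1) * (/ m - 1)) by (apply Rmult_lt_compat_l; lra).
    lra. }
  apply ln_lt_inv in Hl; try easy.
  apply Rmult_lt_compat_l with (r := q) in Hl; [ | lra].
  replace (q * m) with (a + (q - 1)) in Hl by (unfold m; field; lra). easy.
Qed.

Lemma young_strict x y q : 1 < q -> 0 < x -> 0 < y -> x <> y ->
  q * x * rpow y (q - 1) < rpow x q + (q - 1) * rpow y q.
Proof.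
  intros Hq Hx Hy Hn.
  assert (Ht : 0 < x / y) by now apply Rdiv_lt_0_compat.
  assert (Hb := bernoulli_strict (x / y) q Hq Ht).
  assert (E : x = (x / y) * y) by (field; lra).
  set (t := x / y) in *. rewrite E. rewrite rpow_mult_distr by lra.
  rewrite (rpow_pred y q) by lra.
  assert (Hp := rpow_gt0 y (q - 1) Hy).
  assert (Hb' : q * t < rpow t q + (q - 1)).
  { apply Hb. intros E1. rewrite E1 in E. lra. }
  assert (0 < y * rpow y (q - 1)) by now apply Rmult_lt_0_compat.
  nra.
Qed.

(** The tangent line inequality for x |-> x^q at the point y. Being linear in x,
    the left-hand side survives any averaging, which is how the Jensen inequalities
    for powers are obtained below. *)
Lemma young x y q : 1 <= q -> 0 <= x -> 0 <= y ->
  q * x * rpow y (q - 1) <= rpow x q + (q - 1) * rpow y q.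
Proof.
  intros [Hq | <-] Hx Hy.
  2: { rewrite rpow_1 by easy. replace (1 - 1) with 0 by ring.
       unfold rpow. destruct (Req_dec_T y 0); [lra | ].
       rewrite Rpower_O by lra. lra. }
  destruct Hy as [Hy | <-].
  2: { rewrite !rpow_0. generalize (rpow_ge0 x q). lra. }
  destruct Hx as [Hx | <-].
  2: { rewrite rpow_0. generalize (rpow_ge0 y q). nra. }
  destruct (Req_dec x y) as [<- | Hn].
  - rewrite (rpow_pred x q) by lra. lra.
  - left. now apply young_strict.
Qed.

(** * Continuous functions and their averages over a period *)

Definition contR (u : R -> R) : Prop := forall t, continuous u t.

Lemma contR_eps (u : R -> R) (t : R) : continuous u t <->
  forall e, 0 < e -> exists d, 0 < d /\ forall s, Rabs (s - t) < d -> Rabs (u s - u t) < e.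
Proof.
  split.
  - intros H e He. destruct (proj1 (filterlim_locally u (u t)) H (mkposreal e He)) as [d Hd].
    exists d. split; [apply cond_pos | ]. intros s Hs. exact (Hd s Hs).
  - intros H. apply filterlim_locally. intros e.
    destruct (H e (cond_pos e)) as [d [Hd Hs]]. exists (mkposreal d Hd).
    intros s. exact (Hs s).
Qed.

Lemma contR_const c : contR (fun _ => c).
Proof. intros t. apply continuous_const. Qed.

Lemma contR_plus u v : contR u -> contR v -> contR (fun t => u t + v t).
Proof. intros Hu Hv t. exact (continuous_plus u v t (Hu t) (Hv t)). Qed.

Lemma contR_mult u v : contR u -> contR v -> contR (fun t => u t * v t).
Proof. intros Hu Hv t. exact (continuous_mult u v t (Hu t) (Hv t)). Qed.

Lemma contR_opp u : contR u -> contR (fun t => - u t).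
Proof. intros Hu t. exact (continuous_opp u t (Hu t)). Qed.

Lemma contR_minus u v : contR u -> contR v -> contR (fun t => u t - v t).
Proof. intros Hu Hv t. exact (continuous_minus u v t (Hu t) (Hv t)). Qed.

Lemma contR_abs u : contR u -> contR (fun t => Rabs (u t)).
Proof.
  intros Hu t. apply contR_eps. intros e He.
  destruct (proj1 (contR_eps u t) (Hu t) e He) as [d [Hd H]].
  exists d; split; [easy | ]. intros s Hs. specialize (H s Hs).
  eapply Rle_lt_trans; [apply Rabs_triang_inv2 | easy].
Qed.

Lemma contR_comp f u : contR u -> (forall t, continuous f (u t)) -> contR (fun t => f (u t)).
Proof. intros Hu Hf t. apply (continuous_comp u f); auto. Qed.

Lemma contR_cos : contR cos. Proof. intros t. apply continuous_cos. Qed.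

Lemma contR_sin : contR sin. Proof. intros t. apply continuous_sin. Qed.

Lemma contR_rpow u q : contR u -> (forall t, 0 <= u t) -> 0 < q -> contR (fun t => rpow (u t) q).
Proof.
  intros Hu Hp Hq t. destruct (Hp t) as [H | H].
  - apply (continuous_ext_loc _ (fun t => exp (q * ln (u t)))).
    + destruct (proj1 (contR_eps u t) (Hu t) (u t) H) as [d [Hd Hs]].
      exists (mkposreal d Hd). intros s H1. simpl in H1.
      rewrite rpow_pos; [easy | ].
      specialize (Hs s H1). apply Rabs_def2 in Hs. lra.
    + apply (continuous_comp (fun t => q * ln (u t)) exp); [ | apply continuous_exp].
      apply (continuous_mult (fun _ => q) (fun t => ln (u t))); [apply continuous_const | ].
      apply (continuous_comp u ln); [easy | ].
      apply (ex_derive_continuous (K := R_AbsRing) (V := R_NormedModule) ln).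
      exists (/ u t). now apply is_derive_ln.
  - apply contR_eps. intros e He. rewrite <- H, rpow_0.
    destruct (proj1 (contR_eps u t) (Hu t) (rpow e (/ q)) (rpow_gt0 _ _ He)) as [d [Hd Hs]].
    exists d; split; [easy | ]. intros s H1. specialize (Hs s H1).
    rewrite <- H in Hs. rewrite Rminus_0_r in *.
    rewrite Rabs_pos_eq in * by (try apply rpow_ge0; apply Hp).
    rewrite <- (rpow_inv_K e q) by lra. now apply rpow_lt.
Qed.

Definition avg (u : R -> R) : R := / (2 * PI) * RInt u 0 (2 * PI).

Lemma two_pi_gt0 : 0 < 2 * PI.
Proof. generalize PI_RGT_0. lra. Qed.

Lemma inv_two_pi_gt0 : 0 < / (2 * PI).
Proof. apply Rinv_0_lt_compat, two_pi_gt0. Qed.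

Lemma contR_ex_RInt u a b : contR u -> ex_RInt u a b.
Proof. intros Hu. apply (ex_RInt_continuous (V := R_CompleteNormedModule)). intros; apply Hu. Qed.

Lemma avg_ext u v : (forall t, u t = v t) -> avg u = avg v.
Proof. intros H. unfold avg. f_equal. apply RInt_ext. intros; apply H. Qed.

Lemma avg_const c : avg (fun _ => c) = c.
Proof.
  unfold avg. rewrite RInt_const. unfold scal; simpl; unfold mult; simpl.
  generalize two_pi_gt0. intros. field. generalize PI_RGT_0. lra.
Qed.

Lemma avg_plus u v : contR u -> contR v -> avg (fun t => u t + v t) = avg u + avg v.
Proof.
  intros Hu Hv. unfold avg.
  rewrite (RInt_plus u v) by now apply contR_ex_RInt. unfold plus; simpl. ring.
Qed.

Lemma avg_scal c u : contR u -> avg (fun t => c * u t) = c * avg u.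
Proof.
  intros Hu. unfold avg.
  rewrite (RInt_scal u) by now apply contR_ex_RInt.
  unfold scal; simpl; unfold mult; simpl. ring.
Qed.

Lemma avg_opp u : contR u -> avg (fun t => - u t) = - avg u.
Proof.
  intros Hu. rewrite (avg_ext _ (fun t => (-1) * u t)) by (intros; ring).
  rewrite avg_scal by easy. ring.
Qed.

Lemma avg_minus u v : contR u -> contR v -> avg (fun t => u t - v t) = avg u - avg v.
Proof.
  intros Hu Hv. unfold Rminus. rewrite avg_plus, avg_opp; auto using contR_opp.
Qed.

(** For bounds that hold on one period only, such as the bound for the
    sawtooth. *)
Lemma avg_le_loc u v : contR u -> contR v ->
  (forall t, 0 <= t <= 2 * PI -> u t <= v t) -> avg u <= avg v.
Proof.
  intros Hu Hv H. apply Rmult_le_compat_l; [left; apply inv_two_pi_gt0 | ].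
  apply RInt_le; try (now apply contR_ex_RInt); [left; apply two_pi_gt0 | ].
  intros; apply H; lra.
Qed.

Lemma avg_le u v : contR u -> contR v -> (forall t, u t <= v t) -> avg u <= avg v.
Proof. intros; apply avg_le_loc; auto. Qed.

Lemma avg_ge0 u : contR u -> (forall t, 0 <= u t) -> 0 <= avg u.
Proof.
  intros Hu H. rewrite <- (avg_const 0). apply avg_le; auto using contR_const.
Qed.

Lemma avg_gt0 u : contR u -> (forall t, 0 < u t) -> 0 < avg u.
Proof.
  intros Hu H. apply Rmult_lt_0_compat; [apply inv_two_pi_gt0 | ].
  apply RInt_gt_0; auto using two_pi_gt0.
Qed.

Lemma le_all_eps x y : (forall e, 0 < e -> x <= y + e) -> x <= y.
Proof. intros H. apply le_epsilon. intros e He. now apply H. Qed.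

Lemma exp_mono x y : x <= y -> exp x <= exp y.
Proof. intros [H | ->]; [left; now apply exp_increasing | lra]. Qed.

(** * Complex derivatives in epsilon-delta form *)

(** Complex differentiability with an explicit remainder, which avoids the
    choice between the two normed module structures on C under which
    [is_derive] can be read. *)
Definition cderiv (f : C -> C) (z l : C) : Prop :=
  forall e, 0 < e -> exists d, 0 < d /\ forall w, Cmod (w - z) < d ->
    Cmod (f w - f z - l * (w - z)) <= e * Cmod (w - z).

Definition ccont (f : C -> C) (z : C) : Prop :=
  forall e, 0 < e -> exists d, 0 < d /\ forall w, Cmod (w - z) < d ->
    Cmod (f w - f z) < e.

Lemma cderiv_is_derive_ring f z l : cderiv f z l <->
  is_derive (K := C_AbsRing) (V := AbsRing_NormedModule C_AbsRing) f z l.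
Proof.
  assert (E : forall w, norm (minus (minus (f w) (f z)) (scal (minus w z) l)) =
    Cmod (f w - f z - l * (w - z))).
  { intros w. change (Cmod (f w + - f z + - ((w + - z) * l))%C = Cmod (f w - f z - l * (w - z))).
    f_equal. ring. }
  split.
  - intros H. split; [apply is_linear_scal_l | ]. intros x Hx e.
    assert (Ex : x = z).
    { symmetry. apply (is_filter_lim_locally_unique (V := AbsRing_NormedModule C_AbsRing)). exact Hx. }
    subst x. destruct (H e (cond_pos e)) as [d [Hd Hw]].
    exists (mkposreal d Hd). intros w Hb.
    eapply Rle_trans; [right; exact (E w) | exact (Hw w Hb)].
  - intros [_ H] e He. destruct (H z (fun P HP => HP) (mkposreal e He)) as [d Hd].
    exists d. split; [apply cond_pos | ]. intros w Hw.
    eapply Rle_trans; [right; symmetry; exact (E w) | exact (Hd w Hw)].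
Qed.

Lemma cderiv_is_derive f z l :
  cderiv f z l <-> is_derive (K := C_AbsRing) (V := C_NormedModule) f z l.
Proof.
  rewrite cderiv_is_derive_ring.
  split; intros [_ H]; (split; [apply is_linear_scal_l | exact H]).
Qed.

Lemma ccont_continuous f z : ccont f z <->
  continuous (T := AbsRing_UniformSpace C_AbsRing) (U := AbsRing_UniformSpace C_AbsRing) f z.
Proof.
  split.
  - intros H. apply filterlim_locally. intros e. destruct (H e (cond_pos e)) as [d [Hd Hw]].
    exists (mkposreal d Hd). exact Hw.
  - intros H e He. destruct (proj1 (filterlim_locally _ _) H (mkposreal e He)) as [d Hd].
    exists d. split; [apply cond_pos | exact Hd].
Qed.

Lemma cderiv_cont f z l : cderiv f z l -> ccont f z.
Proof.
  intros H. apply cderiv_is_derive_ring in H. apply ccont_continuous.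
  apply (ex_derive_continuous (K := C_AbsRing) (V := AbsRing_NormedModule C_AbsRing)). now exists l.
Qed.

Lemma cderiv_ext_loc f g z l d : 0 < d -> (forall w, Cmod (w - z) < d -> f w = g w) ->
  cderiv f z l -> cderiv g z l.
Proof.
  intros Hd E H e He. destruct (H e He) as [d' [Hd' Hw]].
  exists (Rmin d d'). split; [now apply Rmin_glb_lt | ].
  intros w H1. rewrite <- (E w), <- (E z).
  - apply Hw. eapply Rlt_le_trans; [apply H1 | apply Rmin_r].
  - replace (z - z)%C with (RtoC 0) by ring. now rewrite Cmod_0.
  - eapply Rlt_le_trans; [apply H1 | apply Rmin_l].
Qed.

Lemma ccont_const c z : ccont (fun _ => c) z.
Proof.
  intros e He. exists 1. split; [lra | ]. intros w _.
  replace (c - c)%C with (RtoC 0) by ring. now rewrite Cmod_0.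
Qed.

Lemma ccont_plus f g z : ccont f z -> ccont g z -> ccont (fun w => f w + g w)%C z.
Proof.
  intros Hf Hg. apply ccont_continuous in Hf, Hg. apply ccont_continuous.
  exact (continuous_plus (U := AbsRing_UniformSpace C_AbsRing) (V := AbsRing_NormedModule C_AbsRing) f g z Hf Hg).
Qed.

Lemma ccont_mult f g z : ccont f z -> ccont g z -> ccont (fun w => f w * g w)%C z.
Proof.
  intros Hf Hg. apply ccont_continuous in Hf, Hg. apply ccont_continuous.
  exact (continuous_mult (U := AbsRing_UniformSpace C_AbsRing) (K := C_AbsRing) f g z Hf Hg).
Qed.

Lemma ccont_comp f g z : ccont g z -> ccont f (g z) -> ccont (fun w => f (g w)) z.
Proof.
  intros Hg Hf e He. destruct (Hf e He) as [d [Hd Kd]].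
  destruct (Hg d Hd) as [d' [Hd' Kd']]. exists d'. split; auto.
Qed.

Lemma cderiv_const c z : cderiv (fun _ => c) z 0.
Proof. apply cderiv_is_derive_ring. exact (is_derive_const (K := C_AbsRing) (V := AbsRing_NormedModule C_AbsRing) c z). Qed.

Lemma cderiv_mult f g z a b : cderiv f z a -> cderiv g z b ->
  cderiv (fun w => f w * g w)%C z (a * g z + f z * b).
Proof.
  intros Hf Hg. apply cderiv_is_derive_ring in Hf, Hg. apply cderiv_is_derive_ring.
  exact (is_derive_mult (K := C_AbsRing) f g z a b Hf Hg Cmult_comm).
Qed.

Lemma cderiv_comp f g z a b : cderiv g z b -> cderiv f (g z) a ->
  cderiv (fun w => f (g w)) z (a * b).
Proof.
  intros Hg Hf. apply cderiv_is_derive_ring in Hf, Hg. apply cderiv_is_derive_ring.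
  rewrite Cmult_comm. exact (is_derive_comp (K := C_AbsRing) (V := AbsRing_NormedModule C_AbsRing) f g z a b Hf Hg).
Qed.

(** * Finite sums and series of complex numbers *)

Fixpoint csum (a : nat -> C) (n : nat) : C :=
  match n with O => RtoC 0 | S m => (csum a m + a m)%C end.
Fixpoint rsum (a : nat -> R) (n : nat) : R :=
  match n with O => 0 | S m => rsum a m + a m end.

Lemma csum_ext a b n : (forall k, (k < n)%nat -> a k = b k) -> csum a n = csum b n.
Proof. induction n; intros H; simpl; [easy | ]. rewrite IHn, H; auto. Qed.

Lemma rsum_ext a b n : (forall k, (k < n)%nat -> a k = b k) -> rsum a n = rsum b n.
Proof. induction n; intros H; simpl; [easy | ]. rewrite IHn, H; auto. Qed.

Lemma csum_plus a b n : csum (fun k => a k + b k)%C n = (csum a n + csum b n)%C.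
Proof. induction n; simpl; [ring | rewrite IHn; ring]. Qed.

Lemma csum_scal c a n : csum (fun k => c * a k)%C n = (c * csum a n)%C.
Proof. induction n; simpl; [ring | rewrite IHn; ring]. Qed.

Lemma rsum_plus a b n : rsum (fun k => a k + b k) n = rsum a n + rsum b n.
Proof. induction n; simpl; [ring | rewrite IHn; ring]. Qed.

Lemma rsum_scal c a n : rsum (fun k => c * a k) n = c * rsum a n.
Proof. induction n; simpl; [ring | rewrite IHn; ring]. Qed.

Lemma rsum_le a b n : (forall k, (k < n)%nat -> a k <= b k) -> rsum a n <= rsum b n.
Proof. induction n; intros H; simpl; [lra | ]. apply Rplus_le_compat; auto. Qed.

Lemma rsum_ge0 a n : (forall k, 0 <= a k) -> 0 <= rsum a n.
Proof. intros H. induction n; simpl; [lra | generalize (H n); lra]. Qed.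

Lemma rsum_incr a n m : (forall k, 0 <= a k) -> (n <= m)%nat -> rsum a n <= rsum a m.
Proof. intros H Hnm. induction Hnm; simpl; [lra | generalize (H m); lra]. Qed.

Lemma csum_add a n m : csum a (n + m) = (csum a n + csum (fun k => a (n + k)%nat) m)%C.
Proof. induction m; simpl; [rewrite Nat.add_0_r; ring | ]. rewrite Nat.add_succ_r; simpl. rewrite IHm. ring. Qed.

Lemma rsum_add a n m : rsum a (n + m) = rsum a n + rsum (fun k => a (n + k)%nat) m.
Proof. induction m; simpl; [rewrite Nat.add_0_r; ring | ]. rewrite Nat.add_succ_r; simpl. rewrite IHm. ring. Qed.

Lemma csum_S a n : csum a (S n) = (a O + csum (fun k => a (S k)) n)%C.
Proof. change (S n) with (1 + n)%nat. rewrite (csum_add a 1 n). simpl. ring. Qed.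

Lemma rsum_S a n : rsum a (S n) = a O + rsum (fun k => a (S k)) n.
Proof. change (S n) with (1 + n)%nat. rewrite (rsum_add a 1 n). simpl. ring. Qed.

Lemma Cmod_csum a n : Cmod (csum a n) <= rsum (fun k => Cmod (a k)) n.
Proof.
  induction n; simpl; [rewrite Cmod_0; lra | ].
  eapply Rle_trans; [apply Cmod_triangle | lra].
Qed.

Lemma csum_Re a n : Re (csum a n) = rsum (fun k => Re (a k)) n.
Proof. induction n; simpl; [easy | ]. now rewrite <- IHn. Qed.

Lemma csum_Im a n : Im (csum a n) = rsum (fun k => Im (a k)) n.
Proof. induction n; simpl; [easy | ]. now rewrite <- IHn. Qed.

Lemma sum_n_csum (a : nat -> C) n : sum_n a n = csum a (S n).
Proof.
  induction n.
  - rewrite sum_O. simpl. ring.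
  - rewrite sum_Sn, IHn. easy.
Qed.

Lemma sum_n_rsum (a : nat -> R) n : sum_n a n = rsum a (S n).
Proof.
  induction n.
  - rewrite sum_O. simpl. ring.
  - rewrite sum_Sn, IHn. easy.
Qed.

Lemma rsum_geom q n : q <> 1 -> rsum (fun k => q ^ k) n = (1 - q ^ n) / (1 - q).
Proof. intros H. induction n; simpl; [field; lra | rewrite IHn; field; lra]. Qed.

Lemma rsum_geom_le q n : 0 <= q < 1 -> rsum (fun k => q ^ k) n <= / (1 - q).
Proof.
  intros H. rewrite rsum_geom by lra. unfold Rdiv. rewrite <- (Rmult_1_l (/ (1 - q))) at 2.
  apply Rmult_le_compat_r; [left; apply Rinv_0_lt_compat; lra | ].
  generalize (pow_le q n). lra.
Qed.

(** Convergence of the partial sums. The total sum [C_series] takes real and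
    imaginary parts separately and carries no information on convergence. *)
Definition cser (a : nat -> C) (l : C) : Prop :=
  forall e, 0 < e -> exists N, forall n, (N <= n)%nat -> Cmod (csum a n - l) < e.

Lemma Re_le_Cmod z : Rabs (Re z) <= Cmod z.
Proof. eapply Rle_trans; [ | apply Rmax_Cmod]. apply Rmax_l. Qed.

Lemma Im_le_Cmod z : Rabs (Im z) <= Cmod z.
Proof. eapply Rle_trans; [ | apply Rmax_Cmod]. apply Rmax_r. Qed.

Lemma Cmod_le_ReIm z : Cmod z <= Rabs (Re z) + Rabs (Im z).
Proof.
  replace z with (RtoC (Re z) + Ci * RtoC (Im z))%C at 1.
  2: { destruct z; unfold Ci, RtoC; apply injective_projections; simpl; ring. }
  eapply Rle_trans; [apply Cmod_triangle | ].
  rewrite Cmod_mult, Cmod_Ci, !Cmod_R. lra.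
Qed.

Lemma cser_unique a l l' : cser a l -> cser a l' -> l = l'.
Proof.
  intros H H'. assert (Cmod (l - l') = 0).
  { apply Rle_antisym; [ | apply Cmod_ge_0]. apply le_all_eps. intros e He.
    destruct (H (e / 2)) as [N1 K1]; [lra | ]. destruct (H' (e / 2)) as [N2 K2]; [lra | ].
    specialize (K1 (N1 + N2)%nat ltac:(lia)). specialize (K2 (N1 + N2)%nat ltac:(lia)).
    replace (l - l')%C with ((csum a (N1 + N2) - l') - (csum a (N1 + N2) - l))%C by ring.
    eapply Rle_trans; [apply Cmod_triangle | ]. rewrite Cmod_opp. lra. }
  apply Cmod_eq_0 in H0. replace l with ((l - l') + l')%C by ring. rewrite H0. ring.
Qed.

Lemma cser_C_series a l : cser a l -> C_series a = l.
Proof.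
  intros H. unfold C_series.
  assert (G : forall p : C -> R, (forall n, p (csum a n) = rsum (fun k => p (a k)) n) ->
      (forall z w, Rabs (p z - p w) <= Cmod (z - w)) ->
      Series (fun n => p (a n)) = p l).
  { intros p Hp Hp'. apply is_series_unique.
    change (is_lim_seq (sum_n (fun n => p (a n))) (p l)).
    apply (is_lim_seq_ext (fun n => p (csum a (S n)))).
    { intros n. rewrite Hp. symmetry. apply sum_n_rsum. }
    apply is_lim_seq_spec. intros e. destruct (H e (cond_pos e)) as [N HN].
    exists N. intros n Hn. eapply Rle_lt_trans; [apply Hp' | apply HN; lia]. }
  destruct l as [x y]. f_equal.
  - apply (G Re); [apply csum_Re | ]. intros z w.
    replace (Re z - Re w) with (Re (z - w)) by easy. apply Re_le_Cmod.
  - apply (G Im); [apply csum_Im | ]. intros z w.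
    replace (Im z - Im w) with (Im (z - w)) by easy. apply Im_le_Cmod.
Qed.

Lemma rsum_abs_conv (b : nat -> R) (B : R) : (forall n, rsum (fun k => Rabs (b k)) n <= B) ->
  is_series b (Series b).
Proof.
  intros H. apply Series_correct. apply ex_series_Rabs.
  destruct (ex_finite_lim_seq_incr (sum_n (fun k => Rabs (b k))) B) as [l Hl].
  - intros n. rewrite sum_Sn. unfold plus; simpl. generalize (Rabs_pos (b (S n))). lra.
  - intros n. rewrite sum_n_rsum. apply H.
  - exists l. exact Hl.
Qed.

Lemma cser_exists a B : (forall n, rsum (fun k => Cmod (a k)) n <= B) -> cser a (C_series a).
Proof.
  intros H e He.
  assert (H1 : is_series (fun k => Re (a k)) (Series (fun k => Re (a k)))).
  { apply rsum_abs_conv with B. intros n. eapply Rle_trans; [ | apply (H n)].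
    apply rsum_le. intros; apply Re_le_Cmod. }
  assert (H2 : is_series (fun k => Im (a k)) (Series (fun k => Im (a k)))).
  { apply rsum_abs_conv with B. intros n. eapply Rle_trans; [ | apply (H n)].
    apply rsum_le. intros; apply Im_le_Cmod. }
  assert (E2 : 0 < e / 2) by lra.
  change (is_lim_seq (sum_n (fun k => Re (a k))) (Series (fun k => Re (a k)))) in H1.
  change (is_lim_seq (sum_n (fun k => Im (a k))) (Series (fun k => Im (a k)))) in H2.
  destruct (proj2 (is_lim_seq_spec _ _) H1 (mkposreal _ E2)) as [N1 K1].
  destruct (proj2 (is_lim_seq_spec _ _) H2 (mkposreal _ E2)) as [N2 K2].
  exists (S (N1 + N2)). intros n Hn. destruct n as [ | n]; [lia | ].
  specialize (K1 n ltac:(lia)). specialize (K2 n ltac:(lia)). simpl in K1, K2.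
  rewrite sum_n_rsum in K1, K2.
  eapply Rle_lt_trans; [apply Cmod_le_ReIm | ].
  replace (Re (csum a (S n) - C_series a)) with
     (rsum (fun k => Re (a k)) (S n) - Series (fun k => Re (a k))).
  2: { rewrite <- csum_Re. easy. }
  replace (Im (csum a (S n) - C_series a)) with
     (rsum (fun k => Im (a k)) (S n) - Series (fun k => Im (a k))).
  2: { rewrite <- csum_Im. easy. }
  lra.
Qed.

Lemma cser_ext a b l : (forall n, a n = b n) -> cser a l -> cser b l.
Proof.
  intros E H e He. destruct (H e He) as [N HN]. exists N. intros n Hn.
  rewrite <- (csum_ext a b); auto.
Qed.

Lemma C_series_ext a b : (forall n, a n = b n) -> C_series a = C_series b.
Proof.
  intros E. unfold C_series. f_equal; apply Series_ext; intros n; now rewrite E.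
Qed.

Lemma cser_plus a b l m : cser a l -> cser b m -> cser (fun n => a n + b n)%C (l + m).
Proof.
  intros H H' e He. destruct (H (e / 2)) as [N1 K1]; [lra | ].
  destruct (H' (e / 2)) as [N2 K2]; [lra | ]. exists (N1 + N2)%nat. intros n Hn.
  specialize (K1 n ltac:(lia)). specialize (K2 n ltac:(lia)). rewrite csum_plus.
  replace (csum a n + csum b n - (l + m))%C with ((csum a n - l) + (csum b n - m))%C by ring.
  eapply Rle_lt_trans; [apply Cmod_triangle | lra].
Qed.

Lemma cser_scal c a l : cser a l -> cser (fun n => c * a n)%C (c * l).
Proof.
  intros H e He. assert (P : 0 < Cmod c + 1) by (generalize (Cmod_ge_0 c); lra).
  destruct (H (e / (Cmod c + 1))) as [N K]; [now apply Rdiv_lt_0_compat | ].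
  exists N. intros n Hn. specialize (K n Hn). rewrite csum_scal.
  replace (c * csum a n - c * l)%C with (c * (csum a n - l))%C by ring.
  rewrite Cmod_mult. apply Rle_lt_trans with ((Cmod c + 1) * Cmod (csum a n - l)).
  - apply Rmult_le_compat_r; [apply Cmod_ge_0 | lra].
  - replace e with ((Cmod c + 1) * (e / (Cmod c + 1))) by (field; lra).
    now apply Rmult_lt_compat_l.
Qed.

Lemma cser_bound a l B : cser a l -> (forall n, Cmod (csum a n) <= B) -> Cmod l <= B.
Proof.
  intros H HB. apply le_all_eps. intros e He. destruct (H e He) as [N K].
  specialize (K N ltac:(lia)).
  replace l with (csum a N - (csum a N - l))%C by ring.
  eapply Rle_trans; [apply Cmod_triangle | ]. rewrite Cmod_opp.
  generalize (HB N). lra.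
Qed.

Lemma cser_abs_bound a l B : cser a l -> (forall n, rsum (fun k => Cmod (a k)) n <= B) -> Cmod l <= B.
Proof.
  intros H HB. apply (cser_bound a); [easy | ]. intros n.
  eapply Rle_trans; [apply Cmod_csum | apply HB].
Qed.

Lemma cser_shift a l N : cser a l -> cser (fun k => a (N + k)%nat) (l - csum a N).
Proof.
  intros H e He. destruct (H e He) as [M K]. exists M. intros n Hn.
  specialize (K (N + n)%nat ltac:(lia)). rewrite csum_add in K.
  replace (csum (fun k => a (N + k)%nat) n - (l - csum a N))%C with
   (csum a N + csum (fun k => a (N + k)%nat) n - l)%C by ring. easy.
Qed.

Lemma cser_unshift a l N : cser (fun k => a (N + k)%nat) l -> cser a (csum a N + l).
Proof.
  intros H e He. destruct (H e He) as [M K]. exists (N + M)%nat. intros n Hn.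
  specialize (K (n - N)%nat ltac:(lia)).
  replace n with (N + (n - N))%nat by lia. rewrite csum_add.
  replace (csum a N + csum (fun k => a (N + k)%nat) (n - N) - (csum a N + l))%C with
   (csum (fun k => a (N + k)%nat) (n - N) - l)%C by ring. easy.
Qed.

Lemma cser_S a l : cser a l -> cser (fun k => a (S k)) (l - a O).
Proof.
  intros H. apply (cser_shift a l 1) in H. simpl in H.
  replace (l - a O)%C with (l - (0 + a O))%C by ring. exact H.
Qed.

Lemma cser_unS a l : cser (fun k => a (S k)) l -> cser a (a O + l).
Proof.
  intros H. replace (a O + l)%C with (csum a 1 + l)%C by (simpl; ring).
  now apply (cser_unshift a l 1).
Qed.

(** * Power series *)

(** The radius of convergence is at least [rho], expressed by boundedness of the
    terms on smaller circles. In this form the property is stable under all the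
    coefficient operations used below. *)
Definition rad (rho : R) (c : nat -> C) : Prop :=
  forall r, 0 <= r < rho -> exists B, forall n, Cmod (c n) * r ^ n <= B.

Definition cps (c : nat -> C) (z : C) : C := C_series (fun n => c n * z ^ n)%C.
Definition deriv_coef (c : nat -> C) (n : nat) : C := (RtoC (INR (S n)) * c (S n))%C.

Lemma rad_summable rho c r : rad rho c -> 0 <= r < rho ->
  exists B, forall n, rsum (fun k => Cmod (c k) * r ^ k) n <= B.
Proof.
  intros H Hr. set (r' := (r + rho) / 2).
  destruct (H r') as [B HB]; [unfold r'; lra | ].
  assert (Hr' : r < r') by (unfold r'; lra). set (q := r / r').
  assert (Hq : 0 <= q < 1).
  { split.
    - apply Rmult_le_pos; [lra | left; apply Rinv_0_lt_compat; lra].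
    - apply Rmult_lt_reg_r with r'; [lra | ]. unfold q. field_simplify; lra. }
  exists (B * / (1 - q)). intros n.
  apply Rle_trans with (rsum (fun k => B * q ^ k) n).
  - apply rsum_le. intros k _.
    replace (r ^ k) with (r' ^ k * q ^ k).
    + rewrite <- Rmult_assoc. apply Rmult_le_compat_r; [now apply pow_le | apply HB].
    + rewrite <- Rpow_mult_distr. f_equal. unfold q. field. lra.
  - rewrite rsum_scal. apply Rmult_le_compat_l.
    + eapply Rle_trans; [ | apply (HB O)]. simpl. generalize (Cmod_ge_0 (c O)). lra.
    + now apply rsum_geom_le.
Qed.

Lemma n_pow_bound q n : 0 <= q < 1 -> INR n * q ^ n <= / (1 - q).
Proof.
  intros Hq. eapply Rle_trans; [ | apply (rsum_geom_le q n Hq)].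
  induction n; [simpl; lra | ]. rewrite S_INR. simpl rsum. simpl pow.
  assert (P := pow_le q n (proj1 Hq)).
  assert (0 <= INR n * q ^ n) by (apply Rmult_le_pos; [apply pos_INR | easy]).
  nra.
Qed.

Lemma rad_scale_n rho c : rad rho c -> rad rho (fun n => RtoC (INR n) * c n)%C.
Proof.
  intros H r Hr. set (r' := (r + rho) / 2).
  destruct (H r') as [B HB]; [unfold r'; lra | ].
  assert (Hr' : r < r') by (unfold r'; lra). set (q := r / r').
  assert (Hq : 0 <= q < 1).
  { split.
    - apply Rmult_le_pos; [lra | left; apply Rinv_0_lt_compat; lra].
    - apply Rmult_lt_reg_r with r'; [lra | ]. unfold q. field_simplify; lra. }
  exists (B * / (1 - q)). intros n.
  rewrite Cmod_mult, Cmod_R, Rabs_pos_eq by apply pos_INR.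
  replace (r ^ n) with (r' ^ n * q ^ n).
  2: { rewrite <- Rpow_mult_distr. f_equal. unfold q. field. lra. }
  replace (INR n * Cmod (c n) * (r' ^ n * q ^ n)) with
     ((Cmod (c n) * r' ^ n) * (INR n * q ^ n)) by ring.
  apply Rmult_le_compat.
  - apply Rmult_le_pos; [apply Cmod_ge_0 | apply pow_le; lra].
  - apply Rmult_le_pos; [apply pos_INR | apply pow_le; lra].
  - apply HB.
  - now apply n_pow_bound.
Qed.

Lemma rad_shift rho c : rad rho c -> rad rho (fun n => c (S n)).
Proof.
  intros H r Hr. set (r' := (r + rho) / 2).
  destruct (H r') as [B HB]; [unfold r'; lra | ].
  assert (Hr' : r < r') by (unfold r'; lra).
  exists (B / r'). intros n.
  apply Rmult_le_reg_r with r'; [lra | ].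
  replace (B / r' * r') with B by (field; lra).
  eapply Rle_trans; [ | apply (HB (S n))]. simpl.
  rewrite Rmult_assoc. apply Rmult_le_compat_l; [apply Cmod_ge_0 | ].
  rewrite Rmult_comm. apply Rmult_le_compat_l; [lra | ]. apply pow_incr. lra.
Qed.

Lemma rad_deriv_coef rho c : rad rho c -> rad rho (deriv_coef c).
Proof. intros H. exact (rad_shift rho _ (rad_scale_n rho c H)). Qed.

Lemma rad_le rho c b : rad rho c -> (forall n, Cmod (b n) <= Cmod (c n)) -> rad rho b.
Proof.
  intros H Hb r Hr. destruct (H r Hr) as [B HB]. exists B. intros n.
  eapply Rle_trans; [ | apply (HB n)]. apply Rmult_le_compat_r; [apply pow_le; lra | apply Hb].
Qed.

Lemma rad_plus rho b c : rad rho b -> rad rho c -> rad rho (fun n => b n + c n)%C.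
Proof.
  intros H K r Hr. destruct (H r Hr) as [B HB]. destruct (K r Hr) as [D HD].
  exists (B + D). intros n. generalize (HB n) (HD n) (Cmod_triangle (b n) (c n)).
  assert (0 <= r ^ n) by (apply pow_le; lra). intros. nra.
Qed.

Lemma rad_scal rho k c : rad rho c -> rad rho (fun n => k * c n)%C.
Proof.
  intros H r Hr. destruct (H r Hr) as [B HB]. exists (Cmod k * B). intros n.
  rewrite Cmod_mult, Rmult_assoc. apply Rmult_le_compat_l; [apply Cmod_ge_0 | apply HB].
Qed.

Lemma rad_bmul rho (k : nat -> C) (M : R) c : (forall n, Cmod (k n) <= M) ->
  rad rho c -> rad rho (fun n => k n * c n)%C.
Proof.
  intros Hk H. apply (rad_le rho (fun n => RtoC M * c n)%C).
  - now apply rad_scal.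
  - intros n. rewrite !Cmod_mult, Cmod_R. apply Rmult_le_compat_r; [apply Cmod_ge_0 | ].
    eapply Rle_trans; [apply Hk | apply Rle_abs].
Qed.

Lemma cps_cser rho c z : rad rho c -> Cmod z < rho -> cser (fun n => c n * z ^ n)%C (cps c z).
Proof.
  intros H Hz. destruct (rad_summable rho c (Cmod z) H) as [B HB].
  { split; [apply Cmod_ge_0 | easy]. }
  apply cser_exists with B. intros n. eapply Rle_trans; [ | apply (HB n)].
  apply rsum_le. intros k _. rewrite Cmod_mult, Cmod_pow. lra.
Qed.

Lemma cps_plus rho b c z : rad rho b -> rad rho c -> Cmod z < rho ->
  cps (fun n => b n + c n)%C z = (cps b z + cps c z)%C.
Proof.
  intros Hb Hc Hz. apply cser_C_series.
  apply (cser_ext (fun n => b n * z ^ n + c n * z ^ n)%C); [intros; ring | ].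
  apply cser_plus; now apply (cps_cser rho).
Qed.

Lemma cps_scal rho k c z : rad rho c -> Cmod z < rho ->
  cps (fun n => k * c n)%C z = (k * cps c z)%C.
Proof.
  intros Hc Hz. apply cser_C_series.
  apply (cser_ext (fun n => k * (c n * z ^ n))%C); [intros; ring | ].
  apply cser_scal; now apply (cps_cser rho).
Qed.

Lemma cps_ext b c z : (forall n, b n = c n) -> cps b z = cps c z.
Proof. intros H. apply C_series_ext. intros n. now rewrite H. Qed.

Lemma cps_0 c : cps c 0 = c O.
Proof.
  apply cser_C_series. intros e He. exists 1%nat. intros n Hn.
  destruct n as [ | n]; [lia | ]. rewrite csum_S.
  rewrite (csum_ext _ (fun _ => RtoC 0 * 0)%C).
  - rewrite csum_scal. simpl. replace (c O * 1 + 0 * csum (fun _ => 0) n - c O)%C with (RtoC 0) by ring.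
    now rewrite Cmod_0.
  - intros k _. simpl. ring.
Qed.

Lemma cps_shift rho c z : rad rho c -> Cmod z < rho ->
  cps c z = (c O + z * cps (fun n => c (S n)) z)%C.
Proof.
  intros Hc Hz. apply cser_C_series.
  replace (c O) with (c O * z ^ 0)%C by (simpl; ring).
  apply (cser_unS (fun n => c n * z ^ n)%C).
  apply (cser_ext (fun n => z * (c (S n) * z ^ n))%C); [intros; simpl; ring | ].
  apply cser_scal. apply (cps_cser rho); [now apply rad_shift | easy].
Qed.

(** Second order Taylor remainder of a power on the disc of radius r, scaled by
    r^2 so that no negative power of r appears; the square of n + 1 is a crude
    bound for the second derivative that the induction reproduces. *)
Lemma pow_second_order (z w : C) r n : 0 <= r -> Cmod z <= r -> Cmod w <= r ->
  r * r * Cmod (w ^ (S n) - z ^ (S n) - RtoC (INR (S n)) * z ^ n * (w - z)) <=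
  INR (S n) * INR (S n) * r ^ (S n) * (Cmod (w - z) * Cmod (w - z)).
Proof.
  intros Hr Hz Hw. induction n.
  - simpl. replace (w * 1 - z * 1 - 1 * 1 * (w - z))%C with (RtoC 0) by ring.
    rewrite Cmod_0. generalize (Cmod_ge_0 (w - z)). intros.
    assert (0 <= Cmod (w - z) * Cmod (w - z)) by nra. nra.
  - replace (w ^ (S (S n)) - z ^ (S (S n)) - RtoC (INR (S (S n))) * z ^ (S n) * (w - z))%C
    with (w * (w ^ (S n) - z ^ (S n) - RtoC (INR (S n)) * z ^ n * (w - z))
          + RtoC (INR (S n)) * z ^ n * ((w - z) * (w - z)))%C.
    2: { rewrite (S_INR (S n)), RtoC_plus. simpl. ring. }
    set (D := (w ^ (S n) - z ^ (S n) - RtoC (INR (S n)) * z ^ n * (w - z))%C) in *.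
    set (h := Cmod (w - z)) in *.
    assert (Hh : 0 <= h) by apply Cmod_ge_0.
    set (N := INR (S n)) in *. assert (HN : 0 <= N) by apply pos_INR.
    apply Rle_trans with (r * r * (r * Cmod D + N * r ^ n * (h * h))).
    + apply Rmult_le_compat_l; [nra | ].
      eapply Rle_trans; [apply Cmod_triangle | ]. rewrite !Cmod_mult, Cmod_R, Cmod_pow.
      fold h. fold N. rewrite (Rabs_pos_eq N) by easy.
      apply Rplus_le_compat.
      * apply Rmult_le_compat_r; [apply Cmod_ge_0 | easy].
      * apply Rmult_le_compat_r; [nra | ]. apply Rmult_le_compat_l; [easy | ].
        apply pow_incr. split; [apply Cmod_ge_0 | easy].
    + replace (INR (S (S n))) with (N + 1) by (unfold N; now rewrite <- S_INR).
      replace (r * r * (r * Cmod D + N * r ^ n * (h * h))) with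
        (r * (r * r * Cmod D) + N * r ^ (S (S n)) * (h * h)) by (simpl; ring).
      assert (0 <= r ^ (S (S n)) * (h * h)).
      { apply Rmult_le_pos; [now apply pow_le | nra]. }
      assert (r * (r * r * Cmod D) <= r * (N * N * r ^ S n * (h * h))).
      { now apply Rmult_le_compat_l. }
      replace (r * (N * N * r ^ S n * (h * h))) with (N * N * (r ^ (S (S n)) * (h * h))) in H0 by (simpl; ring).
      replace (N * r ^ S (S n) * (h * h)) with (N * (r ^ (S (S n)) * (h * h))) by ring.
      replace ((N + 1) * (N + 1) * r ^ S (S n) * (h * h)) with
         ((N * N + 2 * N + 1) * (r ^ (S (S n)) * (h * h))) by ring.
      nra.
Qed.

(** Termwise differentiation: the remainders of the monomials are summed with
    [pow_second_order], which needs the summability of n^2 |c_n| r^n on a circle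
    of radius r slightly larger than |z|. *)
Lemma cps_derive rho c z : rad rho c -> Cmod z < rho -> cderiv (cps c) z (cps (deriv_coef c) z).
Proof.
  intros Hc Hz e He.
  set (r := (Cmod z + rho) / 2). assert (Pz := Cmod_ge_0 z).
  assert (Hr : Cmod z < r < rho) by (unfold r; lra).
  destruct (rad_summable rho _ r (rad_scale_n _ _ (rad_scale_n _ _ Hc))) as [B HB]; [lra | ].
  assert (PB : 0 <= B). { eapply Rle_trans; [ | apply (HB O)]. simpl; lra. }
  exists (Rmin (r - Cmod z) (e * (r * r) / (B + 1))). split.
  { apply Rmin_glb_lt; [lra | ]. apply Rdiv_lt_0_compat; [ | lra].
    apply Rmult_lt_0_compat; [easy | nra]. }
  intros w Hw.
  assert (Hw1 := Rlt_le_trans _ _ _ Hw (Rmin_l _ _)).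
  assert (Hw2 := Rlt_le_trans _ _ _ Hw (Rmin_r _ _)).
  assert (Hwr : Cmod w <= r).
  { replace w with ((w - z) + z)%C by ring. eapply Rle_trans; [apply Cmod_triangle | lra]. }
  set (h := Cmod (w - z)) in *. assert (Ph : 0 <= h) by apply Cmod_ge_0.
  assert (S1 := cps_cser rho c w Hc ltac:(lra)).
  assert (S2 := cps_cser rho c z Hc ltac:(lra)).
  assert (S3 := cps_cser rho _ z (rad_deriv_coef _ _ Hc) ltac:(lra)).
  set (T := fun n => match n with O => RtoC 0 | S m =>
     (c (S m) * (w ^ (S m) - z ^ (S m) - RtoC (INR (S m)) * z ^ m * (w - z)))%C end).
  assert (S4 : cser T (cps c w - cps c z - cps (deriv_coef c) z * (w - z))).
  { replace (cps c w - cps c z - cps (deriv_coef c) z * (w - z))%C with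
      (T O + ((cps c w - c O * w ^ 0) + (- (1)) * (cps c z - c O * z ^ 0)
        + (- (w - z)) * cps (deriv_coef c) z))%C by (simpl; ring).
    apply cser_unS.
    apply (cser_ext (fun n => (c (S n) * w ^ (S n)) + (- (1)) * (c (S n) * z ^ (S n))
         + (- (w - z)) * (deriv_coef c n * z ^ n))%C).
    { intros n. unfold T, deriv_coef. ring. }
    apply cser_plus; [apply cser_plus | ].
    - exact (cser_S _ _ S1).
    - apply cser_scal. exact (cser_S _ _ S2).
    - apply cser_scal. exact S3. }
  apply Rmult_le_reg_l with (r * r); [nra | ].
  apply Rle_trans with (B * (h * h)).
  - rewrite Rmult_comm.
    apply Rle_trans with (B * (h * h) / (r * r) * (r * r)).
    2: { right; field; nra. }
    apply Rmult_le_compat_r; [nra | ].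
    apply (cser_abs_bound _ _ _ S4). intros n.
    apply Rmult_le_reg_r with (r * r); [nra | ].
    replace (B * (h * h) / (r * r) * (r * r)) with ((h * h) * B) by (field; nra).
    eapply Rle_trans; [ | apply Rmult_le_compat_l; [nra | apply (HB n)]].
    rewrite Rmult_comm, <- !rsum_scal. apply rsum_le. intros k _.
    destruct k as [ | k].
    + simpl. rewrite Cmod_0.
      apply Rle_trans with 0; [lra | ]. apply Rmult_le_pos; [nra | ].
      apply Rmult_le_pos; [apply Cmod_ge_0 | lra].
    + unfold T. rewrite !Cmod_mult.
      assert (Q := pow_second_order z w r k ltac:(lra) ltac:(lra) Hwr).
      fold h in Q. rewrite !Cmod_R, !(Rabs_pos_eq (INR (S k))) by apply pos_INR.
      assert (Pc := Cmod_ge_0 (c (S k))).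
      apply Rmult_le_compat_l with (r := Cmod (c (S k))) in Q; [ | easy].
      lra.
  - replace (r * r * (e * h)) with ((e * (r * r)) * h) by ring.
    rewrite <- Rmult_assoc. apply Rmult_le_compat_r; [easy | ].
    apply Rle_trans with ((B + 1) * (e * (r * r) / (B + 1))).
    + apply Rmult_le_compat; lra.
    + right; field; lra.
Qed.

(** * Averages over circles and Fourier coefficients *)

Definition contC (u : R -> C) : Prop := contR (fun t => Re (u t)) /\ contR (fun t => Im (u t)).

Lemma contC_eps u : contC u <-> forall t e, 0 < e -> exists d, 0 < d /\
  forall s, Rabs (s - t) < d -> Cmod (u s - u t) < e.
Proof.
  split.
  - intros [H1 H2] t e He.
    destruct (proj1 (contR_eps _ t) (H1 t) (e / 2)) as [d1 [D1 K1]]; [lra | ].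
    destruct (proj1 (contR_eps _ t) (H2 t) (e / 2)) as [d2 [D2 K2]]; [lra | ].
    exists (Rmin d1 d2). split; [now apply Rmin_glb_lt | ]. intros s Hs.
    eapply Rle_lt_trans; [apply Cmod_le_ReIm | ].
    specialize (K1 s (Rlt_le_trans _ _ _ Hs (Rmin_l _ _))).
    specialize (K2 s (Rlt_le_trans _ _ _ Hs (Rmin_r _ _))).
    unfold Re, Im in *. simpl in *. unfold Rminus in *. lra.
  - intros H. split; intros t; apply contR_eps; intros e He;
    destruct (H t e He) as [d [Hd K]]; exists d; split; try easy; intros s Hs;
    eapply Rle_lt_trans; [ | apply (K s Hs) | | apply (K s Hs)].
    + apply (Re_le_Cmod (u s - u t)).
    + apply (Im_le_Cmod (u s - u t)).
Qed.

Lemma contC_const c : contC (fun _ => c).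
Proof. split; apply contR_const. Qed.

Lemma contC_plus u v : contC u -> contC v -> contC (fun t => u t + v t)%C.
Proof. intros [H1 H2] [H3 H4]. split; simpl; now apply contR_plus. Qed.

Lemma contC_minus u v : contC u -> contC v -> contC (fun t => u t - v t)%C.
Proof. intros [H1 H2] [H3 H4]. split; simpl; now apply contR_minus. Qed.

Lemma contC_mult u v : contC u -> contC v -> contC (fun t => u t * v t)%C.
Proof.
  intros [H1 H2] [H3 H4]. split; simpl.
  - apply contR_minus; now apply contR_mult.
  - apply contR_plus; now apply contR_mult.
Qed.

Lemma contC_conj u : contC u -> contC (fun t => Cconj (u t)).
Proof. intros [H1 H2]. split; simpl; [easy | now apply contR_opp]. Qed.

Lemma contC_RtoC u : contR u -> contC (fun t => RtoC (u t)).
Proof. intros H. split; simpl; [easy | apply contR_const]. Qed.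

Lemma contC_pow u n : contC u -> contC (fun t => u t ^ n)%C.
Proof. intros H. induction n; simpl; [apply contC_const | now apply contC_mult]. Qed.

Lemma contC_comp f u : contC u -> (forall t, ccont f (u t)) -> contC (fun t => f (u t)).
Proof.
  intros Hu Hf. apply contC_eps. intros t e He. destruct (Hf t e He) as [d [Hd K]].
  destruct (proj1 (contC_eps u) Hu t d Hd) as [d' [Hd' K']]. exists d'. split; auto.
Qed.

Lemma contC_ext u v : (forall t, u t = v t) -> contC u -> contC v.
Proof.
  intros E H. apply contC_eps. intros t e He.
  destruct (proj1 (contC_eps u) H t e He) as [d [Hd K]]. exists d. split; [easy | ].
  intros s Hs. rewrite <- !E. auto.
Qed.

Lemma contC_Cmod u : contC u -> contR (fun t => Cmod (u t)).
Proof.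
  intros H t. apply contR_eps. intros e He.
  destruct (proj1 (contC_eps u) H t e He) as [d [Hd K]]. exists d. split; [easy | ].
  intros s Hs. eapply Rle_lt_trans; [ | apply (K s Hs)].
  apply Rabs_le. split.
  - assert (Cmod (u t) <= Cmod (u s) + Cmod (u s - u t)); [ | lra].
    replace (u t) with (u s + - (u s - u t))%C at 1 by ring.
    eapply Rle_trans; [apply Cmod_triangle | ]. rewrite Cmod_opp. lra.
  - assert (Cmod (u s) <= Cmod (u t) + Cmod (u s - u t)); [ | lra].
    replace (u s) with (u t + (u s - u t))%C at 1 by ring. apply Cmod_triangle.
Qed.

Lemma contC_csum (a : nat -> R -> C) n : (forall k, contC (a k)) -> contC (fun t => csum (fun k => a k t) n).
Proof. intros H. induction n; simpl; [apply contC_const | now apply contC_plus]. Qed.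

Definition Cavg (u : R -> C) : C := (avg (fun t => Re (u t)), avg (fun t => Im (u t))).

Lemma Cavg_ext u v : (forall t, u t = v t) -> Cavg u = Cavg v.
Proof. intros H. unfold Cavg. f_equal; apply avg_ext; intros; now rewrite H. Qed.

Lemma Cavg_const c : Cavg (fun _ => c) = c.
Proof. unfold Cavg. rewrite !avg_const. now destruct c. Qed.

Lemma Cavg_plus u v : contC u -> contC v -> Cavg (fun t => u t + v t)%C = (Cavg u + Cavg v)%C.
Proof.
  intros [H1 H2] [H3 H4]. unfold Cavg. apply injective_projections.
  - exact (avg_plus _ _ H1 H3).
  - exact (avg_plus _ _ H2 H4).
Qed.

Lemma Cavg_scal c u : contC u -> Cavg (fun t => c * u t)%C = (c * Cavg u)%C.
Proof.
  intros [H1 H2]. unfold Cavg. destruct c as [a b].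
  apply injective_projections.
  - change (avg (fun t => a * Re (u t) - b * Im (u t)) =
      a * avg (fun t => Re (u t)) - b * avg (fun t => Im (u t))).
    rewrite avg_minus, !avg_scal; auto using contR_mult, contR_const.
  - change (avg (fun t => a * Im (u t) + b * Re (u t)) =
      a * avg (fun t => Im (u t)) + b * avg (fun t => Re (u t))).
    rewrite avg_plus, !avg_scal; auto using contR_mult, contR_const.
Qed.

Lemma Cavg_minus u v : contC u -> contC v -> Cavg (fun t => u t - v t)%C = (Cavg u - Cavg v)%C.
Proof.
  intros H1 H2. rewrite (Cavg_ext _ (fun t => u t + (- (1)) * v t)%C) by (intros; ring).
  rewrite Cavg_plus, Cavg_scal; auto using contC_mult, contC_const. ring.
Qed.

Lemma Cavg_conj u : contC u -> Cavg (fun t => Cconj (u t)) = Cconj (Cavg u).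
Proof. intros [H1 H2]. apply injective_projections; [easy | exact (avg_opp _ H2)]. Qed.

Lemma Cavg_RtoC u : Cavg (fun t => RtoC (u t)) = RtoC (avg u).
Proof. unfold Cavg, RtoC. simpl. now rewrite avg_const. Qed.

Lemma Cavg_csum (a : nat -> R -> C) n : (forall k, contC (a k)) ->
  Cavg (fun t => csum (fun k => a k t) n) = csum (fun k => Cavg (a k)) n.
Proof.
  intros H. induction n; simpl; [apply Cavg_const | ].
  rewrite Cavg_plus by (auto; now apply contC_csum). now rewrite IHn.
Qed.

Lemma unimodular_rotation (z : C) : exists m, Cmod m = 1 /\ (m * z = RtoC (Cmod z))%C.
Proof.
  destruct (Req_dec (Cmod z) 0) as [E | E].
  - exists (RtoC 1). rewrite Cmod_1. split; [easy | ].
    rewrite E, (Cmod_eq_0 z E). ring.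
  - assert (Hz : z <> 0) by (intros ->; now rewrite Cmod_0 in E).
    exists (RtoC (Cmod z) / z)%C. rewrite Cmod_div by easy.
    rewrite Cmod_R, Rabs_pos_eq by apply Cmod_ge_0. split; field; easy.
Qed.

Lemma Re_RtoC_mult a z : Re (RtoC a * z) = a * Re z.
Proof. unfold Re. simpl. ring. Qed.

(** After a rotation the average is its own real part, and the real inequality
    applies. *)
Lemma Cmod_Cavg u : contC u -> Cmod (Cavg u) <= avg (fun t => Cmod (u t)).
Proof.
  intros H. destruct (unimodular_rotation (Cavg u)) as [m [Hm E]].
  replace (Cmod (Cavg u)) with (Re (m * Cavg u)) by now rewrite E.
  rewrite <- Cavg_scal by easy.
  apply Rle_trans with (avg (fun t => Re (m * u t)%C)); [right; reflexivity | ].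
  assert (H' : contC (fun t => m * u t)%C) by auto using contC_mult, contC_const.
  apply avg_le; [apply H' | now apply contC_Cmod | ].
  intros t. eapply Rle_trans; [apply Rle_abs | ].
  eapply Rle_trans; [apply Re_le_Cmod | ]. rewrite Cmod_mult, Hm. lra.
Qed.

Lemma rsum_tail b B : (forall k, 0 <= b k) -> (forall n, rsum b n <= B) ->
  forall e, 0 < e -> exists N, forall n m, (N <= n)%nat -> rsum (fun k => b (n + k)%nat) m <= e.
Proof.
  intros Hb HB e He.
  destruct (ex_finite_lim_seq_incr (rsum b) B) as [l Hl].
  - intros n. simpl. generalize (Hb n). lra.
  - easy.
  - destruct (proj2 (is_lim_seq_spec _ _) Hl (mkposreal e He)) as [N HN]. simpl in HN.
    exists N. intros n m Hn.
    assert (L : rsum b (n + m) <= l).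
    { apply (is_lim_seq_incr_compare (rsum b) l); [exact Hl | ].
      intros k. simpl. generalize (Hb k). lra. }
    rewrite rsum_add in L. specialize (HN n Hn). apply Rabs_def2 in HN. lra.
Qed.

(** Termwise integration by the Weierstrass criterion. *)
Lemma Cavg_series (a : nat -> R -> C) u b B :
  (forall n, contC (a n)) -> contC u ->
  (forall n t, 0 <= t <= 2 * PI -> Cmod (a n t) <= b n) ->
  (forall n, rsum b n <= B) -> (forall t, cser (fun n => a n t) (u t)) ->
  cser (fun n => Cavg (a n)) (Cavg u).
Proof.
  intros Ha Hu Hb HB Hs e He.
  assert (Hb0 : forall k, 0 <= b k) by (intros k; eapply Rle_trans; [apply Cmod_ge_0 | apply (Hb k 0); generalize two_pi_gt0; lra]).
  destruct (rsum_tail b B Hb0 HB (e / 2)) as [N HN]; [lra | ].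
  exists N. intros n Hn. rewrite <- (Cavg_csum a n Ha).
  rewrite <- (Cavg_minus _ _ (contC_csum a n Ha) Hu).
  apply Rle_lt_trans with (e / 2); [ | lra].
  assert (K : contC (fun t => csum (fun k => a k t) n - u t)%C)
    by (apply contC_minus; [now apply contC_csum | easy]).
  eapply Rle_trans; [now apply Cmod_Cavg | ].
  rewrite <- (avg_const (e / 2)). apply avg_le_loc; [now apply contC_Cmod | apply contR_const | ].
  intros t Ht. rewrite <- Cmod_opp.
  replace (- (csum (fun k => a k t) n - u t))%C with (u t - csum (fun k => a k t) n)%C by ring.
  apply (cser_abs_bound _ _ _ (cser_shift _ _ n (Hs t))). intros m.
  eapply Rle_trans; [ | apply (HN n m Hn)]. apply rsum_le. intros; now apply Hb.
Qed.

Definition expi (t : R) : C := (cos t, sin t).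

Lemma circle_pt_expi r t : circle_pt r t = (RtoC r * expi t)%C.
Proof. unfold circle_pt, expi, RtoC. apply injective_projections; simpl; ring. Qed.

Lemma Cmod_expi t : Cmod (expi t) = 1.
Proof.
  unfold Cmod, expi. transitivity (sqrt 1); [f_equal; simpl | apply sqrt_1].
  generalize (sin2_cos2 t). unfold Rsqr. lra.
Qed.

Lemma expi_neq0 t : expi t <> 0.
Proof. intros E. generalize (Cmod_expi t). rewrite E, Cmod_0. lra. Qed.

Lemma expi_conj t : (expi t * Cconj (expi t) = 1)%C.
Proof.
  apply injective_projections; simpl; [ | ring].
  generalize (sin2_cos2 t). unfold Rsqr. lra.
Qed.

Lemma Cconj_pow z n : (Cconj (z ^ n) = Cconj z ^ n)%C.
Proof.
  induction n; simpl.
  - apply injective_projections; simpl; ring.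
  - now rewrite Cmult_conj, IHn.
Qed.

Lemma expi_pow t n : (expi t ^ n = expi (INR n * t))%C.
Proof.
  induction n.
  - simpl. rewrite Rmult_0_l. unfold expi. now rewrite cos_0, sin_0.
  - replace (INR (S n) * t) with (t + INR n * t) by (rewrite S_INR; ring).
    rewrite Cpow_S, IHn. unfold expi. rewrite cos_plus, sin_plus.
    apply injective_projections; simpl; ring.
Qed.

Lemma expi_2pi : expi (2 * PI) = expi 0.
Proof. unfold expi. now rewrite cos_2PI, sin_2PI, cos_0, sin_0. Qed.

Lemma contC_expi : contC expi.
Proof. split; simpl; [apply contR_cos | apply contR_sin]. Qed.

Lemma contC_circle r : contC (circle_pt r).
Proof.
  apply (contC_ext (fun t => RtoC r * expi t)%C).
  - intros; now rewrite circle_pt_expi.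
  - apply contC_mult; [apply contC_const | apply contC_expi].
Qed.

Lemma Cmod_circle r t : 0 <= r -> Cmod (circle_pt r t) = r.
Proof. intros H. rewrite circle_pt_expi, Cmod_mult, Cmod_R, Cmod_expi, Rabs_pos_eq; lra. Qed.

Lemma circle_pow r t n : (circle_pt r t ^ n = RtoC (r ^ n) * expi t ^ n)%C.
Proof. now rewrite circle_pt_expi, Cpow_mult_l, RtoC_pow. Qed.

(** The average of a derivative of a periodic function is 0. This is the source
    of the orthogonality relations and of Cauchy's formula. *)
Lemma avg_derive (U u : R -> R) : (forall t, is_derive U t (u t)) -> contR u ->
  U (2 * PI) = U 0 -> avg u = 0.
Proof.
  intros H Hu E. unfold avg.
  rewrite (is_RInt_unique u 0 (2 * PI) (minus (U (2 * PI)) (U 0))).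
  - rewrite E. unfold minus, plus, opp; simpl. ring.
  - apply (is_RInt_derive (V := R_CompleteNormedModule)); intros; [apply H | apply Hu].
Qed.

Lemma sin_2npi n : sin (INR n * (2 * PI)) = 0.
Proof.
  replace (INR n * (2 * PI)) with (0 + 2 * INR n * PI) by ring.
  now rewrite sin_period, sin_0.
Qed.

Lemma cos_2npi n : cos (INR n * (2 * PI)) = 1.
Proof.
  replace (INR n * (2 * PI)) with (0 + 2 * INR n * PI) by ring.
  now rewrite cos_period, cos_0.
Qed.

Lemma Cavg_expi_pow n : Cavg (fun t => expi t ^ (S n))%C = 0.
Proof.
  assert (Hn : 0 < INR (S n)) by apply lt_0_INR, Nat.lt_0_succ.
  rewrite (Cavg_ext _ (fun t => expi (INR (S n) * t))) by (intros; apply expi_pow).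
  unfold Cavg, RtoC. set (k := INR (S n)) in *. simpl. f_equal.
  - apply (avg_derive (fun t => / k * sin (k * t))).
    + intros t. auto_derive; [easy | field; lra].
    + apply (contR_comp cos (fun t => k * t)); [ | intros t; apply continuous_cos].
      apply contR_mult; [apply contR_const | ]. intros t. apply continuous_id.
    + unfold k. rewrite sin_2npi, !Rmult_0_r, sin_0. ring.
  - apply (avg_derive (fun t => - / k * cos (k * t))).
    + intros t. auto_derive; [easy | field; lra].
    + apply (contR_comp sin (fun t => k * t)); [ | intros t; apply continuous_sin].
      apply contR_mult; [apply contR_const | ]. intros t. apply continuous_id.
    + unfold k. rewrite cos_2npi, Rmult_0_r, cos_0. ring.
Qed.

Lemma Cavg_conj_expi_pow n : Cavg (fun t => Cconj (expi t) ^ (S n))%C = 0.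
Proof.
  rewrite (Cavg_ext _ (fun t => Cconj (expi t ^ (S n)))%C) by (intros; symmetry; apply Cconj_pow).
  rewrite Cavg_conj by (apply contC_pow, contC_expi). rewrite Cavg_expi_pow.
  apply injective_projections; simpl; ring.
Qed.

Lemma expi_conj_pow t n k :
  (expi t ^ (n + k) * Cconj (expi t) ^ k = expi t ^ n)%C /\
  (expi t ^ k * Cconj (expi t) ^ (n + k) = Cconj (expi t) ^ n)%C.
Proof.
  rewrite !Cpow_add_r.
  assert (E : (expi t ^ k * Cconj (expi t) ^ k = 1)%C).
  { rewrite <- Cpow_mult_l, expi_conj. apply Cpow_1_l. }
  split.
  - replace (expi t ^ n * expi t ^ k * Cconj (expi t) ^ k)%C with
      (expi t ^ n * (expi t ^ k * Cconj (expi t) ^ k))%C by ring. rewrite E. ring.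
  - replace (expi t ^ k * (Cconj (expi t) ^ n * Cconj (expi t) ^ k))%C with
      (Cconj (expi t) ^ n * (expi t ^ k * Cconj (expi t) ^ k))%C by ring. rewrite E. ring.
Qed.

Lemma Cavg_orth n m : Cavg (fun t => expi t ^ n * Cconj (expi t) ^ m)%C =
  (if Nat.eq_dec n m then 1 else 0).
Proof.
  destruct (Nat.eq_dec n m) as [<- | Hn].
  - rewrite <- (Cavg_const 1). apply Cavg_ext. intros t.
    rewrite <- Cpow_mult_l, expi_conj. apply Cpow_1_l.
  - destruct (Nat.le_gt_cases n m) as [H | H].
    + rewrite <- (Cavg_conj_expi_pow (m - n - 1)). apply Cavg_ext. intros t.
      replace m with (S (m - n - 1) + n)%nat at 1 by lia. apply expi_conj_pow.
    + rewrite <- (Cavg_expi_pow (n - m - 1)). apply Cavg_ext. intros t.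
      replace n with (S (n - m - 1) + m)%nat at 1 by lia. apply expi_conj_pow.
Qed.

Lemma contC_cps rho c r : rad rho c -> 0 <= r < rho -> contC (fun t => cps c (circle_pt r t)).
Proof.
  intros Hc Hr. apply (contC_comp (cps c)); [apply contC_circle | ]. intros t.
  apply (cderiv_cont _ _ (cps (deriv_coef c) (circle_pt r t))).
  apply (cps_derive rho); [easy | ]. rewrite Cmod_circle; lra.
Qed.

Lemma cser_single (a : nat -> C) n : (forall k, k <> n -> a k = 0) -> cser a (a n).
Proof.
  intros H e He. exists (S n). intros m Hm.
  replace (csum a m - a n)%C with (RtoC 0); [now rewrite Cmod_0 | ].
  replace m with (S n + (m - S n))%nat by lia. rewrite csum_add.
  assert (Z : forall (b : nat -> C) j, (forall k, (k < j)%nat -> b k = 0) -> csum b j = 0).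
  { intros b j Hb. induction j; simpl; [easy | ]. rewrite IHj, Hb by auto. ring. }
  rewrite (Z (fun k => a (S n + k)%nat)) by (intros; apply H; lia).
  simpl. rewrite (Z a n) by (intros; apply H; lia). ring.
Qed.

Lemma Cavg_cps_gen rho c r (v : R -> C) : rad rho c -> 0 <= r < rho -> contC v -> (forall t, Cmod (v t) <= 1) ->
  cser (fun k => c k * RtoC (r ^ k) * Cavg (fun t => expi t ^ k * v t))%C
    (Cavg (fun t => cps c (circle_pt r t) * v t)%C).
Proof.
  intros Hc Hr Hv Hv1. destruct (rad_summable rho c r Hc Hr) as [B HB].
  apply (cser_ext (fun k => Cavg (fun t => (c k * RtoC (r ^ k)) * (expi t ^ k * v t))%C)).
  { intros k. rewrite Cavg_scal; [easy | ]. apply contC_mult; [apply contC_pow, contC_expi | easy]. }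
  apply (Cavg_series _ _ (fun k => Cmod (c k) * r ^ k) B); [ | | | easy | ].
  - intros k. apply contC_mult; [apply contC_const | ]. apply contC_mult; [apply contC_pow, contC_expi | easy].
  - apply contC_mult; [now apply (contC_cps rho) | easy].
  - intros k t _. rewrite !Cmod_mult, Cmod_pow, Cmod_expi, pow1, Cmod_R, Rabs_pos_eq by (apply pow_le; lra).
    assert (0 <= Cmod (c k) * r ^ k) by (apply Rmult_le_pos; [apply Cmod_ge_0 | apply pow_le; lra]).
    generalize (Hv1 t) (Cmod_ge_0 (v t)). intros. nra.
  - intros t. apply (cser_ext (fun k => v t * (c k * circle_pt r t ^ k))%C).
    + intros k. rewrite circle_pow. ring.
    + rewrite Cmult_comm. apply cser_scal. apply (cps_cser rho); [easy | ].
      rewrite Cmod_circle; lra.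
Qed.

Lemma Cmod_expi_pow t n : Cmod (expi t ^ n) = 1.
Proof. rewrite Cmod_pow, Cmod_expi. apply pow1. Qed.

Lemma Cmod_cexpi_pow t n : Cmod (Cconj (expi t) ^ n) = 1.
Proof. rewrite Cmod_pow, Cmod_conj, Cmod_expi. apply pow1. Qed.

(** On the circle of radius r a power series is an absolutely convergent
    trigonometric series without negative frequencies; this lemma and
    [Cavg_cps_neg] read off its Fourier coefficients. *)
Lemma Cavg_cps_coef rho c r n : rad rho c -> 0 <= r < rho ->
  Cavg (fun t => cps c (circle_pt r t) * Cconj (expi t) ^ n)%C = (c n * RtoC (r ^ n))%C.
Proof.
  intros Hc Hr.
  assert (H := Cavg_cps_gen rho c r (fun t => Cconj (expi t) ^ n)%C Hc Hr).
  symmetry. eapply cser_unique; [ | apply H].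
  - assert (S := cser_single (fun k => c k * RtoC (r ^ k) * (if Nat.eq_dec k n then 1 else 0))%C n).
    cbv beta in S. destruct (Nat.eq_dec n n) as [_ | ]; [ | easy].
    rewrite Cmult_1_r in S. eapply cser_ext; [ | apply S].
    + intros k. cbv beta. now rewrite Cavg_orth.
    + intros k Hk. destruct (Nat.eq_dec k n); [easy | ring].
  - apply contC_pow, contC_conj, contC_expi.
  - intros t. rewrite Cmod_cexpi_pow. lra.
Qed.

Lemma Cavg_cps_neg rho c r n : rad rho c -> 0 <= r < rho ->
  Cavg (fun t => cps c (circle_pt r t) * expi t ^ (S n))%C = 0.
Proof.
  intros Hc Hr.
  assert (H := Cavg_cps_gen rho c r (fun t => expi t ^ (S n))%C Hc Hr).
  eapply cser_unique; [apply H | ].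
  - apply contC_pow, contC_expi.
  - intros t. rewrite Cmod_expi_pow. lra.
  - apply (cser_ext (fun _ => RtoC 0)); [ | apply (cser_single (fun _ => RtoC 0) 0%nat); easy].
    intros k. rewrite (Cavg_ext _ (fun t => expi t ^ (S (k + n)))%C).
    + rewrite Cavg_expi_pow. ring.
    + intros t. rewrite <- Cpow_add_r. f_equal. lia.
Qed.

Lemma Cavg_cps rho c r : rad rho c -> 0 <= r < rho ->
  Cavg (fun t => cps c (circle_pt r t)) = c O.
Proof.
  intros Hc Hr. assert (H := Cavg_cps_coef rho c r 0 Hc Hr). simpl in H.
  rewrite Cmult_1_r in H. rewrite <- H. apply Cavg_ext. intros; ring.
Qed.

(** * Derivatives along curves and joint continuity *)

(** Derivative of a curve in C, with the explicit remainder that composes with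
    [cderiv]. *)
Definition vderiv (g : R -> C) (t : R) (v : C) : Prop :=
  forall e, 0 < e -> exists d, 0 < d /\ forall s, Rabs (s - t) < d ->
    Cmod (g s - g t - RtoC (s - t) * v) <= e * Rabs (s - t).

Lemma vderiv_comp f g t l v : vderiv g t v -> cderiv f (g t) l ->
  vderiv (fun s => f (g s)) t (l * v).
Proof.
  intros Hg Hf e He.
  set (B := Cmod v + 1). set (A := Cmod l + 1).
  assert (HB : 0 < B) by (generalize (Cmod_ge_0 v); unfold B; lra).
  assert (HA : 0 < A) by (generalize (Cmod_ge_0 l); unfold A; lra).
  destruct (Hf (e / (2 * B))) as [d1 [H1 K1]]; [apply Rdiv_lt_0_compat; lra | ].
  destruct (Hg (Rmin 1 (e / (2 * A)))) as [d2 [H2 K2]].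
  { apply Rmin_glb_lt; [lra | apply Rdiv_lt_0_compat; lra]. }
  exists (Rmin d2 (d1 / B)). split.
  { apply Rmin_glb_lt; [easy | now apply Rdiv_lt_0_compat]. }
  intros s Hs.
  specialize (K2 s (Rlt_le_trans _ _ _ Hs (Rmin_l _ _))).
  assert (K3 := Rlt_le_trans _ _ _ Hs (Rmin_r _ _)).
  set (h := Rabs (s - t)) in *. assert (P : 0 <= h) by apply Rabs_pos.
  set (w := g s) in *. set (z := g t) in *.
  assert (K4 : Cmod (w - z - RtoC (s - t) * v) <= 1 * h).
  { eapply Rle_trans; [apply K2 | apply Rmult_le_compat_r; [easy | apply Rmin_l]]. }
  assert (K5 : Cmod (w - z - RtoC (s - t) * v) <= e / (2 * A) * h).
  { eapply Rle_trans; [apply K2 | apply Rmult_le_compat_r; [easy | apply Rmin_r]]. }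
  assert (K6 : Cmod (w - z) <= B * h).
  { replace (w - z)%C with ((w - z - RtoC (s - t) * v) + RtoC (s - t) * v)%C by ring.
    eapply Rle_trans; [apply Cmod_triangle | ]. rewrite Cmod_mult, Cmod_R. fold h. unfold B. lra. }
  assert (K7 : Cmod (w - z) < d1).
  { eapply Rle_lt_trans; [apply K6 | ]. replace d1 with (B * (d1 / B)) by (field; lra).
    now apply Rmult_lt_compat_l. }
  specialize (K1 w K7).
  replace (f w - f z - RtoC (s - t) * (l * v))%C with
    ((f w - f z - l * (w - z)) + l * (w - z - RtoC (s - t) * v))%C by ring.
  eapply Rle_trans; [apply Cmod_triangle | ]. rewrite Cmod_mult.
  assert (E1 : e / (2 * B) * Cmod (w - z) <= e / 2 * h).
  { replace (e / 2 * h) with (e / (2 * B) * (B * h)) by (field; lra).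
    apply Rmult_le_compat_l; [ | easy]. left. apply Rdiv_lt_0_compat; lra. }
  assert (E2 : Cmod l * Cmod (w - z - RtoC (s - t) * v) <= A * (e / (2 * A) * h)).
  { apply Rmult_le_compat; try apply Cmod_ge_0; [unfold A; lra | easy]. }
  replace (A * (e / (2 * A) * h)) with (e / 2 * h) in E2 by (field; lra).
  lra.
Qed.

Lemma vderiv_is_derive g t v : vderiv g t v -> is_derive (fun s => Re (g s)) t (Re v).
Proof.
  intros H. split; [apply is_linear_scal_l | ].
  intros x Hx e.
  assert (E : x = t). { symmetry. apply (is_filter_lim_locally_unique (V := AbsRing_NormedModule R_AbsRing)). exact Hx. }
  subst x. destruct (H e (cond_pos e)) as [d [Hd K]]. exists (mkposreal d Hd).
  intros s Hs. specialize (K s Hs).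
  eapply Rle_trans; [ | exact K].
  change (Rabs (Re (g s) + - Re (g t) + - ((s + - t) * Re v)) <=
     Cmod (g s - g t - RtoC (s - t) * v)).
  eapply Rle_trans; [ | apply Re_le_Cmod]. right. f_equal.
  unfold Re, RtoC. simpl. ring.
Qed.

Lemma vderiv_comps g t a b : is_derive (fun s => Re (g s)) t a ->
  is_derive (fun s => Im (g s)) t b -> vderiv g t (a, b).
Proof.
  intros [_ Ha] [_ Hb] e He.
  assert (E2 : 0 < e / 2) by lra.
  destruct (Ha t (fun P HP => HP) (mkposreal _ E2)) as [d1 K1].
  destruct (Hb t (fun P HP => HP) (mkposreal _ E2)) as [d2 K2].
  exists (Rmin d1 d2). split; [apply Rmin_glb_lt; apply cond_pos | ].
  intros s Hs.
  specialize (K1 s (Rlt_le_trans _ _ _ Hs (Rmin_l _ _))).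
  specialize (K2 s (Rlt_le_trans _ _ _ Hs (Rmin_r _ _))).
  simpl in K1, K2.
  change (Rabs (Re (g s) + - Re (g t) + - ((s + - t) * a)) <= e / 2 * Rabs (s - t)) in K1.
  change (Rabs (Im (g s) + - Im (g t) + - ((s + - t) * b)) <= e / 2 * Rabs (s - t)) in K2.
  eapply Rle_trans; [apply Cmod_le_ReIm | ].
  replace (Re (g s - g t - RtoC (s - t) * (a, b))) with (Re (g s) + - Re (g t) + - ((s + - t) * a)).
  2: { unfold Re, RtoC. simpl. ring. }
  replace (Im (g s - g t - RtoC (s - t) * (a, b))) with (Im (g s) + - Im (g t) + - ((s + - t) * b)).
  2: { unfold Im, RtoC. simpl. ring. }
  lra.
Qed.

Lemma vderiv_affine a b t : vderiv (fun s => a + RtoC s * b)%C t b.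
Proof.
  intros e He. exists 1. split; [lra | ]. intros s _.
  replace (a + RtoC s * b - (a + RtoC t * b) - RtoC (s - t) * b)%C with (RtoC 0).
  - rewrite Cmod_0. apply Rmult_le_pos; [lra | apply Rabs_pos].
  - rewrite RtoC_minus. ring.
Qed.

Lemma vderiv_ext g h t v : (forall s, g s = h s) -> vderiv g t v -> vderiv h t v.
Proof.
  intros E H e He. destruct (H e He) as [d [Hd K]]. exists d. split; [easy | ].
  intros s Hs. rewrite <- !E. auto.
Qed.

Lemma vderiv_expi t : vderiv expi t (Ci * expi t).
Proof.
  replace (Ci * expi t)%C with (- sin t, cos t)%R.
  - apply vderiv_comps; simpl; auto_derive; try easy; ring.
  - unfold Ci, expi. apply injective_projections; simpl; ring.
Qed.

Lemma cderiv_linear a b z : cderiv (fun w => a + b * w)%C z b.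
Proof.
  intros e He. exists 1. split; [lra | ]. intros w _.
  replace (a + b * w - (a + b * z) - b * (w - z))%C with (RtoC 0) by ring.
  rewrite Cmod_0. apply Rmult_le_pos; [lra | apply Cmod_ge_0].
Qed.

Definition contC_2d (g : R -> R -> C) (s t : R) : Prop :=
  continuity_2d_pt (fun u v => Re (g u v)) s t /\ continuity_2d_pt (fun u v => Im (g u v)) s t.

Lemma contC_2d_mult g h s t : contC_2d g s t -> contC_2d h s t -> contC_2d (fun u v => g u v * h u v)%C s t.
Proof.
  intros [G1 G2] [H1 H2]. split; simpl.
  - apply continuity_2d_pt_minus; now apply continuity_2d_pt_mult.
  - apply continuity_2d_pt_plus; now apply continuity_2d_pt_mult.
Qed.

Lemma contC_2d_plus g h s t : contC_2d g s t -> contC_2d h s t -> contC_2d (fun u v => g u v + h u v)%C s t.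
Proof. intros [G1 G2] [H1 H2]. split; simpl; now apply continuity_2d_pt_plus. Qed.

Lemma contC_2d_const c s t : contC_2d (fun _ _ => c) s t.
Proof. split; apply continuity_2d_pt_const. Qed.

Lemma contC_2d_fst s t : contC_2d (fun u _ => RtoC u) s t.
Proof. split; simpl; [apply continuity_2d_pt_id1 | apply continuity_2d_pt_const]. Qed.

Lemma contC_2d_snd w s t : contC w -> contC_2d (fun _ v => w v) s t.
Proof.
  intros [H1 H2]. split; apply (continuity_1d_2d_pt_comp _ (fun _ v => v));
  try apply continuity_2d_pt_id2; apply continuity_pt_filterlim; [apply H1 | apply H2].
Qed.

Lemma contC_2d_comp f g s t : contC_2d g s t -> ccont f (g s t) -> contC_2d (fun u v => f (g u v)) s t.
Proof.
  intros [G1 G2] Hf.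
  assert (K : forall e : posreal, locally_2d (fun u v => Cmod (f (g u v) - f (g s t)) < e) s t).
  { intros e. destruct (Hf e (cond_pos e)) as [d [Hd K]].
    assert (D2 : 0 < d / 2) by lra.
    destruct (G1 (mkposreal _ D2)) as [d1 K1]. destruct (G2 (mkposreal _ D2)) as [d2 K2].
    simpl in K1, K2. assert (D3 : 0 < Rmin d1 d2) by (apply Rmin_glb_lt; apply cond_pos).
    exists (mkposreal _ D3). simpl. intros u v Hu Hv. apply K.
    specialize (K1 u v (Rlt_le_trans _ _ _ Hu (Rmin_l _ _)) (Rlt_le_trans _ _ _ Hv (Rmin_l _ _))).
    specialize (K2 u v (Rlt_le_trans _ _ _ Hu (Rmin_r _ _)) (Rlt_le_trans _ _ _ Hv (Rmin_r _ _))).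
    eapply Rle_lt_trans; [apply Cmod_le_ReIm | ].
    unfold Re, Im, Rminus in *; simpl in *. lra. }
  split; intros e; destruct (K e) as [d Kd]; exists d; intros u v Hu Hv;
  (eapply Rle_lt_trans; [ | apply (Kd u v Hu Hv)]).
  - apply (Re_le_Cmod (f (g u v) - f (g s t))).
  - apply (Im_le_Cmod (f (g u v) - f (g s t))).
Qed.

(** * Cauchy's formula and Taylor expansions *)

(** Analyticity in the unit disc with a continuous derivative. The continuity is
    what makes differentiation under the integral possible; functions in S^p
    have it because their derivative is differentiable. *)
Definition holC1 (f f' : C -> C) : Prop :=
  forall z, Cmod z < 1 -> cderiv f z (f' z) /\ ccont f' z.

Lemma contC_inv u : contC u -> (forall t, (u t <> 0)%C) -> contC (fun t => / u t)%C.
Proof.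
  intros Hu Hn. assert (N : forall t, Cmod (u t) ^ 2 <> 0).
  { intros t E. apply (Hn t). apply Cmod_eq_0. nra. }
  apply (contC_ext (fun t => Cconj (u t) * RtoC (/ (Cmod (u t) ^ 2)))%C).
  - intros t. rewrite RtoC_inv by apply N. rewrite Cmod2_conj. field.
    split; [apply Hn | ]. intros E. apply (Hn t).
    rewrite <- (Cconj_conj (u t)), E. apply injective_projections; simpl; ring.
  - apply contC_mult; [now apply contC_conj | ]. apply contC_RtoC.
    apply (contR_comp Rinv (fun t => Cmod (u t) ^ 2)).
    + simpl. apply contR_mult; [now apply contC_Cmod | apply contR_mult; [now apply contC_Cmod | apply contR_const]].
    + intros t. now apply continuous_Rinv.
Qed.

Lemma contR_bounded u : contR u -> exists M, forall t, 0 <= t <= 2 * PI -> u t <= M.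
Proof.
  intros Hu. destruct (continuity_ab_maj u 0 (2 * PI)) as [x [Hx _]].
  - left; apply two_pi_gt0.
  - intros t _. apply continuity_pt_filterlim. apply Hu.
  - now exists (u x).
Qed.

Lemma pow_small q e : 0 <= q < 1 -> 0 < e -> exists N, forall n, (N <= n)%nat -> q ^ n < e.
Proof.
  intros Hq He. destruct (pow_lt_1_zero q) with (y := e) as [N HN]; try easy.
  - rewrite Rabs_pos_eq; lra.
  - exists N. intros n Hn. specialize (HN n Hn). now apply Rabs_def2 in HN.
Qed.

Lemma Cgeom x : Cmod x < 1 -> cser (fun n => x ^ n)%C (/ (1 - x)).
Proof.
  intros Hx. assert (N : (1 - x <> 0)%C).
  { intros E. assert (x = 1) by (replace x with (1 - (1 - x))%C by ring; rewrite E; ring).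
    rewrite H, Cmod_1 in Hx. lra. }
  assert (E : forall n, csum (fun n => x ^ n)%C n = ((1 - x ^ n) / (1 - x))%C).
  { induction n; simpl; [ | rewrite IHn]; field; easy. }
  intros e He. assert (P := proj1 (Cmod_gt_0 _) N).
  destruct (pow_small (Cmod x) (e * Cmod (1 - x))) as [M HM].
  - split; [apply Cmod_ge_0 | easy].
  - now apply Rmult_lt_0_compat.
  - exists M. intros n Hn. rewrite E.
    replace ((1 - x ^ n) / (1 - x) - / (1 - x))%C with (- (x ^ n / (1 - x)))%C by (field; easy).
    rewrite Cmod_opp, Cmod_div, Cmod_pow by easy.
    apply Rmult_lt_reg_r with (Cmod (1 - x)); [easy | ].
    unfold Rdiv. rewrite Rmult_assoc, Rinv_l by lra. rewrite Rmult_1_r. now apply HM.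
Qed.

Lemma kernel_neq0 x : Cmod x < 1 -> (1 - x <> 0)%C.
Proof.
  intros Hx E. assert (x = 1) by (replace x with (1 - (1 - x))%C by ring; rewrite E; ring).
  rewrite H, Cmod_1 in Hx. lra.
Qed.

Lemma kernel_series (u v : R -> C) z : contC u -> (forall t, Cmod (u t) = 1) -> contC v -> Cmod z < 1 ->
  cser (fun n => Cavg (fun s => v s * u s ^ n)%C * z ^ n)%C
    (Cavg (fun s => v s / (1 - z * u s)))%C.
Proof.
  intros Hu Hu1 Hv Hz. destruct (contR_bounded _ (contC_Cmod _ Hv)) as [M HM].
  assert (P := Cmod_ge_0 z).
  assert (Hzu : forall t, Cmod (z * u t) < 1) by (intros; rewrite Cmod_mult, Hu1; lra).
  apply (cser_ext (fun n => Cavg (fun s => z ^ n * (v s * u s ^ n)))%C).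
  { intros n. rewrite Cavg_scal; [ring | ]. apply contC_mult; [easy | now apply contC_pow]. }
  apply (Cavg_series _ _ (fun n => M * Cmod z ^ n) (M * / (1 - Cmod z))).
  - intros n. apply contC_mult; [apply contC_const | ]. apply contC_mult; [easy | now apply contC_pow].
  - apply contC_mult; [easy | ]. apply contC_inv.
    + apply contC_minus; [apply contC_const | ]. apply contC_mult; [apply contC_const | easy].
    + intros t. now apply kernel_neq0.
  - intros n t Ht. rewrite !Cmod_mult, !Cmod_pow, Hu1, pow1, Rmult_1_r, Rmult_comm.
    apply Rmult_le_compat_r; [now apply pow_le | now apply HM].
  - intros n. rewrite rsum_scal. apply Rmult_le_compat_l.
    + apply Rle_trans with (Cmod (v 0)); [apply Cmod_ge_0 | apply HM].
      generalize two_pi_gt0. lra.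
    + now apply rsum_geom_le.
  - intros t. apply (cser_ext (fun n => v t * (z * u t) ^ n)%C).
    + intros n. rewrite Cpow_mult_l. ring.
    + apply cser_scal. now apply Cgeom.
Qed.

(** Deform the circle to its interior point z along p(s,t) = z + s (w(t) - z).
    The average of w/(w - z) f(p(s,.)) over t does not depend on s: its
    s-derivative is the average of w f'(p(s,.)), which for s <> 0 is a multiple
    of the t-derivative of the periodic function f(p(s,.)). At s = 1 one reads
    the Cauchy integral, at s = 0 the value f(z) times a constant. The factor
    mu is 1 or -i, and selects the real or the imaginary part. The range of s
    exceeds [0,1] by del on both sides, so that the end points are interior. *)
Section CauchyFormula.
Variables (f f' : C -> C) (rho : R) (z : C).
Hypothesis Hf : holC1 f f'.
Hypothesis Hrho : 0 < rho < 1.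
Hypothesis Hz : Cmod z < rho.

Let w (t : R) : C := (RtoC rho * expi t)%C.
Let p (s t : R) : C := (z + RtoC s * (w t - z))%C.
Let del : R := (1 - rho) / 2.

Lemma cauchy_w_mod t : Cmod (w t) = rho.
Proof. unfold w. rewrite Cmod_mult, Cmod_R, Cmod_expi, Rabs_pos_eq; lra. Qed.

Lemma cauchy_contC_w : contC w.
Proof. apply contC_mult; [apply contC_const | apply contC_expi]. Qed.

Lemma cauchy_w_neq t : (w t - z <> 0)%C.
Proof.
  intros E. assert (w t = z) by (replace (w t) with ((w t - z) + z)%C by ring; rewrite E; ring).
  generalize (cauchy_w_mod t). rewrite H. lra.
Qed.

Lemma cauchy_p_disc s t : - del < s < 1 + del -> Cmod (p s t) < 1.
Proof.
  intros Hs. assert (Pz := Cmod_ge_0 z).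
  assert (D : Cmod (w t - z) <= 2).
  { eapply Rle_trans; [apply Cmod_triangle | ]. rewrite Cmod_opp, cauchy_w_mod. lra. }
  assert (D0 := Cmod_ge_0 (w t - z)). unfold del in Hs.
  destruct (Rle_dec s 0) as [S0 | S0].
  - unfold p. eapply Rle_lt_trans; [apply Cmod_triangle | ].
    rewrite Cmod_mult, Cmod_R, Rabs_left1 by easy. nra.
  - destruct (Rle_dec s 1) as [S1 | S1].
    + replace (p s t) with (RtoC (1 - s) * z + RtoC s * w t)%C
        by (unfold p; rewrite RtoC_minus; ring).
      eapply Rle_lt_trans; [apply Cmod_triangle | ].
      rewrite !Cmod_mult, !Cmod_R, cauchy_w_mod, !Rabs_pos_eq by lra. nra.
    + replace (p s t) with (w t + RtoC (s - 1) * (w t - z))%C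
        by (unfold p; rewrite RtoC_minus; ring).
      eapply Rle_lt_trans; [apply Cmod_triangle | ].
      rewrite !Cmod_mult, !Cmod_R, cauchy_w_mod, !Rabs_pos_eq by lra. nra.
Qed.

Variable mu : C.
Let k (t : R) : C := (mu * (w t / (w t - z)))%C.
Let F (s t : R) : R := Re (k t * f (p s t)).
Let dF (s t : R) : R := Re (mu * w t * f' (p s t)).

Lemma cauchy_F_derive s t : - del < s < 1 + del -> is_derive (fun s => F s t) s (dF s t).
Proof.
  intros Hs. unfold F, dF.
  apply (vderiv_is_derive (fun s => k t * f (p s t))%C).
  replace (mu * w t * f' (p s t))%C with (k t * (f' (p s t) * (w t - z)))%C.
  2: { unfold k. field. apply cauchy_w_neq. }
  apply (vderiv_ext (fun s => 0 + k t * f (p s t))%C); [intros; ring | ].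
  apply (vderiv_comp (fun x => 0 + k t * x)%C (fun s => f (p s t))).
  - apply (vderiv_comp f (fun s => p s t)); [apply vderiv_affine | ].
    apply Hf. now apply cauchy_p_disc.
  - apply cderiv_linear.
Qed.

Lemma cauchy_contC_2d_p s t : contC_2d p s t.
Proof.
  apply contC_2d_plus; [apply contC_2d_const | ]. apply contC_2d_mult; [apply contC_2d_fst | ].
  apply contC_2d_plus; [apply contC_2d_snd, cauchy_contC_w | apply contC_2d_const].
Qed.

Lemma cauchy_contC_inv : contC (fun t => / (w t - z))%C.
Proof.
  apply contC_inv; [ | apply cauchy_w_neq].
  apply contC_minus; [apply cauchy_contC_w | apply contC_const].
Qed.

Lemma cauchy_contC_p s : contC (p s).
Proof.
  apply contC_plus; [apply contC_const | ]. apply contC_mult; [apply contC_const | ].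
  apply contC_minus; [apply cauchy_contC_w | apply contC_const].
Qed.

Lemma cauchy_contR_F s : - del < s < 1 + del -> contR (F s).
Proof.
  intros Hs. apply (contC_mult k (fun t => f (p s t))).
  - apply contC_mult; [apply contC_const | ]. apply contC_mult; [apply cauchy_contC_w | apply cauchy_contC_inv].
  - apply (contC_comp f); [apply cauchy_contC_p | ]. intros t.
    apply (cderiv_cont _ _ (f' (p s t))). apply Hf. now apply cauchy_p_disc.
Qed.

Lemma cauchy_contR_dF s : - del < s < 1 + del -> contR (dF s).
Proof.
  intros Hs. apply (contC_mult (fun t => mu * w t)%C (fun t => f' (p s t))).
  - apply contC_mult; [apply contC_const | apply cauchy_contC_w].
  - apply (contC_comp f'); [apply cauchy_contC_p | ]. intros t. apply Hf. now apply cauchy_p_disc.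
Qed.

Lemma cauchy_avg_dF s : - del < s < 1 + del -> avg (dF s) = 0.
Proof.
  (* At s = 0 the integrand is a multiple of e^{it}; elsewhere it is a t-derivative. *)
  intros Hs. destruct (Req_dec s 0) as [E | E].
  - transitivity (Re (Cavg (fun t => (mu * RtoC rho * f' z) * expi t ^ 1)%C)).
    + change (avg (dF s) = avg (fun t => Re ((mu * RtoC rho * f' z) * expi t ^ 1)%C)).
      apply avg_ext. intros t. unfold dF. f_equal. unfold p. rewrite E.
      replace (z + 0 * (w t - z))%C with z by ring. unfold w. rewrite Cpow_1_r. ring.
    + rewrite Cavg_scal by apply contC_pow, contC_expi. rewrite Cavg_expi_pow.
      unfold Re, RtoC; simpl. ring.
  - apply (avg_derive (fun t => Re ((0 + (- Ci * mu / RtoC s) * f (p s t)))%C)).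
    + intros t. unfold dF.
      replace (mu * w t * f' (p s t))%C with
        ((- Ci * mu / RtoC s) * (f' (p s t) * ((RtoC s * RtoC rho) * (Ci * expi t))))%C.
      2: { assert (Ci * Ci = - (1))%C by (unfold Ci, RtoC; apply injective_projections; simpl; ring).
           unfold w. transitivity (- (Ci * Ci) * mu * (RtoC rho * expi t) * f' (p s t))%C.
           - field. intros E0. apply E. now apply RtoC_inj.
           - rewrite H. ring. }
      apply (vderiv_is_derive (fun t => 0 + (- Ci * mu / RtoC s) * f (p s t))%C).
      apply (vderiv_comp (fun x => 0 + (- Ci * mu / RtoC s) * x)%C (fun t => f (p s t)));
        [ | apply cderiv_linear].
      apply (vderiv_comp f (p s)).
      2: { apply Hf. now apply cauchy_p_disc. }
      apply (vderiv_ext (fun t => (z - RtoC s * z) + (RtoC s * RtoC rho) * expi t)%C).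
      * intros t'. unfold p, w. ring.
      * apply (vderiv_comp (fun x => (z - RtoC s * z) + (RtoC s * RtoC rho) * x)%C expi);
        [apply vderiv_expi | apply cderiv_linear].
    + now apply cauchy_contR_dF.
    + unfold p, w. now rewrite expi_2pi.
Qed.

Lemma cauchy_avg_F_derive s : - del < s < 1 + del -> is_derive (fun s => avg (F s)) s 0.
Proof.
  intros Hs.
  assert (L : locally s (fun u => - del < u < 1 + del)).
  { assert (D : 0 < Rmin (s + del) (1 + del - s)) by (apply Rmin_glb_lt; lra).
    exists (mkposreal _ D). intros u Hu.
    change (Rabs (u - s) < Rmin (s + del) (1 + del - s)) in Hu.
    assert (H1 := Rlt_le_trans _ _ _ Hu (Rmin_l _ _)).
    assert (H2 := Rlt_le_trans _ _ _ Hu (Rmin_r _ _)).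
    apply Rabs_def2 in H1, H2. lra. }
  assert (E : forall u t, - del < u < 1 + del -> Derive (fun s => F s t) u = dF u t).
  { intros u t Hu. apply is_derive_unique. now apply cauchy_F_derive. }
  assert (H : is_derive (fun s => RInt (fun t => F s t) 0 (2 * PI)) s
      (RInt (fun t => Derive (fun u => F u t) s) 0 (2 * PI))).
  { apply is_derive_RInt_param.
    - apply (filter_imp (fun u => - del < u < 1 + del)); [ | exact L].
      intros u Hu t _. exists (dF u t). now apply cauchy_F_derive.
    - intros t _. apply (continuity_2d_pt_ext_loc dF).
      + destruct L as [d Hd]. exists d. intros u v Hu _. symmetry. apply E. now apply Hd.
      + apply (contC_2d_mult (fun u v => mu * w v)%C (fun u v => f' (p u v))).
        * apply contC_2d_mult; [apply contC_2d_const | apply contC_2d_snd, cauchy_contC_w].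
        * apply (contC_2d_comp f'); [apply cauchy_contC_2d_p | ]. apply Hf. now apply cauchy_p_disc.
    - apply (filter_imp (fun u => - del < u < 1 + del)); [ | exact L].
      intros u Hu. apply contR_ex_RInt. now apply cauchy_contR_F. }
  replace 0 with (/ (2 * PI) * RInt (fun t => Derive (fun u => F u t) s) 0 (2 * PI)).
  - apply (is_derive_scal (fun s => RInt (F s) 0 (2 * PI))). exact H.
  - transitivity (avg (dF s)); [ | now apply cauchy_avg_dF].
    unfold avg. f_equal. apply RInt_ext. intros t _. now apply E.
Qed.

Lemma cauchy_avg_F_const : avg (F 1) = avg (F 0).
Proof.
  assert (D : 0 < del) by (unfold del; lra).
  destruct (MVT_gen (fun s => avg (F s)) 0 1 (fun _ => 0)) as [c [_ Hc]].
  - intros x Hx. apply cauchy_avg_F_derive.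
    rewrite Rmin_left, Rmax_right in Hx by lra. lra.
  - intros x Hx. apply continuity_pt_filterlim.
    apply (ex_derive_continuous (K := R_AbsRing) (V := R_NormedModule) (fun s => avg (F s))).
    exists 0. apply cauchy_avg_F_derive.
    rewrite Rmin_left, Rmax_right in Hx by lra. lra.
  - lra.
Qed.
End CauchyFormula.

Lemma Cmod_div_lt1 z rho : 0 < rho -> Cmod z < rho -> Cmod (z / RtoC rho) < 1.
Proof.
  intros H Hz. rewrite Cmod_div by (intros E; apply RtoC_inj in E; lra).
  rewrite Cmod_R, Rabs_pos_eq by lra. apply Rmult_lt_reg_r with rho; [easy | ].
  field_simplify; lra.
Qed.

Lemma cauchy_kernel_eq rho z t : 0 < rho < 1 -> Cmod z < rho ->
  ((RtoC rho * expi t) / (RtoC rho * expi t - z) = 1 / (1 - z / RtoC rho * Cconj (expi t)))%C.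
Proof.
  intros Hr Hz.
  assert (Hn : (RtoC rho * expi t - z <> 0)%C) by now apply (cauchy_w_neq rho z).
  assert (Hd : (1 - z / RtoC rho * Cconj (expi t) <> 0)%C).
  { apply kernel_neq0. rewrite Cmod_mult, Cmod_conj, Cmod_expi, Rmult_1_r. now apply Cmod_div_lt1. }
  assert (R0 : RtoC rho <> 0) by (intros E; apply RtoC_inj in E; lra).
  assert (E : (RtoC rho * expi t * (1 - z / RtoC rho * Cconj (expi t)) = RtoC rho * expi t - z)%C).
  { transitivity (RtoC rho * expi t - z * (expi t * Cconj (expi t)))%C; [field; easy | ].
    rewrite expi_conj. ring. }
  rewrite <- E. assert (He := expi_neq0 t). clear E Hn.
  set (D := (1 - z / RtoC rho * Cconj (expi t))%C) in *. clearbody D. field. auto.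
Qed.

(** The constant left by the deformation is the average of w/(w - z), which the
    geometric series evaluates to 1. *)
Lemma cauchy_formula f f' rho z : holC1 f f' -> 0 < rho < 1 -> Cmod z < rho ->
  f z = Cavg (fun t => circle_pt rho t / (circle_pt rho t - z) * f (circle_pt rho t))%C.
Proof.
  intros Hf Hr Hz.
  rewrite (Cavg_ext _ (fun t => (RtoC rho * expi t) / ((RtoC rho * expi t) - z)
     * f (RtoC rho * expi t)))%C by (intros t; now rewrite circle_pt_expi).
  set (u := fun t => ((RtoC rho * expi t) / ((RtoC rho * expi t) - z))%C).
  assert (Hn : forall t, (RtoC rho * expi t - z <> 0)%C) by (intros t; now apply (cauchy_w_neq rho z)).
  assert (Hu : contC u).
  { apply contC_mult; [apply contC_mult; [apply contC_const | apply contC_expi] | ].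
    now apply (cauchy_contC_inv rho z). }
  assert (Hfc : contC (fun t => f (RtoC rho * expi t)%C)).
  { apply (contC_comp f); [apply contC_mult; [apply contC_const | apply contC_expi] | ].
    intros t. apply (cderiv_cont _ _ (f' (RtoC rho * expi t)%C)). apply Hf.
    rewrite Cmod_mult, Cmod_R, Cmod_expi, Rabs_pos_eq; lra. }
  (* In powers of z / w only the zeroth term has a nonzero average. *)
  assert (M1 : Cavg u = 1).
  { apply (cser_unique (fun n => Cavg (fun s => 1 * Cconj (expi s) ^ n)%C * (z / RtoC rho) ^ n)%C).
    - rewrite (Cavg_ext u (fun s => 1 / (1 - z / RtoC rho * Cconj (expi s))))%C
        by (intros; now apply cauchy_kernel_eq).
      apply (kernel_series (fun s => Cconj (expi s)) (fun _ => RtoC 1)).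
      + apply contC_conj, contC_expi.
      + intros t. now rewrite Cmod_conj, Cmod_expi.
      + apply contC_const.
      + now apply Cmod_div_lt1.
    - assert (E1 : (Cavg (fun s => 1 * Cconj (expi s) ^ 0) * (z / RtoC rho) ^ 0)%C = 1).
      { rewrite (Cavg_ext _ (fun _ => RtoC 1)) by (intros; simpl; ring).
        rewrite Cavg_const. simpl. ring. }
      assert (S := cser_single (fun n => Cavg (fun s => 1 * Cconj (expi s) ^ n)%C * (z / RtoC rho) ^ n)%C 0).
      cbv beta in S. rewrite E1 in S. apply S. clear S.
      intros [ | n] Hn'; [easy | ]. rewrite Cavg_scal by apply contC_pow, contC_conj, contC_expi.
      rewrite Cavg_conj_expi_pow. ring. }
  assert (K : forall mu, Re (mu * Cavg (fun t => u t * f (RtoC rho * expi t)))%C = Re (mu * f z)%C).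
  { intros mu. assert (K := cauchy_avg_F_const f f' rho z Hf Hr Hz mu).
    rewrite <- Cavg_scal by now apply contC_mult.
    transitivity (avg (fun t => Re (mu * u t * f (z + RtoC 0 * (RtoC rho * expi t - z))))%C).
    - etransitivity; [ | exact K].
      apply avg_ext. intros t. unfold u.
      replace (z + 1 * (RtoC rho * expi t - z))%C with (RtoC rho * expi t)%C by ring.
      f_equal. ring.
    - transitivity (Re (Cavg (fun t => (mu * f z) * u t))%C).
      + apply avg_ext. intros t. f_equal.
        replace (z + 0 * (RtoC rho * expi t - z))%C with z by ring. ring.
      + rewrite Cavg_scal, M1 by easy. f_equal. ring. }
  assert (K1 := K 1). assert (K2 := K (- Ci)%C).
  rewrite !Cmult_1_l in K1. apply injective_projections; [symmetry; exact K1 | ].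
  unfold Ci, Re in K2. simpl in K2. simpl. lra.
Qed.

(** The Taylor coefficients of f, as given by Cauchy's formula on the circle of
    radius [rho]; they are identified with [taylor_coef] afterwards. *)
Definition circ_coef (f : C -> C) (rho : R) (n : nat) : C :=
  (Cavg (fun t => f (circle_pt rho t) * Cconj (expi t) ^ n) / RtoC (rho ^ n))%C.

Lemma holC1_contC f f' r : holC1 f f' -> 0 <= r < 1 -> contC (fun t => f (circle_pt r t)).
Proof.
  intros Hf Hr. apply (contC_comp f); [apply contC_circle | ]. intros t.
  apply (cderiv_cont _ _ (f' (circle_pt r t))). apply Hf. rewrite Cmod_circle; lra.
Qed.

Lemma rad_circ_coef f f' rho : holC1 f f' -> 0 < rho < 1 -> rad rho (circ_coef f rho).
Proof.
  intros Hf Hr r Hrr. exists (avg (fun t => Cmod (f (circle_pt rho t)))). intros n.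
  assert (P : 0 < rho ^ n) by (apply pow_lt; lra).
  apply Rle_trans with (Cmod (circ_coef f rho n) * rho ^ n).
  { apply Rmult_le_compat_l; [apply Cmod_ge_0 | ]. apply pow_incr; lra. }
  unfold circ_coef. rewrite Cmod_div by (intros E; apply RtoC_inj in E; lra).
  rewrite Cmod_R, Rabs_pos_eq by lra.
  unfold Rdiv. rewrite Rmult_assoc, Rinv_l, Rmult_1_r by lra.
  assert (H : contC (fun t => f (circle_pt rho t))) by (apply (holC1_contC f f'); [easy | lra]).
  eapply Rle_trans; [apply Cmod_Cavg; apply contC_mult; [easy | apply contC_pow, contC_conj, contC_expi] | ].
  right. apply avg_ext. intros t. rewrite Cmod_mult, Cmod_cexpi_pow. ring.
Qed.

Lemma holC1_circ_series f f' rho z : holC1 f f' -> 0 < rho < 1 -> Cmod z < rho ->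
  f z = cps (circ_coef f rho) z.
Proof.
  intros Hf Hr Hz.
  assert (H : contC (fun t => f (circle_pt rho t))) by (apply (holC1_contC f f'); [easy | lra]).
  symmetry. apply cser_C_series. rewrite (cauchy_formula f f' rho z) by easy.
  rewrite (Cavg_ext _ (fun s => f (circle_pt rho s) / (1 - z / RtoC rho * Cconj (expi s))))%C.
  2: { intros t. rewrite circle_pt_expi. rewrite cauchy_kernel_eq by easy.
       unfold Cdiv. ring. }
  eapply cser_ext; [ | apply (kernel_series (fun s => Cconj (expi s)))].
  - intros n. cbv beta. unfold circ_coef. unfold Cdiv.
    assert (R0 : RtoC rho <> 0) by (intros E; apply RtoC_inj in E; lra).
    rewrite Cpow_mult_l, RtoC_pow, Cpow_inv by easy. ring.
  - apply contC_conj, contC_expi.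
  - intros t. now rewrite Cmod_conj, Cmod_expi.
  - easy.
  - now apply Cmod_div_lt1.
Qed.

Lemma C_derive_unique f z l : cderiv f z l -> C_derive f z = l.
Proof. intros H. apply is_C_derive_unique. now apply cderiv_is_derive. Qed.

Lemma deriv_coef_iter c n k : (RtoC (INR (fact k)) * Nat.iter n deriv_coef c k =
  RtoC (INR (fact (n + k))) * c (n + k)%nat)%C.
Proof.
  revert k. induction n; intros k; [easy | ]. simpl Nat.iter. unfold deriv_coef at 1.
  replace (S n + k)%nat with (n + S k)%nat by lia. rewrite <- IHn.
  rewrite fact_simpl, mult_INR, RtoC_mult. ring.
Qed.

Lemma C_derive_n_cps f c rho n : rad rho c -> (forall z, Cmod z < rho -> f z = cps c z) ->
  rad rho (Nat.iter n deriv_coef c) /\ forall z, Cmod z < rho -> C_derive_n f n z = cps (Nat.iter n deriv_coef c) z.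
Proof.
  intros Hc Hf. induction n; [easy | ]. destruct IHn as [Ra E1]. simpl. split; [now apply rad_deriv_coef | ].
  intros z Hz. apply C_derive_unique.
  apply (cderiv_ext_loc (cps (Nat.iter n deriv_coef c)) _ z _ (rho - Cmod z)); [lra | | ].
  - intros w Hw. symmetry. apply E1.
    replace w with ((w - z) + z)%C by ring. eapply Rle_lt_trans; [apply Cmod_triangle | lra].
  - now apply (cps_derive rho).
Qed.

Lemma taylor_cps f c rho n : 0 < rho -> rad rho c -> (forall z, Cmod z < rho -> f z = cps c z) ->
  taylor_coef f n = c n.
Proof.
  intros Hr Hc Hf. destruct (C_derive_n_cps f c rho n Hc Hf) as [_ E].
  unfold taylor_coef. rewrite E by now rewrite Cmod_0. rewrite cps_0.
  assert (D := deriv_coef_iter c n 0). rewrite Nat.add_0_r in D. simpl fact in D.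
  simpl INR in D. rewrite Cmult_1_l in D. rewrite D. field.
  intros Z. apply RtoC_inj in Z. apply (INR_fact_neq_0 n Z).
Qed.

(** The expansions on the circles of all radii rho < 1 have the same
    coefficients, namely the iterated derivatives at 0, so they fit together. *)
Lemma holC1_taylor f f' : holC1 f f' -> rad 1 (taylor_coef f) /\ forall z, Cmod z < 1 -> f z = cps (taylor_coef f) z.
Proof.
  intros Hf.
  assert (E : forall rho, 0 < rho < 1 -> forall n, taylor_coef f n = circ_coef f rho n).
  { intros rho Hr n. apply (taylor_cps f _ rho); [lra | now apply (rad_circ_coef f f') | ].
    intros z Hz. now apply (holC1_circ_series f f'). }
  split.
  - intros r Hr. destruct (rad_circ_coef f f' ((r + 1) / 2) Hf ltac:(lra) r ltac:(lra)) as [B HB].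
    exists B. intros n. rewrite (E ((r + 1) / 2)) by lra. apply HB.
  - intros z Hz. assert (P := Cmod_ge_0 z).
    rewrite (holC1_circ_series f f' ((Cmod z + 1) / 2) z Hf) by lra.
    apply cps_ext. intros n. symmetry. apply E. lra.
Qed.

Lemma holC1_cps c : rad 1 c -> holC1 (cps c) (cps (deriv_coef c)).
Proof.
  intros Hc z Hz. split; [now apply (cps_derive 1) | ].
  apply (cderiv_cont _ _ (cps (deriv_coef (deriv_coef c)) z)). apply (cps_derive 1); [now apply rad_deriv_coef | easy].
Qed.

Lemma holC1_mult f f' g g' : holC1 f f' -> holC1 g g' ->
  holC1 (fun z => f z * g z)%C (fun z => f' z * g z + f z * g' z)%C.
Proof.
  intros Hf Hg z Hz. destruct (Hf z Hz) as [F1 F2]. destruct (Hg z Hz) as [G1 G2].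
  split; [now apply cderiv_mult | ].
  apply (ccont_plus (fun z => f' z * g z)%C (fun z => f z * g' z)%C);
  apply ccont_mult; try easy; eapply cderiv_cont; eassumption.
Qed.

Lemma holC1_comp F F' g g' : holC1 g g' ->
  (forall z, Cmod z < 1 -> cderiv F (g z) (F' (g z)) /\ ccont F' (g z)) ->
  holC1 (fun z => F (g z)) (fun z => F' (g z) * g' z)%C.
Proof.
  intros Hg HF z Hz. destruct (Hg z Hz) as [G1 G2]. destruct (HF z Hz) as [F1 F2].
  split; [now apply cderiv_comp | ].
  apply (ccont_mult (fun z => F' (g z)) g'); [ | easy].
  apply (ccont_comp F'); [ | easy]. eapply cderiv_cont; eassumption.
Qed.

Lemma holC1_mean f f' r : holC1 f f' -> 0 <= r < 1 -> Cavg (fun t => f (circle_pt r t)) = f 0.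
Proof.
  intros Hf Hr. destruct (holC1_taylor f f' Hf) as [Ra E1].
  rewrite (Cavg_ext _ (fun t => cps (taylor_coef f) (circle_pt r t))).
  - rewrite (Cavg_cps 1) by easy. rewrite E1 by (rewrite Cmod_0; lra). now rewrite cps_0.
  - intros t. apply E1. rewrite Cmod_circle; lra.
Qed.

(** * Poisson integrals and Herglotz transforms *)

Ltac prove_cont := repeat first [ assumption | lazymatch goal with
  | |- contR (fun _ => ?c) => apply contR_const
  | |- contC (fun _ => ?c) => apply contC_const
  | |- contR (fun _ => (_ + _)%R) => apply contR_plus
  | |- contR (fun _ => (_ * _)%R) => apply contR_mult
  | |- contC (fun _ => (_ + _)%C) => apply contC_plus
  | |- contC (fun _ => (_ * _)%C) => apply contC_mult
  | |- contR _ => fail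
  | |- contC _ => fail
  | |- _ => easy
  end ].

Definition fourier (v : R -> C) (n : nat) : C := Cavg (fun s => v s * Cconj (expi s) ^ n)%C.

Lemma rad_fourier v : contC v -> rad 1 (fourier v).
Proof.
  intros Hv r Hr. exists (avg (fun t => Cmod (v t))). intros n.
  apply Rle_trans with (Cmod (fourier v n) * 1).
  { apply Rmult_le_compat_l; [apply Cmod_ge_0 | ]. rewrite <- (pow1 n). apply pow_incr; lra. }
  rewrite Rmult_1_r.
  eapply Rle_trans; [apply Cmod_Cavg; apply contC_mult; [easy | apply contC_pow, contC_conj, contC_expi] | ].
  right. apply avg_ext. intros t. rewrite Cmod_mult, Cmod_cexpi_pow. ring.
Qed.

Lemma fourier_kernel v z : contC v -> Cmod z < 1 ->
  cps (fourier v) z = Cavg (fun s => v s / (1 - z * Cconj (expi s)))%C.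
Proof.
  intros Hv Hz. apply cser_C_series.
  apply (kernel_series (fun s => Cconj (expi s))); try easy.
  - apply contC_conj, contC_expi.
  - intros t. now rewrite Cmod_conj, Cmod_expi.
Qed.

Lemma contC_kernel z : Cmod z < 1 -> contC (fun s => / (1 - z * Cconj (expi s)))%C.
Proof.
  intros Hz. apply contC_inv.
  - apply contC_minus; [apply contC_const | ]. apply contC_mult; [apply contC_const | apply contC_conj, contC_expi].
  - intros t. apply kernel_neq0. rewrite Cmod_mult, Cmod_conj, Cmod_expi. lra.
Qed.

(** Taylor coefficients of the analytic function in the disc whose real part is
    the Poisson integral of u and whose value at 0 is real. *)
Definition herglotz (u : R -> R) (n : nat) : C :=
  match n with O => fourier (fun s => RtoC (u s)) 0 | S _ => (2 * fourier (fun s => RtoC (u s)) n)%C end.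

Definition poisson_kernel (z : C) (s : R) : R := Re (2 / (1 - z * Cconj (expi s)) - 1).
Definition poisson (u : R -> R) (z : C) : R := avg (fun s => u s * poisson_kernel z s).

Lemma rad_herglotz u : contR u -> rad 1 (herglotz u).
Proof.
  intros Hu. apply (rad_le 1 (fun n => 2 * fourier (fun s => RtoC (u s)) n)%C).
  - apply rad_scal, rad_fourier, contC_RtoC, Hu.
  - intros [ | n]; simpl; [ | lra]. rewrite Cmod_mult, Cmod_R, Rabs_pos_eq by lra.
    generalize (Cmod_ge_0 (fourier (fun s => RtoC (u s)) 0)). lra.
Qed.

Lemma contR_poisson_kernel z : Cmod z < 1 -> contR (poisson_kernel z).
Proof.
  intros Hz. assert (H : contC (fun s => 2 / (1 - z * Cconj (expi s)) - 1)%C).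
  { apply contC_minus; [ | apply contC_const]. apply contC_mult; [apply contC_const | now apply contC_kernel]. }
  apply H.
Qed.

Lemma poisson_kernel_pos z s : Cmod z < 1 -> 0 < poisson_kernel z s.
Proof.
  intros Hz. unfold poisson_kernel. set (x := (z * Cconj (expi s))%C).
  assert (Hx : Cmod x < 1) by (unfold x; rewrite Cmod_mult, Cmod_conj, Cmod_expi; lra).
  assert (Hn := kernel_neq0 x Hx). clearbody x. destruct x as [a b].
  assert (Hab : a * a + b * b < 1).
  { assert (E := Cmod2_alt (a, b)). unfold Re, Im in E. simpl in E.
    assert (P := Cmod_ge_0 (a, b)). nra. }
  assert (D : 0 < (1 - a) * (1 - a) + b * b).
  { destruct (Req_dec b 0) as [-> | Hb]; [ | nra].
    destruct (Req_dec a 1) as [-> | Ha]; [ | nra]. nra. }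
  replace (Re (2 / (1 - (a, b)) - 1)) with ((1 - a * a - b * b) / ((1 - a) * (1 - a) + b * b)).
  - apply Rdiv_lt_0_compat; lra.
  - unfold Re. simpl. field. nra.
Qed.

Lemma contR_poisson_integrand u z : contR u -> Cmod z < 1 -> contR (fun s => u s * poisson_kernel z s).
Proof. intros Hu Hz. apply contR_mult; [easy | now apply contR_poisson_kernel]. Qed.

Lemma herglotz_re u z : contR u -> Cmod z < 1 -> Re (cps (herglotz u) z) = poisson u z.
Proof.
  intros Hu Hz. set (v := fun s => RtoC (u s)). assert (Hv : contC v) by now apply contC_RtoC.
  assert (E : cps (herglotz u) z = (2 * cps (fourier v) z - fourier v 0)%C).
  { rewrite (cps_shift 1 (herglotz u)) by (try easy; now apply rad_herglotz).
    rewrite (cps_shift 1 (fourier v)) by (try easy; now apply rad_fourier).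
    rewrite (cps_ext (fun n => herglotz u (S n)) (fun n => 2 * fourier v (S n))%C) by easy.
    rewrite (cps_scal 1) by (try easy; apply rad_shift; now apply rad_fourier).
    simpl. fold v. ring. }
  rewrite E, fourier_kernel by easy. unfold fourier.
  rewrite (Cavg_ext (fun s => v s * Cconj (expi s) ^ 0)%C v) by (intros; simpl; ring).
  assert (Hk : contC (fun s => v s / (1 - z * Cconj (expi s)))%C).
  { apply contC_mult; [easy | now apply contC_kernel]. }
  rewrite <- Cavg_scal, <- Cavg_minus by prove_cont.
  change (avg (fun s => Re (2 * (v s / (1 - z * Cconj (expi s))) - v s)%C) = poisson u z).
  apply avg_ext. intros s. unfold poisson_kernel. rewrite <- Re_RtoC_mult. f_equal. unfold v.
  unfold Cdiv. ring.
Qed.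

Lemma fourier_const c n : fourier (fun _ => c) (S n) = 0.
Proof.
  unfold fourier. rewrite Cavg_scal by apply contC_pow, contC_conj, contC_expi.
  rewrite Cavg_conj_expi_pow. ring.
Qed.

Lemma fourier_0 v : fourier v 0 = Cavg v.
Proof. apply Cavg_ext. intros; simpl; ring. Qed.

Lemma poisson_scal c u z : contR u -> Cmod z < 1 -> poisson (fun s => c * u s) z = c * poisson u z.
Proof.
  intros Hu Hz. unfold poisson. rewrite <- avg_scal by now apply contR_poisson_integrand.
  apply avg_ext. intros; ring.
Qed.

Lemma poisson_plus u v z : contR u -> contR v -> Cmod z < 1 ->
  poisson (fun s => u s + v s) z = poisson u z + poisson v z.
Proof.
  intros Hu Hv Hz. unfold poisson. rewrite <- avg_plus by now apply contR_poisson_integrand.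
  apply avg_ext. intros; ring.
Qed.

Lemma poisson_le u v z : contR u -> contR v -> Cmod z < 1 -> (forall s, u s <= v s) ->
  poisson u z <= poisson v z.
Proof.
  intros Hu Hv Hz H. apply avg_le; try now apply contR_poisson_integrand. intros s.
  apply Rmult_le_compat_r; [left; now apply poisson_kernel_pos | easy].
Qed.

Lemma poisson_const c z : Cmod z < 1 -> poisson (fun _ => c) z = c.
Proof.
  intros Hz. rewrite <- herglotz_re by (try easy; apply contR_const).
  rewrite (cps_shift 1) by (try easy; apply rad_herglotz, contR_const).
  rewrite (cps_ext _ (fun _ => 0 * 0)%C).
  2: { intros n. simpl. rewrite fourier_const. ring. }
  rewrite (cps_scal 1 0 (fun _ => RtoC 0)).
  - change (herglotz (fun _ => c) 0) with (fourier (fun _ => RtoC c) 0).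
    rewrite fourier_0, Cavg_const. unfold Re; simpl; ring.
  - intros r Hr. exists 0. intros n. rewrite Cmod_0. lra.
  - easy.
Qed.

Lemma poisson_pos u z : contR u -> Cmod z < 1 -> (forall s, 0 < u s) -> 0 < poisson u z.
Proof.
  intros Hu Hz H. apply avg_gt0; [now apply contR_poisson_integrand | ]. intros s.
  apply Rmult_lt_0_compat; [easy | now apply poisson_kernel_pos].
Qed.

Lemma poisson_ge0 u z : contR u -> Cmod z < 1 -> (forall s, 0 <= u s) -> 0 <= poisson u z.
Proof.
  intros Hu Hz H. apply avg_ge0; [now apply contR_poisson_integrand | ]. intros s.
  apply Rmult_le_pos; [easy | left; now apply poisson_kernel_pos].
Qed.

Lemma contR_Re_cps rho c r : rad rho c -> 0 <= r < rho -> contR (fun t => Re (cps c (circle_pt r t))).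
Proof. intros Hc Hr. apply (contC_cps rho c r Hc Hr). Qed.

Lemma contR_poisson u r : contR u -> 0 <= r < 1 -> contR (fun t => poisson u (circle_pt r t)).
Proof.
  intros Hu Hr.
  assert (E : forall t, Re (cps (herglotz u) (circle_pt r t)) = poisson u (circle_pt r t)).
  { intros t. apply herglotz_re; [easy | rewrite Cmod_circle; lra]. }
  assert (H := contR_Re_cps 1 (herglotz u) r (rad_herglotz u Hu) Hr).
  intros t. apply (continuous_ext _ _ t E). apply H.
Qed.

(** The Poisson integral is the real part of a power series; its mean over a
    circle is the constant coefficient, which is the average of u. *)
Lemma poisson_mean u r : contR u -> 0 <= r < 1 -> avg (fun t => poisson u (circle_pt r t)) = avg u.
Proof.
  intros Hu Hr.
  transitivity (Re (Cavg (fun t => cps (herglotz u) (circle_pt r t)))).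
  - apply avg_ext. intros t. symmetry. apply herglotz_re; [easy | rewrite Cmod_circle; lra].
  - rewrite (Cavg_cps 1) by (try easy; now apply rad_herglotz).
    change (herglotz u 0) with (fourier (fun s => RtoC (u s)) 0). now rewrite fourier_0, Cavg_RtoC.
Qed.

(** The kernel is positive with mean 1, so the tangent line inequality [young]
    at the value of the Poisson integral can be integrated. *)
Lemma poisson_jensen_pow u z q : contR u -> (forall s, 0 <= u s) -> Cmod z < 1 -> 1 <= q ->
  rpow (poisson u z) q <= poisson (fun s => rpow (u s) q) z.
Proof.
  intros Hu Hp Hz Hq. set (y := poisson u z).
  assert (Hy : 0 <= y) by now apply poisson_ge0.
  assert (Hr : contR (fun s => rpow (u s) q)) by (apply contR_rpow; try easy; lra).
  apply Rle_trans with (poisson (fun s => (q * rpow y (q - 1)) * u s + - ((q - 1) * rpow y q)) z).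
  - rewrite poisson_plus, poisson_scal, poisson_const by
      prove_cont.
    fold y. rewrite (rpow_pred y q) by easy. lra.
  - apply poisson_le; try easy.
    + apply contR_plus; [ | apply contR_const]. apply contR_mult; [apply contR_const | easy].
    + intros s. generalize (young (u s) y q Hq (Hp s) Hy). lra.
Qed.

Lemma contR_exp u : contR u -> contR (fun s => exp (u s)).
Proof. intros Hu. apply (contR_comp exp); [easy | intros; apply continuous_exp]. Qed.

Lemma poisson_jensen_exp u z : contR u -> Cmod z < 1 ->
  exp (poisson u z) <= poisson (fun s => exp (u s)) z.
Proof.
  intros Hu Hz. set (y := poisson u z).
  apply Rle_trans with (poisson (fun s => exp y * u s + exp y * (1 - y)) z).
  - rewrite poisson_plus, poisson_scal, poisson_const by
      prove_cont.
    fold y. lra.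
  - apply poisson_le; try easy; [ | now apply contR_exp | ].
    + apply contR_plus; [ | apply contR_const]. apply contR_mult; [apply contR_const | easy].
    + intros s. assert (P := exp_pos y).
      replace (exp (u s)) with (exp y * exp (u s - y)) by (rewrite <- exp_plus; f_equal; ring).
      assert (1 + (u s - y) <= exp (u s - y)) by (apply exp_ineq1_le). nra.
Qed.

Lemma poisson_mean_pow u r q : contR u -> (forall s, 0 <= u s) -> 0 <= r < 1 -> 1 <= q ->
  avg (fun t => rpow (poisson u (circle_pt r t)) q) <= avg (fun t => rpow (u t) q).
Proof.
  intros Hu Hp Hr Hq. assert (Hu' : contR (fun s => rpow (u s) q)) by (apply contR_rpow; try easy; lra).
  rewrite <- (poisson_mean (fun t => rpow (u t) q) r) by easy.
  apply avg_le.
  - apply contR_rpow; [now apply contR_poisson | | lra]. intros t. apply poisson_ge0; try easy.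
    rewrite Cmod_circle; lra.
  - now apply contR_poisson.
  - intros t. apply poisson_jensen_pow; try easy. rewrite Cmod_circle; lra.
Qed.

Lemma rad_dilate rho c r : rad rho c -> 0 <= r < rho -> rad 1 (fun n => c n * RtoC (r ^ n))%C.
Proof.
  intros Hc Hr x Hx. destruct (Hc r Hr) as [B HB]. exists B. intros n.
  rewrite Cmod_mult, Cmod_R, Rabs_pos_eq by (apply pow_le; lra).
  eapply Rle_trans; [ | apply (HB n)].
  rewrite <- (Rmult_1_r (Cmod (c n) * r ^ n)) at 2. apply Rmult_le_compat_l.
  - apply Rmult_le_pos; [apply Cmod_ge_0 | apply pow_le; lra].
  - rewrite <- (pow1 n). apply pow_incr; lra.
Qed.

Lemma cps_dilate c r z : cps (fun n => c n * RtoC (r ^ n))%C z = cps c (RtoC r * z).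
Proof.
  apply C_series_ext. intros n. rewrite Cpow_mult_l, RtoC_pow. ring.
Qed.

Lemma half_conj z : RtoC (Re z) = ((z + Cconj z) / 2)%C.
Proof.
  destruct z as [a b]. unfold RtoC, Re. apply injective_projections; simpl; field.
Qed.

Lemma fourier_Re_cps rho c r n : rad rho c -> 0 <= r < rho ->
  fourier (fun s => RtoC (Re (cps c (circle_pt r s)))) n =
  match n with O => RtoC (Re (c O)) | S _ => (c n * RtoC (r ^ n) / 2)%C end.
Proof.
  intros Hc Hr. assert (H := contC_cps rho c r Hc Hr).
  set (F := fun s => cps c (circle_pt r s)) in *.
  assert (Hw : contC (fun s => Cconj (expi s) ^ n)%C) by apply contC_pow, contC_conj, contC_expi.
  assert (Hw' : contC (fun s => expi s ^ n)%C) by apply contC_pow, contC_expi.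
  assert (E : fourier (fun s => RtoC (Re (F s))) n =
    ((c n * RtoC (r ^ n) + Cconj (Cavg (fun s => F s * expi s ^ n))) / 2)%C).
  { unfold fourier. rewrite <- (Cavg_cps_coef rho c r n) by easy. fold F.
    rewrite <- Cavg_conj by now apply contC_mult.
    rewrite <- Cavg_plus by (try apply contC_conj; now apply contC_mult).
    unfold Cdiv. rewrite Cmult_comm, <- Cavg_scal.
    - apply Cavg_ext. intros s. change (cps c (circle_pt r s)) with (F s). rewrite half_conj, Cmult_conj, Cconj_pow. field.
    - apply contC_plus; [now apply contC_mult | apply contC_conj; now apply contC_mult]. }
  change (fourier (fun s => RtoC (Re (F s))) n =
    match n with O => RtoC (Re (c O)) | S _ => (c n * RtoC (r ^ n) / 2)%C end).
  rewrite E. destruct n as [ | n].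
  - rewrite (Cavg_ext _ F) by (intros; simpl; ring). unfold F.
    rewrite (Cavg_cps rho) by easy. rewrite half_conj. simpl. f_equal. ring.
  - unfold F. rewrite (Cavg_cps_neg rho) by easy.
    replace (Cconj 0) with (RtoC 0) by (apply injective_projections; simpl; ring).
    f_equal. ring.
Qed.

(** A power series on a circle of convergence is the Poisson integral of its
    values there: both sides are real parts of power series, with equal
    coefficients by [fourier_Re_cps]. *)
Lemma poisson_cps rho c r z : rad rho c -> 0 <= r < rho -> Cmod z < 1 ->
  Re (cps c (RtoC r * z)) = poisson (fun s => Re (cps c (circle_pt r s))) z.
Proof.
  intros Hc Hr Hz. assert (Hu := contR_Re_cps rho c r Hc Hr).
  rewrite <- herglotz_re by easy. rewrite <- cps_dilate.
  rewrite (cps_shift 1 (herglotz _)) by (try easy; now apply rad_herglotz).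
  rewrite (cps_shift 1 (fun n => c n * RtoC (r ^ n))%C) by (try easy; now apply (rad_dilate rho)).
  set (u := fun s => Re (cps c (circle_pt r s))) in *.
  change (herglotz u 0) with (fourier (fun s => RtoC (u s)) 0). unfold u at 1.
  rewrite (fourier_Re_cps rho c r 0) by easy.
  rewrite (cps_ext (fun n => herglotz u (S n)) (fun n => c (S n) * RtoC (r ^ (S n)))%C).
  - set (x := (z * _)%C). unfold Re. simpl. ring.
  - intros n. change (herglotz u (S n)) with (2 * fourier (fun s => RtoC (u s)) (S n))%C.
    unfold u. rewrite (fourier_Re_cps rho) by easy. field.
Qed.

(** Rotate the value to the positive axis and bound a real part by a
    modulus. *)
Lemma cps_submean rho c r z : rad rho c -> 0 <= r < rho -> Cmod z < 1 ->
  Cmod (cps c (RtoC r * z)) <= poisson (fun s => Cmod (cps c (circle_pt r s))) z.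
Proof.
  intros Hc Hr Hz. destruct (unimodular_rotation (cps c (RtoC r * z))) as [m [Hm E]].
  assert (Hrz : Cmod (RtoC r * z) < rho).
  { rewrite Cmod_mult, Cmod_R, Rabs_pos_eq by lra. generalize (Cmod_ge_0 z). nra. }
  replace (Cmod (cps c (RtoC r * z))) with (Re (cps (fun n => m * c n)%C (RtoC r * z))).
  2: { rewrite (cps_scal rho) by easy. now rewrite E. }
  rewrite (poisson_cps rho) by (try easy; now apply rad_scal).
  apply poisson_le; try easy.
  - apply (contR_Re_cps rho); [now apply rad_scal | easy].
  - apply contC_Cmod. now apply (contC_cps rho).
  - intros s. eapply Rle_trans; [apply Rle_abs | ]. eapply Rle_trans; [apply Re_le_Cmod | ].
    rewrite (cps_scal rho) by (try easy; rewrite Cmod_circle; lra).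
    rewrite Cmod_mult, Hm. lra.
Qed.

Lemma cps_maximum rho c r z B : rad rho c -> 0 <= r < rho -> Cmod z < 1 ->
  (forall s, Cmod (cps c (circle_pt r s)) <= B) -> Cmod (cps c (RtoC r * z)) <= B.
Proof.
  intros Hc Hr Hz HB. eapply Rle_trans; [now apply (cps_submean rho) | ].
  rewrite <- (poisson_const B z) by easy. apply poisson_le; try easy; [ | apply contR_const].
  apply contC_Cmod. now apply (contC_cps rho).
Qed.

(** The q-th power of the integral mean of order q on the circle of radius r. *)
Definition cmean (q : R) (c : nat -> C) (r : R) : R :=
  avg (fun t => rpow (Cmod (cps c (circle_pt r t))) q).

Lemma contR_cmean rho q c r : rad rho c -> 0 <= r < rho -> 0 < q ->
  contR (fun t => rpow (Cmod (cps c (circle_pt r t))) q).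
Proof.
  intros Hc Hr Hq. apply contR_rpow; [ | intros; apply Cmod_ge_0 | easy].
  apply contC_Cmod. now apply (contC_cps rho).
Qed.

(** By [cps_submean] the values on the smaller circle are dominated by a Poisson
    integral of the moduli on the larger one, and Poisson integration does not
    increase q-th power means. *)
Lemma cmean_mono rho q c r s : rad rho c -> 1 <= q -> 0 <= r <= s -> s < rho ->
  cmean q c r <= cmean q c s.
Proof.
  intros Hc Hq [Hr [Hrs | ->]] Hs; [ | lra].
  assert (Hx : 0 <= r / s < 1).
  { split; [apply Rmult_le_pos; [easy | left; apply Rinv_0_lt_compat; lra] | ].
    apply Rmult_lt_reg_r with s; [lra | ]. field_simplify; lra. }
  assert (E : forall t, circle_pt r t = (RtoC s * circle_pt (r / s) t)%C).
  { intros t. rewrite !circle_pt_expi. rewrite Cmult_assoc, <- RtoC_mult. repeat f_equal. field. lra. }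
  assert (Hm : forall t, Cmod (circle_pt (r / s) t) < 1) by (intros; rewrite Cmod_circle; lra).
  assert (Hu : contR (fun t => Cmod (cps c (circle_pt s t)))) by (apply contC_Cmod, (contC_cps rho); [easy | lra]).
  eapply Rle_trans; [ | apply (poisson_mean_pow _ (r / s) q Hu); try easy; intros; apply Cmod_ge_0].
  apply avg_le.
  - apply (contR_cmean rho); [easy | lra | lra].
  - apply contR_rpow; [now apply contR_poisson | | lra]. intros t.
    apply poisson_ge0; try easy; intros; apply Cmod_ge_0.
  - intros t. apply rpow_le; [apply Cmod_ge_0 | | lra]. rewrite E.
    apply (cps_submean rho); [easy | lra | easy].
Qed.

Lemma cps_poly (c : nat -> C) N z : (forall n, (N <= n)%nat -> c n = 0) -> cps c z = csum (fun n => c n * z ^ n)%C N.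
Proof.
  intros H. apply cser_C_series. intros e He. exists N. intros n Hn.
  replace n with (N + (n - N))%nat by lia. rewrite csum_add.
  rewrite (csum_ext (fun k => c (N + k)%nat * z ^ (N + k))%C (fun _ => 0 * 0)%C).
  2: { intros k _. rewrite H by lia. ring. }
  rewrite csum_scal. replace (_ - _)%C with (RtoC 0) by ring. now rewrite Cmod_0.
Qed.

Lemma rad_poly (c : nat -> C) N rho : (forall n, (N <= n)%nat -> c n = 0) -> rad rho c.
Proof.
  intros H r Hr. exists (rsum (fun k => Cmod (c k) * r ^ k) N). intros n.
  assert (P : forall k, 0 <= Cmod (c k) * r ^ k).
  { intros k. apply Rmult_le_pos; [apply Cmod_ge_0 | apply pow_le; lra]. }
  destruct (Nat.le_gt_cases N n).
  - rewrite H, Cmod_0 by easy. rewrite Rmult_0_l. now apply rsum_ge0.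
  - eapply Rle_trans; [ | apply (rsum_incr _ (S n) N); [easy | lia]]. simpl.
    assert (Q := rsum_ge0 (fun k => Cmod (c k) * r ^ k) n P). lra.
Qed.

(** A quantitative version of the convergence of Poisson integrals to their
    boundary function. In the manner of Korovkin, |u(s) - u(t)| is dominated by
    e plus a multiple of |e^{is} - e^{it}|^2, a trigonometric polynomial of degree
    1 whose Poisson integral at r e^{it} is exactly 2 - 2r. *)
Lemma poisson_approx u L r t e : contR u -> 0 <= r < 1 -> 0 < e ->
  (forall s, Rabs (u s - u t) <= L * Cmod (expi s - expi t)) ->
  Rabs (poisson u (circle_pt r t) - u t) <= e + L * L / (4 * e) * (2 - 2 * r).
Proof.
  intros Hu Hr He HL. set (z := circle_pt r t).
  assert (Hz : Cmod z < 1) by (unfold z; rewrite Cmod_circle; lra).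
  set (A := L * L / (4 * e)).
  set (c := fun n => match n with 1%nat => Cconj (expi t) | _ => RtoC 0 end).
  assert (Hc0 : forall n, (2 <= n)%nat -> c n = 0).
  { intros [ | [ | n]] Hn; [lia | lia | easy]. }
  assert (Ec : forall x, cps c x = (Cconj (expi t) * x)%C).
  { intros x. rewrite (cps_poly c 2) by easy. simpl. ring. }
  assert (Hrc : contR (fun s => Re (cps c (circle_pt 1 s)))).
  { apply (contR_Re_cps 2); [now apply (rad_poly c 2) | lra]. }
  assert (Q : forall s, Cmod (expi s - expi t) * Cmod (expi s - expi t) =
     2 + - 2 * Re (cps c (circle_pt 1 s))).
  { intros s. rewrite Ec, circle_pt_expi.
    assert (E := Cmod2_alt (expi s - expi t)). simpl in E. rewrite Rmult_1_r in E. rewrite E.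
    unfold Re, Im, expi. simpl. generalize (sin2_cos2 s) (sin2_cos2 t). unfold Rsqr. intros. nra. }
  assert (P1 : poisson (fun s => (e + 2 * A) + (- 2 * A) * Re (cps c (circle_pt 1 s))) z =
     e + A * (2 - 2 * r)).
  { rewrite poisson_plus, poisson_const, poisson_scal;
      prove_cont.
    rewrite <- (poisson_cps 2) by first [easy | now apply (rad_poly c 2) | lra].
    rewrite Ec. unfold z. rewrite circle_pt_expi.
    replace (Cconj (expi t) * (1 * (r * expi t)))%C with (r * (expi t * Cconj (expi t)))%C by ring.
    rewrite expi_conj, Cmult_1_r. unfold Re, RtoC. simpl. ring. }
  assert (B : forall s, Rabs (u s - u t) <= (e + 2 * A) + (- 2 * A) * Re (cps c (circle_pt 1 s))).
  { intros s. eapply Rle_trans; [apply HL | ].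
    replace (e + 2 * A + -2 * A * Re (cps c (circle_pt 1 s))) with
      (e + A * (2 + - 2 * Re (cps c (circle_pt 1 s)))) by ring.
    rewrite <- Q. unfold A. set (h := Cmod (expi s - expi t)).
    assert (0 <= (L * h - 2 * e) * (L * h - 2 * e) / (4 * e)).
    { apply Rmult_le_pos; [apply Rle_0_sqr | left; apply Rinv_0_lt_compat; lra]. }
    replace ((L * h - 2 * e) * (L * h - 2 * e) / (4 * e)) with
       (e + L * L / (4 * e) * (h * h) - L * h) in H by (field; lra). lra. }
  assert (D : poisson (fun s => u s + - u t) z = poisson u z - u t).
  { rewrite poisson_plus, poisson_const; try easy; apply contR_const. }
  assert (Hd : contR (fun s => u s + - u t)) by (apply contR_plus; [easy | apply contR_const]).
  assert (Hb : contR (fun s => (e + 2 * A) + (- 2 * A) * Re (cps c (circle_pt 1 s)))).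
  { apply contR_plus; [apply contR_const | ]. apply contR_mult; [apply contR_const | easy]. }
  rewrite <- D, <- P1. apply Rabs_le. split.
  - rewrite <- (Rmult_1_l (poisson _ z)), Ropp_mult_distr_l, <- poisson_scal by easy.
    apply poisson_le; try easy; [apply contR_mult; [apply contR_const | easy] | ].
    intros s. specialize (B s). apply Rabs_le_between in B. lra.
  - apply poisson_le; try easy. intros s. specialize (B s). apply Rabs_le_between in B. lra.
Qed.

(** * The complex exponential *)

Definition cexp (z : C) : C := (RtoC (exp (Re z)) * expi (Im z))%C.

Lemma cexp_plus z w : cexp (z + w) = (cexp z * cexp w)%C.
Proof.
  unfold cexp, expi, Re, Im. simpl. rewrite exp_plus, cos_plus, sin_plus.
  apply injective_projections; simpl; ring.
Qed.

Lemma Cmod_cexp z : Cmod (cexp z) = exp (Re z).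
Proof.
  unfold cexp. rewrite Cmod_mult, Cmod_R, Cmod_expi, Rmult_1_r.
  apply Rabs_pos_eq. left; apply exp_pos.
Qed.

(** The Cauchy-Riemann equations, for functions whose real and imaginary parts
    are differentiable in the real sense. *)
Lemma cderiv_CR f x y a b :
  differentiable_pt_lim (fun x y => Re (f (x, y))) x y a (- b) ->
  differentiable_pt_lim (fun x y => Im (f (x, y))) x y b a ->
  cderiv f (x, y) (a, b).
Proof.
  intros H1 H2 e He. assert (E2 : 0 < e / 2) by lra.
  destruct (H1 (mkposreal _ E2)) as [d1 K1]. destruct (H2 (mkposreal _ E2)) as [d2 K2].
  exists (Rmin d1 d2). split; [apply Rmin_glb_lt; apply cond_pos | ].
  intros [u v] Hw. set (h := Cmod ((u, v) - (x, y))) in *.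
  assert (Hu : Rabs (u - x) <= h) by exact (Re_le_Cmod ((u, v) - (x, y))).
  assert (Hv : Rabs (v - y) <= h) by exact (Im_le_Cmod ((u, v) - (x, y))).
  assert (W1 := Rlt_le_trans _ _ _ Hw (Rmin_l _ _)).
  assert (W2 := Rlt_le_trans _ _ _ Hw (Rmin_r _ _)).
  specialize (K1 u v ltac:(lra) ltac:(lra)). specialize (K2 u v ltac:(lra) ltac:(lra)).
  simpl in K1, K2.
  assert (M : Rmax (Rabs (u - x)) (Rabs (v - y)) <= h) by now apply Rmax_lub.
  eapply Rle_trans; [apply Cmod_le_ReIm | ].
  replace (Re (f (u, v) - f (x, y) - (a, b) * ((u, v) - (x, y)))) with
    (Re (f (u, v)) - Re (f (x, y)) - (a * (u - x) + - b * (v - y))).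
  2: { unfold Re. simpl. ring. }
  replace (Im (f (u, v) - f (x, y) - (a, b) * ((u, v) - (x, y)))) with
    (Im (f (u, v)) - Im (f (x, y)) - (b * (u - x) + a * (v - y))).
  2: { unfold Im. simpl. ring. }
  assert (0 <= Rmax (Rabs (u - x)) (Rabs (v - y))).
  { eapply Rle_trans; [apply Rabs_pos | apply Rmax_l]. }
  unfold Re, Im in *. simpl in *. nra.
Qed.

Lemma differentiable_C1 (f fx : R -> R -> R) x y fy :
  (exists d, 0 < d /\ forall u v, Rabs (u - x) < d -> Rabs (v - y) < d ->
     is_derive (fun z => f z v) u (fx u v)) ->
  is_derive (fun z => f x z) y fy ->
  continuity_2d_pt fx x y -> differentiable_pt_lim f x y (fx x y) fy.
Proof.
  intros [d [Hd H]] Hy Hc. apply filterdiff_differentiable_pt_lim.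
  apply (is_derive_filterdiff f x y fx fy).
  - exists (mkposreal d Hd). intros [u v] [Hu Hv]. now apply H.
  - easy.
  - now apply continuity_2d_pt_filterlim in Hc.
Qed.

Lemma continuity_2d_fst f x y : continuous f x -> continuity_2d_pt (fun u _ => f u) x y.
Proof.
  intros H. apply (continuity_1d_2d_pt_comp f (fun u _ => u)).
  - now apply continuity_pt_filterlim.
  - apply continuity_2d_pt_id1.
Qed.

Lemma continuity_2d_snd f x y : continuous f y -> continuity_2d_pt (fun _ v => f v) x y.
Proof.
  intros H. apply (continuity_1d_2d_pt_comp f (fun _ v => v)).
  - now apply continuity_pt_filterlim.
  - apply continuity_2d_pt_id2.
Qed.

Lemma cderiv_cexp z : cderiv cexp z (cexp z).
Proof.
  destruct z as [x y].
  replace (cexp (x, y)) with (exp x * cos y, exp x * sin y).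
  2: { unfold cexp, expi, Re, Im. apply injective_projections; simpl; ring. }
  apply cderiv_CR.
  - apply (differentiable_C1 _ (fun u v => exp u * cos v) x y (- (exp x * sin y))).
    + exists 1. split; [lra | ]. intros u v _ _.
      apply (is_derive_ext (fun z => exp z * cos v)).
      * intros t. unfold cexp, expi, Re, Im. simpl. ring.
      * auto_derive; [easy | ring].
    + apply (is_derive_ext (fun z => exp x * cos z)).
      * intros t. unfold cexp, expi, Re, Im. simpl. ring.
      * auto_derive; [easy | ring].
    + apply continuity_2d_pt_mult; [apply (continuity_2d_fst exp), continuous_exp | apply (continuity_2d_snd cos), continuous_cos].
  - apply (differentiable_C1 _ (fun u v => exp u * sin v) x y (exp x * cos y)).
    + exists 1. split; [lra | ]. intros u v _ _.
      apply (is_derive_ext (fun z => exp z * sin v)).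
      * intros t. unfold cexp, expi, Re, Im. simpl. ring.
      * auto_derive; [easy | ring].
    + apply (is_derive_ext (fun z => exp x * sin z)).
      * intros t. unfold cexp, expi, Re, Im. simpl. ring.
      * auto_derive; [easy | ring].
    + apply continuity_2d_pt_mult; [apply (continuity_2d_fst exp), continuous_exp | apply (continuity_2d_snd sin), continuous_sin].
Qed.

Lemma holC1_cexp f f' : holC1 f f' -> holC1 (fun z => cexp (f z)) (fun z => cexp (f z) * f' z)%C.
Proof.
  intros Hf. apply (holC1_comp cexp cexp); [easy | ]. intros z _. split; [apply cderiv_cexp | ].
  apply (cderiv_cont _ _ _ (cderiv_cexp _)).
Qed.

Lemma holC1_cps_scal k c : rad 1 c -> exists f', holC1 (fun z => k * cps c z)%C f'.
Proof.
  intros Hc. exists (fun z => 0 * cps c z + k * cps (deriv_coef c) z)%C.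
  apply (holC1_mult (fun _ => k) (fun _ => RtoC 0)).
  - intros z _. split; [apply cderiv_const | apply ccont_const].
  - now apply holC1_cps.
Qed.

(** * Bessel's and Hilbert's inequalities *)

Lemma Cmod_sqr_conj z : RtoC (Cmod z * Cmod z) = (z * Cconj z)%C.
Proof. rewrite <- Cmod2_conj. f_equal. ring. Qed.

Lemma Cconj_csum a n : Cconj (csum a n) = csum (fun k => Cconj (a k)) n.
Proof.
  induction n; simpl; [apply injective_projections; simpl; ring | ].
  now rewrite Cplus_conj, IHn.
Qed.

Lemma csum_RtoC a n : csum (fun k => RtoC (a k)) n = RtoC (rsum a n).
Proof. induction n; simpl; [easy | ]. now rewrite IHn, RtoC_plus. Qed.

Definition tpoly (b : nat -> C) (N : nat) (t : R) : C := csum (fun j => b j * expi t ^ j)%C N.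

Lemma contC_tpoly b N : contC (tpoly b N).
Proof.
  apply (contC_csum (fun j t => b j * expi t ^ j)%C). intros k.
  apply contC_mult; [apply contC_const | apply contC_pow, contC_expi].
Qed.

Lemma Cavg_conj_tpoly F b N : contC F -> (forall j, (j < N)%nat -> fourier F j = b j) ->
  Cavg (fun t => F t * Cconj (tpoly b N t))%C = RtoC (rsum (fun j => Cmod (b j) * Cmod (b j)) N).
Proof.
  intros HF Hb. unfold tpoly.
  rewrite (Cavg_ext _ (fun t => csum (fun j => Cconj (b j) * (F t * Cconj (expi t) ^ j)) N)%C).
  - rewrite (Cavg_csum (fun j t => Cconj (b j) * (F t * Cconj (expi t) ^ j))%C).
    + rewrite <- csum_RtoC. apply csum_ext. intros k Hk.
      assert (contC (fun t => F t * Cconj (expi t) ^ k)%C) by (apply contC_mult; [easy | apply contC_pow, contC_conj, contC_expi]).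
      rewrite Cavg_scal by easy. fold (fourier F k). rewrite Hb by easy.
      rewrite Cmod_sqr_conj. ring.
    + intros k. apply contC_mult; [apply contC_const | ].
      apply contC_mult; [easy | apply contC_pow, contC_conj, contC_expi].
  - intros t. rewrite Cconj_csum, <- csum_scal. apply csum_ext. intros k _.
    rewrite Cmult_conj, Cconj_pow. ring.
Qed.

Lemma fourier_tpoly b N j : (j < N)%nat -> fourier (tpoly b N) j = b j.
Proof.
  intros Hj. unfold fourier.
  set (c := fun n => if le_lt_dec N n then RtoC 0 else b n).
  assert (Hc : forall n, (N <= n)%nat -> c n = 0).
  { intros n Hn. unfold c. destruct (le_lt_dec N n); [easy | lia]. }
  assert (E := Cavg_cps_coef 2 c 1 j (rad_poly c N 2 Hc) ltac:(lra)).
  rewrite pow1, Cmult_1_r in E.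
  transitivity (c j).
  - rewrite <- E. apply Cavg_ext. intros t. f_equal. rewrite (cps_poly c N) by easy.
    apply csum_ext. intros k Hk. rewrite circle_pow, pow1, Cmult_1_l.
    unfold c. destruct (le_lt_dec N k); [lia | easy].
  - unfold c. destruct (le_lt_dec N j); [lia | easy].
Qed.

Lemma parseval_tpoly b N :
  avg (fun t => Cmod (tpoly b N t) * Cmod (tpoly b N t)) = rsum (fun j => Cmod (b j) * Cmod (b j)) N.
Proof.
  apply RtoC_inj. rewrite <- Cavg_RtoC.
  rewrite <- (Cavg_conj_tpoly (tpoly b N) b N); [ | apply contC_tpoly | intros; now apply fourier_tpoly].
  apply Cavg_ext. intros t. apply Cmod_sqr_conj.
Qed.

(** The mean of |F - S|^2 is nonnegative, where S is the partial Fourier sum. *)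
Lemma bessel F N : contC F ->
  rsum (fun j => Cmod (fourier F j) * Cmod (fourier F j)) N <= avg (fun t => Cmod (F t) * Cmod (F t)).
Proof.
  intros HF. set (S := tpoly (fourier F) N). assert (HS : contC S) by apply contC_tpoly.
  assert (E1 := Cavg_conj_tpoly F (fourier F) N HF ltac:(easy)).
  assert (E2 := parseval_tpoly (fourier F) N). fold S in E1, E2.
  set (X := rsum _ N) in *.
  assert (HF2 : contR (fun t => Cmod (F t) * Cmod (F t))) by (apply contR_mult; now apply contC_Cmod).
  assert (HS2 : contR (fun t => Cmod (S t) * Cmod (S t))) by (apply contR_mult; now apply contC_Cmod).
  assert (HR : contR (fun t => Re (F t * Cconj (S t)))).
  { apply (contC_mult F (fun t => Cconj (S t))); [easy | now apply contC_conj]. }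
  assert (E3 : avg (fun t => Re (F t * Cconj (S t))) = X).
  { apply (f_equal Re) in E1. exact E1. }
  assert (P : 0 <= avg (fun t => (Cmod (F t) * Cmod (F t) + Cmod (S t) * Cmod (S t))
       + (-2) * Re (F t * Cconj (S t)))).
  { apply avg_ge0.
    - apply contR_plus; [now apply contR_plus | ]. apply contR_mult; [apply contR_const | easy].
    - intros t. replace (_ + _) with (Cmod (F t - S t) * Cmod (F t - S t)).
      + apply Rle_0_sqr.
      + assert (A := Cmod2_alt (F t - S t)). assert (B := Cmod2_alt (F t)).
        assert (D := Cmod2_alt (S t)). simpl in A, B, D. rewrite !Rmult_1_r in A, B, D.
        rewrite A, B, D. unfold Re, Im. simpl. ring. }
  rewrite avg_plus, avg_plus, avg_scal, E3, E2 in P; try easy.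
  - lra.
  - now apply contR_plus.
  - apply contR_mult; [apply contR_const | easy].
Qed.

(** The Fourier coefficients of the sawtooth are i/n: a bounded function produces
    the Hilbert matrix. *)
Lemma Cavg_sawtooth n : Cavg (fun t => RtoC (PI - t) * expi t ^ (S n))%C = (Ci / RtoC (INR (S n)))%C.
Proof.
  assert (Hn : 0 < INR (S n)) by apply (lt_0_INR (S n)), Nat.lt_0_succ.
  assert (E1 := sin_2npi (S n)). assert (E2 := cos_2npi (S n)).
  rewrite (Cavg_ext _ (fun t => RtoC (PI - t) * expi (INR (S n) * t))%C)
    by (intros; now rewrite expi_pow).
  set (k := INR (S n)) in *.
  assert (HP := PI_RGT_0).
  assert (Hk : contR (fun t => k * t)).
  { apply contR_mult; [apply contR_const | intros t; apply continuous_id]. }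
  assert (Hs : contR (fun t => sin (k * t))) by (apply (contR_comp sin); [easy | intros; apply continuous_sin]).
  assert (Hc : contR (fun t => cos (k * t))) by (apply (contR_comp cos); [easy | intros; apply continuous_cos]).
  assert (Hp : contR (fun t => PI - t)) by (apply contR_minus; [apply contR_const | intros t; apply continuous_id]).
  replace (Ci / RtoC k)%C with ((0, / k) : C).
  2: { unfold Ci, RtoC, Cdiv, Cinv. apply injective_projections; simpl; field; lra. }
  apply injective_projections; simpl.
  - rewrite (avg_ext _ (fun t => (PI - t) * cos (k * t))) by (intros; unfold Re; simpl; ring).
    apply (avg_derive (fun t => (PI - t) * (/ k * sin (k * t)) - / (k * k) * cos (k * t))).
    + intros t. auto_derive; [easy | field; lra].
    + now apply contR_mult.
    + rewrite E1, E2, !Rmult_0_r, sin_0, cos_0. ring.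
  - rewrite (avg_ext _ (fun t => (PI - t) * sin (k * t))) by (intros; unfold Im; simpl; ring).
    unfold avg. rewrite (is_RInt_unique _ 0 (2 * PI) (minus
      ((PI - 2 * PI) * (- / k * cos (k * (2 * PI))) - / (k * k) * sin (k * (2 * PI)))
      ((PI - 0) * (- / k * cos (k * 0)) - / (k * k) * sin (k * 0)))).
    + rewrite E1, E2, !Rmult_0_r, sin_0, cos_0. unfold minus, plus, opp; simpl. field. lra.
    + apply (is_RInt_derive (V := R_CompleteNormedModule)
       (fun t => (PI - t) * (- / k * cos (k * t)) - / (k * k) * sin (k * t))).
      * intros t _. auto_derive; [easy | field; lra].
      * intros t _. now apply contR_mult.
Qed.

(** Toeplitz's proof: up to the factor i, the double sum is the average of
    (pi - t) e^{it} P(t) Q(t), where P and Q are the trigonometric polynomials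
    with coefficients a and b, and |pi - t| <= pi. *)
Lemma hilbert_inequality (a b : nat -> R) N (Wa Wb : R) :
  rsum (fun j => a j * a j) N <= Wa -> rsum (fun j => b j * b j) N <= Wb ->
  rsum (fun j => rsum (fun l => a j * b l / INR (S (j + l))) N) N <= PI * ((Wa + Wb) / 2).
Proof.
  intros Ha Hb. set (A := fun j => RtoC (a j)). set (B := fun j => RtoC (b j)).
  set (P := tpoly A N). set (Q := tpoly B N).
  assert (HP := contC_tpoly A N : contC P). assert (HQ := contC_tpoly B N : contC Q).
  assert (Hs : contC (fun t => RtoC (PI - t))).
  { apply contC_RtoC. apply contR_minus; [apply contR_const | intros t; apply continuous_id]. }
  set (K := fun j l t => (A j * B l * (RtoC (PI - t) * expi t ^ (S (j + l))))%C).
  assert (Hb' : forall n, contC (fun t => RtoC (PI - t) * expi t ^ (S n))%C).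
  { intros n. apply contC_mult; [easy | apply contC_pow, contC_expi]. }
  assert (HK : forall j l, contC (K j l)) by (intros j l; apply contC_mult; [apply contC_const | apply Hb']).
  set (T := fun t => (RtoC (PI - t) * expi t * (P t * Q t))%C).
  assert (HT : contC T).
  { apply contC_mult; [apply contC_mult; [easy | apply contC_expi] | now apply contC_mult]. }
  assert (ET : forall t, T t = csum (fun j => csum (fun l => K j l t) N) N).
  { intros t. unfold T, P at 1, tpoly.
    transitivity (csum (fun j => (RtoC (PI - t) * expi t * Q t) * (A j * expi t ^ j)) N)%C.
    - rewrite csum_scal. ring.
    - apply csum_ext. intros j _. unfold Q, tpoly.
      transitivity (csum (fun l => (RtoC (PI - t) * expi t * (A j * expi t ^ j)) * (B l * expi t ^ l)) N)%C.
      + rewrite csum_scal. ring.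
      + apply csum_ext. intros l _. unfold K. rewrite Cpow_S, Cpow_add_r. ring. }
  assert (E : Cavg T = (Ci * RtoC (rsum (fun j => rsum (fun l => a j * b l / INR (S (j + l)))%R N) N))%C).
  { rewrite (Cavg_ext _ _ ET).
    rewrite (Cavg_csum (fun j t => csum (fun l => K j l t) N)) by (intros; now apply contC_csum).
    rewrite <- csum_RtoC, <- csum_scal. apply csum_ext. intros j _.
    rewrite (Cavg_csum (K j)) by easy.
    rewrite <- csum_RtoC, <- csum_scal. apply csum_ext. intros l _.
    unfold K. rewrite Cavg_scal, Cavg_sawtooth by apply Hb'.
    assert (INR (S (j + l)) <> 0) by (apply not_0_INR; lia).
    unfold A, B, Rdiv. rewrite !RtoC_mult, RtoC_inv by easy. field.
    intros Z. apply RtoC_inj in Z. easy. }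
  assert (L : Rabs (rsum (fun j => rsum (fun l => a j * b l / INR (S (j + l))) N) N) = Cmod (Cavg T)).
  { rewrite E, Cmod_mult, Cmod_Ci, Cmod_R. ring. }
  eapply Rle_trans; [apply Rle_abs | ]. rewrite L.
  eapply Rle_trans; [now apply Cmod_Cavg | ].
  assert (HP2 : contR (fun t => Cmod (P t) * Cmod (P t))) by (apply contR_mult; now apply contC_Cmod).
  assert (HQ2 : contR (fun t => Cmod (Q t) * Cmod (Q t))) by (apply contR_mult; now apply contC_Cmod).
  assert (E1 := parseval_tpoly A N). assert (E2 := parseval_tpoly B N).
  fold P in E1. fold Q in E2. assert (PP := PI_RGT_0).
  apply Rle_trans with (avg (fun t => PI / 2 * (Cmod (P t) * Cmod (P t) + Cmod (Q t) * Cmod (Q t)))).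
  - apply avg_le_loc; [now apply contC_Cmod | apply contR_mult; [apply contR_const | now apply contR_plus] | ].
    intros t Ht. unfold T. rewrite !Cmod_mult, Cmod_expi, Cmod_R.
    assert (Rabs (PI - t) <= PI) by (apply Rabs_le; lra).
    assert (P0 := Cmod_ge_0 (P t)). assert (Q0 := Cmod_ge_0 (Q t)).
    assert (S0 := Rle_0_sqr (Cmod (P t) - Cmod (Q t))). unfold Rsqr in S0.
    apply Rle_trans with (PI * (Cmod (P t) * Cmod (Q t))).
    + rewrite Rmult_1_r. apply Rmult_le_compat_r; [now apply Rmult_le_pos | easy].
    + nra.
  - rewrite avg_scal, avg_plus, E1, E2 by (try easy; now apply contR_plus).
    rewrite (rsum_ext (fun j => Cmod (A j) * Cmod (A j)) (fun j => a j * a j)).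
    + rewrite (rsum_ext (fun j => Cmod (B j) * Cmod (B j)) (fun j => b j * b j)).
      * nra.
      * intros k _. unfold B. rewrite Cmod_R. now rewrite <- Rabs_mult, Rabs_pos_eq by apply Rle_0_sqr.
    + intros k _. unfold A. rewrite Cmod_R. now rewrite <- Rabs_mult, Rabs_pos_eq by apply Rle_0_sqr.
Qed.

(** * Factorisation in H^1 and Hardy's inequality *)

Lemma pow_lip (z w : C) n : Cmod z <= 1 -> Cmod w <= 1 ->
  Cmod (z ^ n - w ^ n) <= INR n * Cmod (z - w).
Proof.
  intros Hz Hw. induction n.
  - simpl. replace (1 - 1)%C with (RtoC 0) by ring. rewrite Cmod_0. lra.
  - rewrite S_INR. simpl Cpow.
    replace (z * z ^ n - w * w ^ n)%C with (z * (z ^ n - w ^ n) + w ^ n * (z - w))%C by ring.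
    eapply Rle_trans; [apply Cmod_triangle | ]. rewrite !Cmod_mult, Cmod_pow.
    assert (Cmod w ^ n <= 1).
    { rewrite <- (pow1 n). apply pow_incr. split; [apply Cmod_ge_0 | easy]. }
    assert (P1 := Cmod_ge_0 z). assert (P2 := Cmod_ge_0 (z ^ n - w ^ n)).
    assert (P3 := Cmod_ge_0 (z - w)). assert (P4 := pow_le _ n (Cmod_ge_0 w)). nra.
Qed.

(** Analyticity across the unit circle gives a Lipschitz bound up to the
    boundary. *)
Lemma cps_lip rho c : rad rho c -> 1 < rho -> exists L, 0 <= L /\
  forall z w, Cmod z <= 1 -> Cmod w <= 1 -> Cmod (cps c z - cps c w) <= L * Cmod (z - w).
Proof.
  intros Hc Hr. destruct (rad_summable rho _ 1 (rad_scale_n _ _ Hc)) as [L HL]; [lra | ].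
  exists L. split; [exact (HL 0%nat) | ]. intros z w Hz Hw.
  assert (S : cser (fun n => c n * z ^ n + (- (1)) * (c n * w ^ n))%C (cps c z + (- (1)) * cps c w)).
  { apply cser_plus; [ | apply cser_scal]; apply (cps_cser rho); try easy; lra. }
  replace (cps c z - cps c w)%C with (cps c z + (- (1)) * cps c w)%C by ring.
  apply (cser_abs_bound _ _ _ S). intros n. rewrite Rmult_comm.
  eapply Rle_trans; [ | apply Rmult_le_compat_l; [apply Cmod_ge_0 | apply (HL n)]].
  rewrite <- rsum_scal. apply rsum_le. intros k _.
  replace (c k * z ^ k + - (1) * (c k * w ^ k))%C with (c k * (z ^ k - w ^ k))%C by ring.
  rewrite !Cmod_mult, Cmod_R, Rabs_pos_eq, pow1 by apply pos_INR.
  assert (H := pow_lip z w k Hz Hw). assert (P := Cmod_ge_0 (c k)). nra.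
Qed.

Lemma ln_lip a b e : 0 < e -> e <= a -> e <= b -> Rabs (ln a - ln b) <= Rabs (a - b) / e.
Proof.
  intros He.
  assert (H : forall a b, e <= a -> e <= b -> ln a - ln b <= Rabs (a - b) / e).
  { intros x y Hx Hy. rewrite <- ln_div by lra.
    eapply Rle_trans; [apply ln_le_sub1; apply Rdiv_lt_0_compat; lra | ].
    replace (x / y - 1) with ((x - y) / y) by (field; lra).
    apply Rle_trans with (Rabs (x - y) / y).
    - apply Rmult_le_compat_r; [left; apply Rinv_0_lt_compat; lra | apply Rle_abs].
    - apply Rmult_le_compat_l; [apply Rabs_pos | apply Rinv_le_contravar; lra]. }
  intros Ha Hb. apply Rabs_le. split; [ | now apply H].
  generalize (H b a Hb Ha). rewrite (Rabs_minus_sym b a). lra.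
Qed.

Lemma bernoulli_nat d m : 0 <= d <= 1 -> 1 - INR m * d <= (1 - d) ^ m.
Proof.
  intros Hd. induction m; [simpl; lra | ]. rewrite S_INR. simpl pow.
  assert (0 <= INR m * (d * d)) by (apply Rmult_le_pos; [apply pos_INR | nra]).
  apply Rle_trans with ((1 - d) * (1 - INR m * d)); [lra | ].
  apply Rmult_le_compat_l; lra.
Qed.

(** Passage to the limit r -> 1 in bounds for finite sums of Taylor
    coefficients. *)
Lemma pow_limit_le X W m : 0 <= X -> (forall r, 0 < r < 1 -> r ^ m * X <= W) -> X <= W.
Proof.
  intros X0 B. apply le_all_eps. intros e He.
  destruct (Req_dec X 0) as [E | E].
  { specialize (B (/ 2) ltac:(lra)). rewrite E in *. lra. }
  assert (XP : 0 < X) by lra.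
  set (M := INR m). assert (HM : 0 <= M) by apply pos_INR.
  assert (XM : 0 < X * (M + 1)) by (apply Rmult_lt_0_compat; lra).
  set (d := Rmin (/ 2) (e / (X * (M + 1)))).
  assert (Hd : 0 < d) by (apply Rmin_glb_lt; [lra | now apply Rdiv_lt_0_compat]).
  assert (Hd2 : d <= / 2) by apply Rmin_l.
  assert (Hd3 : d <= e / (X * (M + 1))) by apply Rmin_r.
  specialize (B (1 - d) ltac:(lra)).
  assert (Bn : 1 - M * d <= (1 - d) ^ m).
  { apply bernoulli_nat. lra. }
  assert (X * (M * d) <= e).
  { apply Rle_trans with (X * (M + 1) * (e / (X * (M + 1)))); [ | right; field; lra].
    replace (X * (M * d)) with (X * M * d) by ring. apply Rmult_le_compat; nra. }
  nra.
Qed.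

(** The boundary weight w = |F| + eps of a function F that is analytic across the
    unit circle, and its logarithm u. Adding eps makes u Lipschitz even if F has
    zeros on the circle. *)
Section Factor.
Variables (c : nat -> C) (rho eps : R).
Hypothesis Hc : rad rho c.
Hypothesis Hrho : 1 < rho.
Hypothesis Heps : 0 < eps.

Let w (s : R) : R := Cmod (cps c (circle_pt 1 s)) + eps.
Let u (s : R) : R := ln (w s).

Lemma factor_w_pos s : eps <= w s.
Proof. unfold w. generalize (Cmod_ge_0 (cps c (circle_pt 1 s))). lra. Qed.

Lemma factor_contR_w : contR w.
Proof.
  apply contR_plus; [ | apply contR_const]. apply contC_Cmod. apply (contC_cps rho); [easy | lra].
Qed.

Lemma factor_contR_u : contR u.
Proof.
  apply (contR_comp ln); [apply factor_contR_w | ]. intros t.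
  apply (ex_derive_continuous (K := R_AbsRing) (V := R_NormedModule) ln).
  exists (/ w t). apply is_derive_ln. generalize (factor_w_pos t). lra.
Qed.

(** The function K = F exp(-H), with H the Herglotz transform of u = log w, is
    analytic in the disc with |K| = |F| exp(-P[u]). On circles of radius close
    to 1 one has |F| <= w and P[u] >= u - e, hence |K| <= exp(e); by the
    maximum principle this holds inside. *)
Lemma outer_majorant z : Cmod z < 1 -> Cmod (cps c z) <= exp (poisson u z).
Proof.
  intros Hz.
  assert (Hc1 : rad 1 c) by (intros r Hr; apply Hc; lra).
  destruct (cps_lip rho c Hc Hrho) as [L [HL0 HL]].
  assert (AH : exists f', holC1 (fun z => (- (1)) * cps (herglotz u) z)%C f') by apply holC1_cps_scal, rad_herglotz, factor_contR_u.
  destruct AH as [h' AH].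
  assert (AK := holC1_mult _ _ _ _ (holC1_cps c Hc1) (holC1_cexp _ _ AH)).
  set (K := fun z => (cps c z * cexp (- (1) * cps (herglotz u) z))%C) in AK.
  destruct (holC1_taylor _ _ AK) as [Rk Ek].
  assert (MK : forall z, Cmod z < 1 -> Cmod (K z) = Cmod (cps c z) * exp (- poisson u z)).
  { intros x Hx. unfold K. rewrite Cmod_mult, Cmod_cexp. f_equal. f_equal.
    rewrite <- herglotz_re by (try easy; apply factor_contR_u).
    set (y := cps (herglotz u) x). unfold Re. simpl. ring. }
  assert (B1 : forall e, 0 < e -> Cmod (K z) <= exp e).
  { intros e He.
    set (Lu := L / eps).
    set (D := Lu * Lu / (4 * (e / 2)) * 2 + 1).
    assert (HD : 0 < D).
    { unfold D. assert (0 <= Lu * Lu / (4 * (e / 2))); [ | lra].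
      apply Rmult_le_pos; [apply Rle_0_sqr | left; apply Rinv_0_lt_compat; lra]. }
    (* The radius exceeds |z|, makes |F| <= w by the Lipschitz bound for F, and P[u] >= u - e
       by the approximation bound with tolerance e / 2. *)
    set (r := Rmax ((1 + Cmod z) / 2) (Rmax (1 - eps / (L + 1)) (1 - e / 2 / D))).
    assert (Hr1 : (1 + Cmod z) / 2 <= r) by apply Rmax_l.
    assert (Hr2 : 1 - eps / (L + 1) <= r) by (eapply Rle_trans; [apply Rmax_l | apply Rmax_r]).
    assert (Hr3 : 1 - e / 2 / D <= r) by (eapply Rle_trans; [apply Rmax_r | apply Rmax_r]).
    assert (Pz := Cmod_ge_0 z).
    assert (Pe : 0 < eps / (L + 1)) by (apply Rdiv_lt_0_compat; lra).
    assert (Pd : 0 < e / 2 / D) by (apply Rdiv_lt_0_compat; lra).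
    assert (Hr : 0 < r < 1).
    { split; [lra | ]. unfold r. repeat apply Rmax_lub_lt; lra. }
    replace z with (RtoC r * (z / RtoC r))%C.
    2: { field. intros E. apply RtoC_inj in E. lra. }
    assert (Hzr : Cmod (z / RtoC r) < 1) by (apply Cmod_div_lt1; lra).
    rewrite Ek.
    2: { rewrite Cmod_mult, Cmod_R, Rabs_pos_eq by lra. generalize (Cmod_ge_0 (z / RtoC r)). nra. }
    apply (cps_maximum 1); [easy | lra | easy | ]. intros s.
    assert (Hm : Cmod (circle_pt r s) < 1) by (rewrite Cmod_circle; lra).
    rewrite <- Ek by easy. rewrite MK by easy.
    assert (A1 : Cmod (cps c (circle_pt r s)) <= w s).
    { unfold w. replace (cps c (circle_pt r s)) with
        (cps c (circle_pt 1 s) + (cps c (circle_pt r s) - cps c (circle_pt 1 s)))%C by ring.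
      eapply Rle_trans; [apply Cmod_triangle | ]. apply Rplus_le_compat_l.
      eapply Rle_trans; [apply HL; rewrite Cmod_circle; lra | ].
      replace (circle_pt r s - circle_pt 1 s)%C with (RtoC (r - 1) * expi s)%C.
      2: { rewrite !circle_pt_expi, RtoC_minus. ring. }
      rewrite Cmod_mult, Cmod_R, Cmod_expi, Rabs_left1 by lra.
      apply Rle_trans with ((L + 1) * (eps / (L + 1))); [nra | right; field; lra]. }
    assert (A2 : u s - e <= poisson u (circle_pt r s)).
    { assert (E2 : 0 < e / 2) by lra.
      assert (Q := poisson_approx u Lu r s (e / 2) factor_contR_u ltac:(lra) E2).
      apply Rabs_le_between in Q.
      - assert (Lu * Lu / (4 * (e / 2)) * (2 - 2 * r) <= e / 2); [ | lra].
        apply Rle_trans with (D * (1 - r)).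
        + unfold D. nra.
        + apply Rle_trans with (D * (e / 2 / D)); [ | right; field; lra].
          apply Rmult_le_compat_l; lra.
      - intros x. unfold u.
        eapply Rle_trans; [apply (ln_lip _ _ eps Heps); apply factor_w_pos | ].
        unfold Lu, Rdiv. rewrite Rmult_assoc, (Rmult_comm (/ eps)), <- Rmult_assoc.
        apply Rmult_le_compat_r; [left; now apply Rinv_0_lt_compat | ].
        unfold w. replace (Cmod (cps c (circle_pt 1 x)) + eps - (Cmod (cps c (circle_pt 1 s)) + eps))
          with (Cmod (cps c (circle_pt 1 x)) - Cmod (cps c (circle_pt 1 s))) by ring.
        apply Rle_trans with (Cmod (cps c (circle_pt 1 x) - cps c (circle_pt 1 s))).
        + assert (T : forall a b, Cmod a - Cmod b <= Cmod (a - b)).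
          { intros a b. assert (Cmod a <= Cmod (a - b) + Cmod b); [ | lra].
            replace a with ((a - b) + b)%C at 1 by ring. apply Cmod_triangle. }
          apply Rabs_le. split; [ | apply T].
          generalize (T (cps c (circle_pt 1 s)) (cps c (circle_pt 1 x))).
          rewrite <- (Cmod_opp (_ - _)).
          replace (- (cps c (circle_pt 1 s) - cps c (circle_pt 1 x)))%C
            with (cps c (circle_pt 1 x) - cps c (circle_pt 1 s))%C by ring. lra.
        + eapply Rle_trans; [apply HL; rewrite Cmod_circle; lra | ].
          right. f_equal. f_equal. rewrite !circle_pt_expi. ring. }
    assert (W0 := factor_w_pos s).
    apply Rle_trans with (w s * exp (e - u s)).
    - apply Rmult_le_compat; [apply Cmod_ge_0 | left; apply exp_pos | easy | ].
      apply exp_mono. lra.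
    - unfold Rminus. rewrite exp_plus, exp_Ropp. unfold u. rewrite exp_ln by lra.
      right. field. lra. }
  assert (B2 : Cmod (K z) <= 1).
  { apply Rnot_lt_le. intros Hgt.
    assert (He : 0 < ln (Cmod (K z))) by (rewrite <- ln_1; apply ln_increasing; lra).
    assert (Q := B1 (ln (Cmod (K z)) / 2) ltac:(lra)).
    rewrite <- (exp_ln (Cmod (K z))) in Q at 1 by lra.
    assert (Q2 : exp (ln (Cmod (K z)) / 2) < exp (ln (Cmod (K z)))) by (apply exp_increasing; lra).
    lra. }
  rewrite MK in B2 by easy.
  apply Rmult_le_reg_r with (exp (- poisson u z)); [apply exp_pos | ].
  rewrite <- exp_plus, Rplus_opp_r, exp_0. easy.
Qed.

Lemma exp_half x : exp (/ 2 * x) * exp (/ 2 * x) = exp x.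
Proof. rewrite <- exp_plus. f_equal. field. Qed.

(** F = exp(H/2) (F exp(-H/2)). By [outer_majorant] both factors have squared
    modulus at most exp(P[u]) <= P[exp u] = P[w], whose mean on every circle is
    the mean of w; Bessel's inequality turns this into a bound for the
    coefficients. *)
Lemma l1_factorisation : exists g k, rad 1 g /\ rad 1 k /\
  (forall z, Cmod z < 1 -> cps c z = (cps g z * cps k z)%C) /\
  forall N, rsum (fun j => Cmod (g j) * Cmod (g j)) N <= avg w /\
            rsum (fun j => Cmod (k j) * Cmod (k j)) N <= avg w.
Proof.
  assert (Hc1 : rad 1 c) by (intros r Hr; apply Hc; lra).
  destruct (holC1_cps_scal (RtoC (/ 2)) (herglotz u) (rad_herglotz u factor_contR_u)) as [h1 A1].
  destruct (holC1_cps_scal (RtoC (- / 2)) (herglotz u) (rad_herglotz u factor_contR_u)) as [h2 A2].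
  assert (AG := holC1_cexp _ _ A1).
  assert (AK := holC1_mult _ _ _ _ (holC1_cps c Hc1) (holC1_cexp _ _ A2)).
  set (G := fun z => cexp (RtoC (/ 2) * cps (herglotz u) z)) in AG.
  set (K := fun z => (cps c z * cexp (RtoC (- / 2) * cps (herglotz u) z))%C) in AK.
  destruct (holC1_taylor _ _ AG) as [Rg Eg]. destruct (holC1_taylor _ _ AK) as [Rk Ek].
  assert (SG : forall z, Cmod z < 1 -> Cmod (G z) * Cmod (G z) <= exp (poisson u z)).
  { intros z Hz. unfold G. rewrite Cmod_cexp, Re_RtoC_mult, herglotz_re by (try easy; apply factor_contR_u).
    rewrite exp_half. lra. }
  assert (SK : forall z, Cmod z < 1 -> Cmod (K z) * Cmod (K z) <= exp (poisson u z)).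
  { intros z Hz. unfold K. rewrite Cmod_mult, Cmod_cexp, Re_RtoC_mult, herglotz_re by (try easy; apply factor_contR_u).
    assert (Q := outer_majorant z Hz). assert (P := Cmod_ge_0 (cps c z)).
    replace (- / 2 * poisson u z) with (/ 2 * (- poisson u z)) by ring.
    set (p := poisson u z) in *.
    replace (Cmod (cps c z) * exp (/ 2 * - p) * (Cmod (cps c z) * exp (/ 2 * - p))) with
      (Cmod (cps c z) * Cmod (cps c z) * (exp (/ 2 * - p) * exp (/ 2 * - p))) by ring.
    rewrite exp_half.
    apply Rle_trans with (exp p * exp p * exp (- p)).
    - apply Rmult_le_compat_r; [left; apply exp_pos | ]. now apply Rmult_le_compat.
    - rewrite Rmult_assoc, <- exp_plus, Rplus_opp_r, exp_0. lra. }
  exists (taylor_coef G), (taylor_coef K). split; [easy | ]. split; [easy | ]. split.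
  { intros z Hz. rewrite <- Eg, <- Ek by easy. unfold G, K.
    transitivity (cps c z * (cexp (RtoC (/ 2) * cps (herglotz u) z) * cexp (RtoC (- / 2) * cps (herglotz u) z)))%C; [ | ring].
    rewrite <- cexp_plus.
    replace (RtoC (/ 2) * cps (herglotz u) z + RtoC (- / 2) * cps (herglotz u) z)%C with (RtoC 0).
    - unfold cexp, expi. simpl. rewrite exp_0, cos_0, sin_0.
      apply injective_projections; simpl; ring.
    - rewrite RtoC_opp. ring. }
  assert (Main : forall F f', holC1 F f' ->
    (forall z, Cmod z < 1 -> Cmod (F z) * Cmod (F z) <= exp (poisson u z)) ->
    forall N, rsum (fun j => Cmod (taylor_coef F j) * Cmod (taylor_coef F j)) N <= avg w).
  { intros F f' AF SF N. destruct (holC1_taylor _ _ AF) as [Rf Ef].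
    (* On the circle of radius r the coefficients carry factors r^j >= r^N. *)
    assert (B : forall r, 0 < r < 1 -> r ^ (2 * N) *
       rsum (fun j => Cmod (taylor_coef F j) * Cmod (taylor_coef F j)) N <= avg w).
    { intros r Hr. assert (HF : contC (fun t => F (circle_pt r t))) by (apply (holC1_contC F f'); [easy | lra]).
      eapply Rle_trans; [ | eapply Rle_trans; [apply (bessel _ N HF) | ]].
      - rewrite <- rsum_scal. apply rsum_le. intros j Hj.
        assert (Hh : fourier (fun t => F (circle_pt r t)) j = (taylor_coef F j * RtoC (r ^ j))%C).
        { rewrite <- (Cavg_cps_coef 1) by (try easy; lra). apply Cavg_ext.
          intros t. now rewrite Ef by (rewrite Cmod_circle; lra). }
        rewrite Hh, Cmod_mult, Cmod_R, Rabs_pos_eq by (apply pow_le; lra).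
        replace (Cmod (taylor_coef F j) * r ^ j * (Cmod (taylor_coef F j) * r ^ j))
          with (r ^ (2 * j) * (Cmod (taylor_coef F j) * Cmod (taylor_coef F j))).
        2: { replace (2 * j)%nat with (j + j)%nat by lia. rewrite pow_add. ring. }
        apply Rmult_le_compat_r; [apply Rle_0_sqr | ].
        replace (2 * N)%nat with (2 * j + (2 * N - 2 * j))%nat by lia. rewrite pow_add.
        rewrite <- (Rmult_1_r (r ^ (2 * j))) at 2. apply Rmult_le_compat_l; [apply pow_le; lra | ].
        rewrite <- (pow1 (2 * N - 2 * j)). apply pow_incr; lra.
      - rewrite (avg_ext w (fun s => exp (u s))).
        2: { intros s. unfold u. rewrite exp_ln; [easy | ]. generalize (factor_w_pos s). lra. }
        rewrite <- (poisson_mean (fun s => exp (u s)) r) by (try lra; apply contR_exp, factor_contR_u).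
        apply avg_le.
        + apply contR_mult; now apply contC_Cmod.
        + apply contR_poisson; [apply contR_exp, factor_contR_u | lra].
        + intros t. assert (Hm : Cmod (circle_pt r t) < 1) by (rewrite Cmod_circle; lra).
          eapply Rle_trans; [now apply SF | ]. apply poisson_jensen_exp; [apply factor_contR_u | easy]. }
    apply (pow_limit_le _ _ (2 * N)); [ | easy].
    apply rsum_ge0; intros; apply Rle_0_sqr. }
  intros N. split; [apply (Main G _ AG SG) | apply (Main K _ AK SK)].
Qed.
End Factor.

Lemma rsum_swap (a : nat -> nat -> R) n m :
  rsum (fun i => rsum (fun j => a i j) m) n = rsum (fun j => rsum (fun i => a i j) n) m.
Proof.
  induction n; simpl.
  - induction m; simpl; [easy | rewrite <- IHm; ring].
  - rewrite IHn, <- rsum_plus. easy.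
Qed.

(** A triangle of indices, summed along its antidiagonals, lies inside a
    square. *)
Lemma rsum_triangle (a b x : nat -> R) N : (forall k, 0 <= a k) -> (forall k, 0 <= b k) -> (forall k, 0 <= x k) ->
  rsum (fun n => rsum (fun j => a j * b (n - j)%nat) (S n) * x n) N <=
  rsum (fun j => rsum (fun l => a j * b l * x (j + l)%nat) N) N.
Proof.
  intros Ha Hb Hx.
  assert (P : forall i j k, 0 <= a i * b j * x k) by (intros; repeat apply Rmult_le_pos; auto).
  apply Rle_trans with (rsum (fun n => rsum (fun j => if le_lt_dec j n then a j * b (n - j)%nat * x n else 0) N) N).
  - apply rsum_le. intros n Hn. rewrite Rmult_comm, <- rsum_scal.
    replace N with (S n + (N - S n))%nat by lia. rewrite rsum_add.
    apply Rle_trans with (rsum (fun j => if le_lt_dec j n then a j * b (n - j)%nat * x n else 0) (S n)).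
    + apply rsum_le. intros j Hj. destruct (le_lt_dec j n); [lra | lia].
    + assert (0 <= rsum (fun k => if le_lt_dec (S n + k) n then a (S n + k)%nat * b (n - (S n + k))%nat * x n else 0) (N - S n)); [ | lra].
      apply rsum_ge0. intros k. destruct (le_lt_dec (S n + k) n); [apply P | lra].
  - rewrite rsum_swap. apply rsum_le. intros j Hj.
    replace N with (j + (N - j))%nat at 1 by lia. rewrite rsum_add.
    rewrite (rsum_ext _ (fun _ => 0 * 0)).
    + rewrite rsum_scal, Rmult_0_l, Rplus_0_l.
      rewrite (rsum_ext _ (fun l => a j * b l * x (j + l)%nat) (N - j)).
      * assert (Q := rsum_incr (fun l => a j * b l * x (j + l)%nat) (N - j) N
          ltac:(intros; apply P) ltac:(lia)). lra.
      * intros l _. destruct (le_lt_dec j (j + l)); [ | lia]. repeat f_equal. lia.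
    + intros k Hk. destruct (le_lt_dec j k); [lia | ring].
Qed.

Lemma cps_split c z n : rad 1 c -> Cmod z < 1 ->
  cps c z = (csum (fun j => c j * z ^ j) n + z ^ n * cps (fun j => c (n + j)%nat) z)%C.
Proof.
  intros Hc Hz. revert c Hc. induction n; intros c Hc.
  - simpl. rewrite Cmult_1_l, Cplus_0_l. now apply cps_ext.
  - rewrite (cps_shift 1) by easy. rewrite (IHn (fun k => c (S k))) by now apply rad_shift.
    rewrite csum_S.
    rewrite (csum_ext (fun k => c (S k) * z ^ S k)%C (fun k => z * (c (S k) * z ^ k))%C)
      by (intros; simpl; ring).
    rewrite csum_scal. simpl. ring.
Qed.

Lemma rad_shiftn c n : rad 1 c -> rad 1 (fun j => c (n + j)%nat).
Proof.
  revert c. induction n; intros c Hc; [easy | ]. exact (IHn (fun k => c (S k)) (rad_shift 1 c Hc)).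
Qed.

(** The n-th Fourier coefficient of g k on a circle is computed after g has been
    split at degree n + 1: the remainder of g times k contributes no frequency
    up to n. *)
Lemma cauchy_product c g k : rad 1 c -> rad 1 g -> rad 1 k ->
  (forall z, Cmod z < 1 -> cps c z = (cps g z * cps k z)%C) ->
  forall n, c n = csum (fun j => g j * k (n - j)%nat)%C (S n).
Proof.
  intros Hc Hg Hk E n.
  set (r := / 2). assert (Hr : 0 <= r < 1) by (unfold r; lra).
  assert (Hr' : forall m, RtoC (r ^ m) <> 0).
  { intros m Z. apply RtoC_inj in Z. assert (0 < r ^ m) by (apply pow_lt; unfold r; lra). lra. }
  assert (Hm : forall t, Cmod (circle_pt r t) < 1) by (intros; rewrite Cmod_circle; lra).
  set (g' := fun j => g (S n + j)%nat). assert (Hg' : rad 1 g') by now apply (rad_shiftn g (S n)).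
  destruct (holC1_taylor _ _ (holC1_mult _ _ _ _ (holC1_cps g' Hg') (holC1_cps k Hk))) as [Rm Em].
  set (m := taylor_coef (fun z => (cps g' z * cps k z)%C)) in *.
  assert (X : (c n * RtoC (r ^ n))%C = (csum (fun j => g j * k (n - j)%nat) (S n) * RtoC (r ^ n))%C).
  { rewrite <- (Cavg_cps_coef 1 c r n) by easy.
    rewrite (Cavg_ext _ (fun t => csum (fun j => (g j * RtoC (r ^ j)) *
       (cps k (circle_pt r t) * Cconj (expi t) ^ (n - j))) (S n)
       + RtoC (r ^ S n) * (cps m (circle_pt r t) * expi t ^ 1))%C).
    - assert (H1 : forall j, contC (fun t => cps k (circle_pt r t) * Cconj (expi t) ^ (n - j))%C).
      { intros j. apply contC_mult; [now apply (contC_cps 1) | apply contC_pow, contC_conj, contC_expi]. }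
      assert (H2 : contC (fun t => cps m (circle_pt r t) * expi t ^ 1)%C).
      { apply contC_mult; [now apply (contC_cps 1) | apply contC_pow, contC_expi]. }
      assert (H3 : forall j, contC (fun t => (g j * RtoC (r ^ j)) *
         (cps k (circle_pt r t) * Cconj (expi t) ^ (n - j)))%C).
      { intros j. apply contC_mult; [apply contC_const | apply H1]. }
      rewrite Cavg_plus.
      + rewrite Cavg_scal by easy. rewrite (Cavg_cps_neg 1) by easy.
        rewrite (Cavg_csum (fun j t => (g j * RtoC (r ^ j)) *
         (cps k (circle_pt r t) * Cconj (expi t) ^ (n - j)))%C) by easy.
        rewrite Cmult_0_r, Cplus_0_r, (Cmult_comm _ (RtoC (r ^ n))), <- csum_scal.
        apply csum_ext. intros j Hj. rewrite Cavg_scal by easy.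
        rewrite (Cavg_cps_coef 1) by easy.
        replace (r ^ n) with (r ^ j * r ^ (n - j)) by (rewrite <- pow_add; f_equal; lia).
        rewrite RtoC_mult. ring.
      + apply (contC_csum (fun j t => (g j * RtoC (r ^ j)) *
         (cps k (circle_pt r t) * Cconj (expi t) ^ (n - j)))%C). easy.
      + apply contC_mult; [apply contC_const | easy].
    - intros t. rewrite E by easy. rewrite (cps_split g _ (S n)) by easy. fold g'.
      rewrite <- Em by easy. rewrite circle_pow.
      transitivity ((csum (fun j => (cps k (circle_pt r t) * Cconj (expi t) ^ n) * (g j * circle_pt r t ^ j)) (S n))
         + (RtoC (r ^ S n)) * (cps g' (circle_pt r t) * cps k (circle_pt r t) *
           (expi t ^ (S n) * Cconj (expi t) ^ n)))%C.
      + rewrite csum_scal. ring.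
      + f_equal.
        * apply csum_ext. intros j Hj. rewrite circle_pow.
          assert (Q := proj2 (expi_conj_pow t (n - j) j)).
          replace (n - j + j)%nat with n in Q by lia. rewrite <- Q. ring.
        * assert (Q := proj1 (expi_conj_pow t 1 n)). change (1 + n)%nat with (S n) in Q. rewrite Q. ring. }
  replace (c n) with ((c n * RtoC (r ^ n)) / RtoC (r ^ n))%C by (field; apply Hr').
  rewrite X. field. apply Hr'.
Qed.

(** With F = G K as in [l1_factorisation], |c_n| is at most the convolution of the
    moduli of the coefficients of G and K, and the weights 1/(n+1) turn the
    convolution into the bilinear form of Hilbert's inequality. *)
Lemma hardy_closed c rho N : rad rho c -> 1 < rho ->
  rsum (fun k => Cmod (c k) / INR (S k)) N <= PI * avg (fun s => Cmod (cps c (circle_pt 1 s))).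
Proof.
  intros Hc Hr. assert (Hc1 : rad 1 c) by (intros r Hr'; apply Hc; lra).
  assert (PP := PI_RGT_0). apply le_all_eps. intros e He.
  assert (He' : 0 < e / PI) by now apply Rdiv_lt_0_compat.
  destruct (l1_factorisation c rho (e / PI) Hc Hr He') as [g [k [Hg [Hk [E B]]]]].
  destruct (B N) as [B1 B2].
  rewrite avg_plus, avg_const in B1, B2; try apply contR_const;
    try (apply contC_Cmod, (contC_cps rho); [easy | lra]).
  set (A := avg _) in *.
  apply Rle_trans with (rsum (fun n => rsum (fun j => Cmod (g j) * Cmod (k (n - j)%nat)) (S n) * / INR (S n)) N).
  - apply rsum_le. intros n Hn. apply Rmult_le_compat_r.
    + left. apply Rinv_0_lt_compat, (lt_0_INR (S n)). lia.
    + rewrite (cauchy_product c g k Hc1 Hg Hk E n).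
      eapply Rle_trans; [apply Cmod_csum | ]. right. apply rsum_ext. intros; apply Cmod_mult.
  - eapply Rle_trans; [apply (rsum_triangle (fun j => Cmod (g j)) (fun j => Cmod (k j)) (fun n => / INR (S n))) | ].
    + intros; apply Cmod_ge_0.
    + intros; apply Cmod_ge_0.
    + intros n. left. apply Rinv_0_lt_compat, (lt_0_INR (S n)). lia.
    + eapply Rle_trans; [apply (hilbert_inequality (fun j => Cmod (g j)) (fun j => Cmod (k j)) N _ _ B1 B2) | ].
      right. field. lra.
Qed.

(** Hardy's inequality in H^1, by dilation from [hardy_closed]. *)
Lemma hardy_inequality c M : rad 1 c ->
  (forall r, 0 < r < 1 -> avg (fun s => Cmod (cps c (circle_pt r s))) <= M) ->
  forall N, rsum (fun k => Cmod (c k) / INR (S k)) N <= PI * M.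
Proof.
  intros Hc HM N. assert (PP := PI_RGT_0).
  assert (B : forall r, 0 < r < 1 -> rsum (fun k => Cmod (c k) * r ^ k / INR (S k)) N <= PI * M).
  { intros r Hr. set (d := (fun n => c n * RtoC (r ^ n))%C).
    assert (Hd : rad (/ r) d).
    { intros x Hx. destruct (Hc (r * x)) as [K HK].
      - split; [nra | ]. apply Rmult_lt_reg_l with (/ r); [apply Rinv_0_lt_compat; lra | ].
        rewrite <- Rmult_assoc, Rinv_l by lra. lra.
      - exists K. intros n. unfold d. rewrite Cmod_mult, Cmod_R, Rabs_pos_eq by (apply pow_le; lra).
        rewrite Rmult_assoc, <- Rpow_mult_distr. apply HK. }
    assert (Q : 1 < / r) by (rewrite <- Rinv_1; apply Rinv_lt_contravar; lra).
    assert (H := hardy_closed d (/ r) N Hd Q).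
    rewrite (rsum_ext _ (fun k => Cmod (d k) / INR (S k))).
    - eapply Rle_trans; [apply H | ]. apply Rmult_le_compat_l; [lra | ].
      eapply Rle_trans; [ | apply (HM r Hr)]. right. apply avg_ext. intros s. unfold d.
      rewrite cps_dilate. do 2 f_equal. rewrite !circle_pt_expi. ring.
    - intros k _. unfold d. rewrite Cmod_mult, Cmod_R, Rabs_pos_eq by (apply pow_le; lra). easy. }
  set (X := rsum _ N).
  assert (X0 : 0 <= X).
  { apply rsum_ge0. intros k. apply Rmult_le_pos; [apply Cmod_ge_0 | ].
    left. apply Rinv_0_lt_compat, (lt_0_INR (S k)). lia. }
  assert (B' : forall r, 0 < r < 1 -> r ^ N * X <= PI * M).
  { intros r Hr. eapply Rle_trans; [ | apply (B r Hr)]. unfold X. rewrite <- rsum_scal.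
    apply rsum_le. intros k Hk. unfold Rdiv. rewrite <- Rmult_assoc.
    apply Rmult_le_compat_r; [left; apply Rinv_0_lt_compat, (lt_0_INR (S k)); lia | ].
    rewrite Rmult_comm. apply Rmult_le_compat_l; [apply Cmod_ge_0 | ].
    replace N with (k + (N - k))%nat by lia. rewrite pow_add.
    rewrite <- (Rmult_1_r (r ^ k)) at 2. apply Rmult_le_compat_l; [apply pow_le; lra | ].
    rewrite <- (pow1 (N - k)). apply pow_incr; lra. }
  now apply (pow_limit_le X (PI * M) N).
Qed.

(** * Powers of functions with positive real part *)

(** Principal branch of the logarithm on the right half plane. *)
Definition clog (w : C) : C := (/ 2 * ln (Re w * Re w + Im w * Im w), atan (Im w / Re w)).

Lemma cderiv_clog w : 0 < Re w -> cderiv clog w (/ w).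
Proof.
  destruct w as [x y]. unfold Re at 1. simpl fst. intros Hx.
  assert (D : forall u v, 0 < u -> 0 < u * u + v * v) by (intros; nra).
  assert (CD : continuity_2d_pt (fun u v => u * u + v * v) x y).
  { apply continuity_2d_pt_plus; apply continuity_2d_pt_mult;
    first [apply continuity_2d_pt_id1 | apply continuity_2d_pt_id2]. }
  assert (CI : continuity_2d_pt (fun u v => / (u * u + v * v)) x y).
  { apply continuity_2d_pt_inv; [easy | ]. generalize (D x y Hx). lra. }
  replace (/ (x, y))%C with ((x / (x * x + y * y), - y / (x * x + y * y)) : C).
  2: { unfold Cinv. apply injective_projections; simpl; field; generalize (D x y Hx); lra. }
  apply cderiv_CR.
  - replace (- (- y / (x * x + y * y))) with (y / (x * x + y * y)) by (field; generalize (D x y Hx); lra).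
    apply (differentiable_C1 _ (fun u v => u / (u * u + v * v)) x y).
    + exists x. split; [easy | ]. intros u v Hu _. apply Rabs_def2 in Hu.
      assert (Du := D u v ltac:(lra)).
      apply (is_derive_ext (fun z => / 2 * ln (z * z + v * v))); [easy | ].
      auto_derive; [easy | field; lra].
    + assert (Du := D x y Hx).
      apply (is_derive_ext (fun z => / 2 * ln (x * x + z * z))); [easy | ].
      auto_derive; [easy | field; lra].
    + apply continuity_2d_pt_mult; [apply continuity_2d_pt_id1 | easy].
  - apply (differentiable_C1 _ (fun u v => - v / (u * u + v * v)) x y).
    + exists x. split; [easy | ]. intros u v Hu _. apply Rabs_def2 in Hu.
      assert (Du := D u v ltac:(lra)).
      apply (is_derive_ext (fun z => atan (v / z))); [easy | ].
      auto_derive; [lra | ]. field. split; [lra | ]. nra.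
    + assert (Du := D x y Hx).
      apply (is_derive_ext (fun z => atan (z / x))); [easy | ].
      auto_derive; [lra | ]. field. split; [lra | ]. nra.
    + apply continuity_2d_pt_mult; [ | easy].
      apply continuity_2d_pt_opp, continuity_2d_pt_id2.
Qed.

Lemma ccont_inv (w : C) : (w <> 0)%C -> ccont Cinv w.
Proof.
  intros Hw e He. assert (P := proj1 (Cmod_gt_0 w) Hw). set (m := Cmod w) in *.
  exists (Rmin (m / 2) (e * (m * m) / 2)). split.
  - apply Rmin_glb_lt; [lra | ]. assert (0 < e * (m * m)) by (apply Rmult_lt_0_compat; nra). lra.
  - intros v Hv. assert (H1 := Rlt_le_trans _ _ _ Hv (Rmin_l _ _)).
    assert (H2 := Rlt_le_trans _ _ _ Hv (Rmin_r _ _)).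
    assert (Hmv : m / 2 < Cmod v).
    { assert (m <= Cmod v + Cmod (v - w)); [ | lra]. unfold m.
      replace w with (v - (v - w))%C at 1 by ring.
      eapply Rle_trans; [apply Cmod_triangle | ]. rewrite Cmod_opp. lra. }
    assert (Hv0 : (v <> 0)%C) by (intros ->; rewrite Cmod_0 in Hmv; lra).
    replace (/ v - / w)%C with (- ((v - w) / (v * w)))%C by (field; easy).
    rewrite Cmod_opp, Cmod_div, Cmod_mult by (apply Cmult_neq_0; easy). fold m.
    apply Rmult_lt_reg_r with (Cmod v * m); [nra | ].
    unfold Rdiv. rewrite Rmult_assoc, Rinv_l by nra. rewrite Rmult_1_r.
    apply Rlt_trans with (e * (m * m) / 2); [easy | ].
    apply Rle_lt_trans with (e * (m / 2 * m)); [right; field | ].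
    apply Rmult_lt_compat_l; [easy | ]. apply Rmult_lt_compat_r; easy.
Qed.

Definition cpow (q : R) (w : C) : C := cexp (RtoC q * clog w).

Lemma holC1_cpow q F F' : holC1 F F' -> (forall z, Cmod z < 1 -> 0 < Re (F z)) ->
  exists G', holC1 (fun z => cpow q (F z)) G'.
Proof.
  intros HF Hp.
  assert (H1 : holC1 (fun z => clog (F z)) (fun z => / (F z) * F' z)%C).
  { apply (holC1_comp clog Cinv); [easy | ]. intros z Hz. split; [now apply cderiv_clog, Hp | ].
    apply ccont_inv. intros E. specialize (Hp z Hz). rewrite E in Hp. simpl in Hp. lra. }
  assert (H2 := holC1_mult (fun _ => RtoC q) (fun _ => RtoC 0) _ _
    ltac:(intros z _; split; [apply cderiv_const | apply ccont_const]) H1).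
  eexists. exact (holC1_cexp _ _ H2).
Qed.

Lemma Re_clog w : 0 < Re w -> Re (clog w) = ln (Cmod w).
Proof.
  intros Hw. unfold clog. simpl.
  assert (P : 0 < Cmod w).
  { eapply Rlt_le_trans; [apply Hw | ]. eapply Rle_trans; [apply Rle_abs | apply Re_le_Cmod]. }
  assert (E := Cmod2_alt w). simpl in E. rewrite !Rmult_1_r in E. rewrite <- E.
  rewrite ln_mult by easy. field.
Qed.

Lemma Re_cpow q w : 0 < Re w -> Re (cpow q w) = rpow (Cmod w) q * cos (q * atan (Im w / Re w)).
Proof.
  intros Hw. unfold cpow, cexp. rewrite Re_RtoC_mult, Re_RtoC_mult, Re_clog by easy.
  assert (P : 0 < Cmod w).
  { eapply Rlt_le_trans; [apply Hw | ]. eapply Rle_trans; [apply Rle_abs | apply Re_le_Cmod]. }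
  rewrite rpow_pos by easy. unfold Rpower. f_equal.
  unfold expi, Re at 1. simpl. f_equal. unfold clog. simpl. ring.
Qed.

Lemma polar_Re w : 0 < Re w -> Re w = Cmod w * cos (atan (Im w / Re w)).
Proof.
  destruct w as [x y]. unfold Re, Im. simpl. intros Hx. rewrite cos_atan.
  assert (E : Cmod (x, y) = x * sqrt (1 + Rsqr (y / x))).
  { transitivity (sqrt (Rsqr x * (1 + Rsqr (y / x)))).
    - unfold Cmod. f_equal. simpl. unfold Rsqr. field. lra.
    - rewrite sqrt_mult, sqrt_Rsqr; try lra; [apply Rle_0_sqr | ].
      generalize (Rle_0_sqr (y / x)). lra. }
  rewrite E. field. intros Z. assert (0 < sqrt (1 + Rsqr (y / x))); [ | lra].
  apply sqrt_lt_R0. generalize (Rle_0_sqr (y / x)). lra.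
Qed.

(** Let phi0 be the midpoint of pi/(2q) and pi/2. For phi between phi0 and pi/2 the
    angle q phi lies between q phi0 > pi/2 and pi, because 1 < q <= 2; there
    -B cos(q phi) alone is at least 1. Below phi0, cos(phi)^q is bounded away
    from 0. *)
Lemma angle_inequality q : 1 < q <= 2 -> exists A B, 0 <= A /\ 0 <= B /\
  forall phi, - PI / 2 < phi < PI / 2 -> 1 <= A * rpow (cos phi) q - B * cos (q * phi).
Proof.
  intros Hq. assert (PP := PI_RGT_0).
  set (phi0 := (PI / 2 / q + PI / 2) / 2).
  assert (Iq : 0 < / q < 1).
  { split; [apply Rinv_0_lt_compat; lra | ]. rewrite <- Rinv_1. apply Rinv_lt_contravar; lra. }
  assert (Hphi0 : 0 < phi0 < PI / 2).
  { unfold phi0. unfold Rdiv at 2 4. split; nra. }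
  assert (Hq0 : PI / 2 < q * phi0).
  { unfold phi0. replace (q * ((PI / 2 / q + PI / 2) / 2)) with ((PI / 2 + q * (PI / 2)) / 2) by (field; lra). nra. }
  assert (Hq1 : q * phi0 < PI) by nra.
  assert (C0 : cos (q * phi0) < 0) by (apply cos_lt_0; lra).
  assert (C1 : 0 < cos phi0) by (apply cos_gt_0; lra).
  set (B := / (- cos (q * phi0))). assert (HB : 0 < B) by (apply Rinv_0_lt_compat; lra).
  assert (Pp := rpow_gt0 (cos phi0) q C1).
  set (A := (1 + B) / rpow (cos phi0) q).
  assert (HA : 0 < A) by (apply Rdiv_lt_0_compat; lra).
  exists A, B. split; [lra | ]. split; [lra | ].
  assert (K : forall phi, 0 <= phi < PI / 2 -> 1 <= A * rpow (cos phi) q - B * cos (q * phi)).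
  { intros phi Hphi. destruct (Rle_dec phi0 phi) as [H | H].
    - assert (cos (q * phi) <= cos (q * phi0)).
      { apply cos_decr_1; try nra. }
      assert (0 <= A * rpow (cos phi) q) by (apply Rmult_le_pos; [lra | apply rpow_ge0]).
      assert (B * - cos (q * phi) >= B * - cos (q * phi0)).
      { apply Rle_ge. apply Rmult_le_compat_l; lra. }
      assert (B * - cos (q * phi0) = 1) by (unfold B; field; lra). lra.
    - assert (cos phi0 <= cos phi) by (apply cos_decr_1; lra).
      assert (rpow (cos phi0) q <= rpow (cos phi) q) by (apply rpow_le; lra).
      assert (A * rpow (cos phi0) q <= A * rpow (cos phi) q) by (apply Rmult_le_compat_l; lra).
      assert (A * rpow (cos phi0) q = 1 + B) by (unfold A; field; lra).
      assert (B * cos (q * phi) <= B * 1) by (apply Rmult_le_compat_l; [lra | apply COS_bound]).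
      lra. }
  intros phi Hphi. destruct (Rle_dec 0 phi).
  - apply K. lra.
  - rewrite <- (cos_neg phi), <- (cos_neg (q * phi)).
    replace (- (q * phi)) with (q * - phi) by ring. apply K. lra.
Qed.

Lemma cpow_inequality q : 1 < q <= 2 -> exists A B, 0 <= A /\ 0 <= B /\
  forall w, 0 < Re w -> rpow (Cmod w) q <= A * rpow (Re w) q - B * Re (cpow q w).
Proof.
  intros Hq. destruct (angle_inequality q Hq) as [A [B [HA [HB H]]]].
  exists A, B. split; [easy | ]. split; [easy | ]. intros w Hw.
  rewrite Re_cpow by easy. rewrite (polar_Re w Hw) at 1. set (phi := atan (Im w / Re w)).
  assert (Hphi : - PI / 2 < phi < PI / 2) by apply atan_bound.
  assert (Hc : 0 <= cos phi) by (left; apply cos_gt_0; lra).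
  rewrite rpow_mult_distr by (try easy; apply Cmod_ge_0).
  specialize (H phi Hphi). assert (P := rpow_ge0 (Cmod w) q). nra.
Qed.

Lemma herglotz_pos_re u z : contR u -> (forall s, 0 < u s) -> Cmod z < 1 -> 0 < Re (cps (herglotz u) z).
Proof. intros Hu Hp Hz. rewrite herglotz_re by easy. now apply poisson_pos. Qed.

Lemma herglotz_0 u : herglotz u 0 = RtoC (avg u).
Proof. change (herglotz u 0) with (fourier (fun s => RtoC (u s)) 0). now rewrite fourier_0, Cavg_RtoC. Qed.

(** Average [cpow_inequality] at w = F(r e^{it}), where F is the Herglotz transform of u.
    The mean of F^q is F(0)^q = avg(u)^q, whose contribution has the good sign,
    and Re F is the Poisson integral of u. *)
Lemma riesz_positive q : 1 < q <= 2 -> exists A, 0 <= A /\ forall u r, contR u -> (forall s, 0 < u s) ->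
  0 <= r < 1 -> cmean q (herglotz u) r <= A * avg (fun t => rpow (u t) q).
Proof.
  intros Hq. destruct (cpow_inequality q Hq) as [A [B [HA [HB H]]]].
  exists A. split; [easy | ]. intros u r Hu Hp Hr.
  set (F := cps (herglotz u)). assert (HR := rad_herglotz u Hu).
  assert (Fp : forall z, Cmod z < 1 -> 0 < Re (F z)) by (intros; now apply herglotz_pos_re).
  destruct (holC1_cpow q F _ (holC1_cps _ HR) Fp) as [G' HG].
  assert (Hm : forall t, Cmod (circle_pt r t) < 1) by (intros; rewrite Cmod_circle; lra).
  assert (E := holC1_mean _ _ r HG Hr).
  assert (E' : 0 <= avg (fun t => Re (cpow q (F (circle_pt r t))))).
  { replace (avg _) with (Re (cpow q (F 0))) by now rewrite <- E.
    rewrite Re_cpow by (apply Fp; rewrite Cmod_0; lra).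
    unfold F. rewrite cps_0, herglotz_0. unfold Im, RtoC at 2. simpl snd. unfold Rdiv.
    rewrite Rmult_0_l, atan_0, Rmult_0_r, cos_0, Rmult_1_r. apply rpow_ge0. }
  assert (Rp : contR (fun t => poisson u (circle_pt r t))) by now apply contR_poisson.
  assert (Rpq : contR (fun t => rpow (poisson u (circle_pt r t)) q)).
  { apply contR_rpow; [easy | | lra]. intros t. left. now apply poisson_pos. }
  assert (RG : contR (fun t => Re (cpow q (F (circle_pt r t))))).
  { apply (holC1_contC _ _ r HG Hr). }
  unfold cmean.
  apply Rle_trans with (avg (fun t => A * rpow (poisson u (circle_pt r t)) q +
     (- B) * Re (cpow q (F (circle_pt r t))))).
  - apply avg_le; [apply (contR_cmean 1); [easy | easy | lra] | | ].
    + apply contR_plus; apply contR_mult; try easy; apply contR_const.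
    + intros t. rewrite <- herglotz_re by easy. fold F.
      generalize (H (F (circle_pt r t)) (Fp _ (Hm t))). lra.
  - rewrite avg_plus, !avg_scal by (try easy; apply contR_mult; try easy; apply contR_const).
    assert (Q : avg (fun t => rpow (poisson u (circle_pt r t)) q) <= avg (fun t => rpow (u t) q)).
    { apply poisson_mean_pow; try easy; [ | lra]. intros s. now left. }
    assert (P := Rmult_le_pos _ _ HB E').
    apply Rle_trans with (A * avg (fun t => rpow (poisson u (circle_pt r t)) q)); [lra | ].
    now apply Rmult_le_compat_l.
Qed.

(** * The Riesz projection *)

(** The function with coefficients c lies in H^q, and the q-th power of its norm
    is at most X. *)
Definition mean_bdd (q : R) (c : nat -> C) (X : R) : Prop :=
  rad 1 c /\ forall r, 0 <= r < 1 -> cmean q c r <= X.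

Lemma mean_bdd_scal q k c X : 0 < q -> mean_bdd q c X -> mean_bdd q (fun n => k * c n)%C (rpow (Cmod k) q * X).
Proof.
  intros Hq [Hc H]. split; [now apply rad_scal | ]. intros r Hr.
  assert (E : cmean q (fun n => k * c n)%C r = rpow (Cmod k) q * cmean q c r).
  { unfold cmean. rewrite <- avg_scal by now apply (contR_cmean 1).
    apply avg_ext. intros t. rewrite (cps_scal 1) by (try easy; rewrite Cmod_circle; lra).
    rewrite Cmod_mult. apply rpow_mult_distr; apply Cmod_ge_0. }
  rewrite E. apply Rmult_le_compat_l; [apply rpow_ge0 | now apply H].
Qed.

Lemma rpow_Cmod_plus z w q : 0 < q ->
  rpow (Cmod (z + w)) q <= rpow 2 q * (rpow (Cmod z) q + rpow (Cmod w) q).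
Proof.
  intros Hq. eapply Rle_trans; [ | apply rpow_two_max; try easy; apply Cmod_ge_0].
  apply rpow_le; [apply Cmod_ge_0 | apply Cmod_triangle | easy].
Qed.

Lemma mean_bdd_plus q c d X Y : 0 < q -> mean_bdd q c X -> mean_bdd q d Y ->
  mean_bdd q (fun n => c n + d n)%C (rpow 2 q * (X + Y)).
Proof.
  intros Hq [Hc HX] [Hd HY]. split; [now apply rad_plus | ]. intros r Hr.
  assert (Hc' := contR_cmean 1 q c r Hc Hr Hq). assert (Hd' := contR_cmean 1 q d r Hd Hr Hq).
  apply Rle_trans with (rpow 2 q * (cmean q c r + cmean q d r)).
  - unfold cmean. rewrite <- avg_plus, <- avg_scal by (try easy; now apply contR_plus).
    apply avg_le.
    + apply (contR_cmean 1); [now apply rad_plus | easy | easy].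
    + apply contR_mult; [apply contR_const | now apply contR_plus].
    + intros t. rewrite (cps_plus 1) by (try easy; rewrite Cmod_circle; lra).
      now apply rpow_Cmod_plus.
  - apply Rmult_le_compat_l; [apply rpow_ge0 | ]. specialize (HX r Hr). specialize (HY r Hr). lra.
Qed.

Lemma mean_bdd_le q c X Y : mean_bdd q c X -> X <= Y -> mean_bdd q c Y.
Proof. intros [H1 H2] H. split; [easy | ]. intros r Hr. specialize (H2 r Hr). lra. Qed.

Lemma cmean_ext q c d r : (forall n, c n = d n) -> cmean q c r = cmean q d r.
Proof. intros H. apply avg_ext. intros t. now rewrite (cps_ext c d). Qed.

Lemma mean_bdd_ext q c d X : (forall n, c n = d n) -> mean_bdd q c X -> mean_bdd q d X.
Proof.
  intros E [H1 H2]. split.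
  - apply (rad_le 1 c); [easy | ]. intros n. rewrite E. lra.
  - intros r Hr. rewrite <- (cmean_ext q c d r E). now apply H2.
Qed.

Definition delta0 (k : C) (n : nat) : C := match n with O => k | _ => 0 end.

Lemma cps_delta0 k z : cps (delta0 k) z = k.
Proof. rewrite (cps_poly _ 1) by (intros [ | n] Hn; [lia | easy]). simpl. ring. Qed.

(** The projection of u on the nonnegative frequencies is half the sum of its
    Herglotz transform and of the constant avg(u), which is the value of this
    transform at 0. *)
Lemma mean_bdd_fourier_pos q A u : 1 < q -> contR u -> (forall r, 0 <= r < 1 -> cmean q (herglotz u) r <= A) ->
  mean_bdd q (fourier (fun s => RtoC (u s))) (2 * A).
Proof.
  intros Hq Hu H.
  assert (M1 : mean_bdd q (herglotz u) A) by (split; [now apply rad_herglotz | easy]).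
  assert (M2 : mean_bdd q (delta0 (herglotz u 0)) A).
  { split.
    - apply (rad_poly _ 1). intros [ | n] Hn; [lia | easy].
    - intros r Hr. eapply Rle_trans; [ | apply (H 0); lra]. right. apply avg_ext. intros t.
      rewrite cps_delta0. rewrite circle_pt_expi. replace (0 * expi t)%C with (RtoC 0) by ring.
      now rewrite cps_0. }
  assert (Q : 0 < q) by lra.
  assert (M := mean_bdd_plus q _ _ _ _ Q (mean_bdd_scal q (RtoC (/ 2)) _ _ Q M1) (mean_bdd_scal q (RtoC (/ 2)) _ _ Q M2)).
  eapply mean_bdd_ext; [ | eapply mean_bdd_le; [exact M | ]].
  - intros [ | n]; unfold herglotz, delta0.
    + rewrite RtoC_inv by lra. field.
    + rewrite RtoC_inv by lra. field.
  - rewrite Cmod_R, Rabs_pos_eq by lra. right.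
    transitivity (rpow 2 q * rpow (/ 2) q * (A + A)); [ring | ].
    rewrite <- rpow_mult_distr by lra. replace (2 * / 2) with 1 by field. rewrite rpow_one. ring.
Qed.

Lemma fourier_plus v w n : contC v -> contC w -> fourier (fun s => v s + w s)%C n = (fourier v n + fourier w n)%C.
Proof.
  intros Hv Hw. unfold fourier.
  assert (E : contC (fun s => Cconj (expi s) ^ n)%C) by apply contC_pow, contC_conj, contC_expi.
  rewrite <- Cavg_plus by now apply contC_mult. apply Cavg_ext. intros; ring.
Qed.

Lemma fourier_scal k v n : contC v -> fourier (fun s => k * v s)%C n = (k * fourier v n)%C.
Proof.
  intros Hv. unfold fourier.
  assert (E : contC (fun s => Cconj (expi s) ^ n)%C) by apply contC_pow, contC_conj, contC_expi.
  rewrite <- Cavg_scal by now apply contC_mult. apply Cavg_ext. intros; ring.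
Qed.

(** The positive and negative parts of Re h and Im h are continuous and
    nonnegative; adding a constant d > 0 makes them positive. The constants
    cancel in the combination that gives back h, and d tends to 0 at the end. *)
Lemma riesz_projection q : 1 < q <= 2 -> exists K, 0 <= K /\ forall h, contC h ->
  mean_bdd q (fourier h) (K * avg (fun t => rpow (Cmod (h t)) q)).
Proof.
  intros Hq. destruct (riesz_positive q Hq) as [A [HA H]].
  assert (Q : 0 < q) by lra.
  assert (R2 := rpow_ge0 2 q).
  set (K := rpow 2 q * (rpow 2 q * (2 * A * rpow 2 q * 4))).
  assert (HK : 0 <= K) by (unfold K; repeat apply Rmult_le_pos; lra).
  exists K. split; [easy | ]. intros h Hh.
  split; [now apply rad_fourier | ]. intros r Hr.
  assert (Main : forall d, 0 < d -> cmean q (fourier h) r <=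
     K * (avg (fun t => rpow (Cmod (h t)) q) + rpow d q)).
  { intros d Hd.
    set (X := avg (fun t => rpow (Cmod (h t)) q) + rpow d q).
    assert (Pos : forall v, contR v -> (forall t, Rabs (v t) <= Cmod (h t)) ->
       let u := fun t => (Rabs (v t) + v t) / 2 + d in
       contC (fun s => RtoC (u s)) /\ mean_bdd q (fourier (fun s => RtoC (u s))) (2 * (A * (rpow 2 q * X)))).
    { intros v Hv Hvh u.
      assert (Hu : contR u).
      { apply contR_plus; [ | apply contR_const]. apply contR_mult; [ | apply contR_const].
        apply contR_plus; [now apply contR_abs | easy]. }
      assert (Hup : forall s, 0 < u s).
      { intros s. unfold u. generalize (Rle_abs (- v s)). rewrite Rabs_Ropp. lra. }
      split; [now apply contC_RtoC | ]. apply mean_bdd_fourier_pos; [lra | easy | ].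
      intros r' Hr'. eapply Rle_trans; [now apply H | ]. apply Rmult_le_compat_l; [easy | ].
      assert (Hhq : contR (fun t => rpow (Cmod (h t)) q)).
      { apply contR_rpow; [now apply contC_Cmod | intros; apply Cmod_ge_0 | easy]. }
      unfold X. rewrite <- (avg_const (rpow d q)), <- avg_plus, <- avg_scal
        by prove_cont.
      apply avg_le.
      - apply contR_rpow; [easy | intros; now left | easy].
      - apply contR_mult; [apply contR_const | apply contR_plus; [easy | apply contR_const]].
      - intros t. eapply Rle_trans; [ | apply rpow_two_max; [apply Cmod_ge_0 | lra | easy]].
        apply rpow_le; [now left | | easy]. unfold u.
        generalize (Hvh t) (Rle_abs (v t)). lra. }
    destruct (Pos (fun t => Re (h t)) (proj1 Hh) ltac:(intros; apply Re_le_Cmod)) as [C1 M1].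
    destruct (Pos (fun t => - Re (h t)) (contR_opp _ (proj1 Hh)) ltac:(intros; cbv beta; rewrite Rabs_Ropp; apply Re_le_Cmod)) as [C2 M2].
    destruct (Pos (fun t => Im (h t)) (proj2 Hh) ltac:(intros; apply Im_le_Cmod)) as [C3 M3].
    destruct (Pos (fun t => - Im (h t)) (contR_opp _ (proj2 Hh)) ltac:(intros; cbv beta; rewrite Rabs_Ropp; apply Im_le_Cmod)) as [C4 M4].
    cbv beta zeta in *.
    set (u1 := fun s => RtoC ((Rabs (Re (h s)) + Re (h s)) / 2 + d)) in *.
    set (u2 := fun s => RtoC ((Rabs (- Re (h s)) + - Re (h s)) / 2 + d)) in *.
    set (u3 := fun s => RtoC ((Rabs (Im (h s)) + Im (h s)) / 2 + d)) in *.
    set (u4 := fun s => RtoC ((Rabs (- Im (h s)) + - Im (h s)) / 2 + d)) in *.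
    assert (N1 : forall c Y, mean_bdd q c Y -> forall k, Cmod k = 1 -> mean_bdd q (fun n => k * c n)%C Y).
    { intros c Y HM k Hk. eapply mean_bdd_le; [exact (mean_bdd_scal q k c Y Q HM) | ]. rewrite Hk, rpow_one. lra. }
    assert (Cm1 : Cmod (- (1)) = 1) by (rewrite Cmod_opp; apply Cmod_1).
    assert (Mre := mean_bdd_plus q _ _ _ _ Q M1 (N1 _ _ M2 (- (1))%C Cm1)).
    assert (Mim := mean_bdd_plus q _ _ _ _ Q M3 (N1 _ _ M4 (- (1))%C Cm1)).
    assert (M := mean_bdd_plus q _ _ _ _ Q Mre (N1 _ _ Mim Ci Cmod_Ci)).
    destruct M as [_ M]. specialize (M r Hr). cbv beta in M.
    rewrite (cmean_ext q (fourier h) (fun n => fourier u1 n + - (1) * fourier u2 n + Ci * (fourier u3 n + - (1) * fourier u4 n))%C).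
    - eapply Rle_trans; [apply M | ]. unfold K. fold X. right. ring.
    - intros n.
      transitivity (fourier (fun s => (u1 s + - (1) * u2 s) + Ci * (u3 s + - (1) * u4 s))%C n).
      + apply Cavg_ext. intros s. f_equal. unfold u1, u2, u3, u4.
        rewrite !Rabs_Ropp. destruct (h s) as [x y]. unfold Ci, RtoC, Re, Im.
        apply injective_projections; simpl; field.
      + rewrite fourier_plus, fourier_plus, fourier_scal, fourier_scal, fourier_plus, fourier_scal by prove_cont. easy. }
  apply le_all_eps. intros e He.
  set (d := rpow (e / (K + 1)) (/ q)).
  assert (He' : 0 < e / (K + 1)) by (apply Rdiv_lt_0_compat; lra).
  assert (Hd : 0 < d) by now apply rpow_gt0.
  eapply Rle_trans; [apply (Main d Hd) | ]. unfold d. rewrite rpow_inv_K by lra.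
  rewrite Rmult_plus_distr_l. apply Rplus_le_compat_l.
  apply Rle_trans with ((K + 1) * (e / (K + 1))); [ | right; field; lra].
  apply Rmult_le_compat_r; lra.
Qed.

(** * Partial sums and Taylor tails in H^q *)

Definition trunc (c : nat -> C) (k n : nat) : C := if Nat.ltb n k then c n else 0.
Definition tail (c : nat -> C) (k n : nat) : C := if Nat.ltb n k then 0 else c n.

Lemma trunc_high c k n : (k <= n)%nat -> trunc c k n = 0.
Proof. intros H. unfold trunc. now rewrite (proj2 (Nat.ltb_ge n k) H). Qed.

Lemma cps_trunc c k z : cps (trunc c k) z = csum (fun n => c n * z ^ n)%C k.
Proof.
  rewrite (cps_poly _ k) by (intros; now apply trunc_high). apply csum_ext. intros n Hn.
  unfold trunc. now rewrite (proj2 (Nat.ltb_lt n k) Hn).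
Qed.

Lemma rad_trunc c k rho : rad rho (trunc c k).
Proof. apply (rad_poly _ k). intros; now apply trunc_high. Qed.

Lemma tpoly_cps c k t : tpoly c k t = cps (trunc c k) (circle_pt 1 t).
Proof.
  rewrite cps_trunc. apply csum_ext. intros j _. rewrite circle_pow, pow1. ring.
Qed.

Lemma contR_tpoly_pow b k q : 0 < q -> contR (fun t => rpow (Cmod (tpoly b k t)) q).
Proof.
  intros Hq. apply contR_rpow; [apply contC_Cmod, contC_tpoly | intros; apply Cmod_ge_0 | easy].
Qed.

Lemma contR_pow_Cmod h q : contC h -> 0 < q -> contR (fun t => rpow (Cmod (h t)) q).
Proof. intros Hh Hq. apply contR_rpow; [now apply contC_Cmod | intros; apply Cmod_ge_0 | easy]. Qed.

(** Means on the circle of radius 1 from those on smaller circles. The factor 2^q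
    comes from the quasi-triangle inequality and is harmless. *)
Lemma cmean_poly_limit q c rho X : 0 < q -> rad rho c -> 1 < rho ->
  (forall r, 0 <= r < 1 -> cmean q c r <= X) -> cmean q c 1 <= rpow 2 q * X.
Proof.
  intros Hq Hc Hrho H. destruct (cps_lip rho c Hc Hrho) as [L [HL0 HL]].
  apply le_all_eps. intros e He.
  assert (P2 := rpow_gt0 2 q Rlt_0_2).
  set (d := rpow (e / rpow 2 q) (/ q)).
  assert (Hd : 0 < d) by (apply rpow_gt0; now apply Rdiv_lt_0_compat).
  set (x := Rmin (/ 2) (d / (L + 1))).
  assert (Hx : 0 < x) by (apply Rmin_glb_lt; [lra | apply Rdiv_lt_0_compat; lra]).
  assert (Hx2 : x <= / 2) by apply Rmin_l.
  assert (Hx3 : x <= d / (L + 1)) by apply Rmin_r.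
  assert (HLx : L * x <= d).
  { apply Rle_trans with ((L + 1) * (d / (L + 1))); [ | right; field; lra].
    apply Rmult_le_compat; lra. }
  apply Rle_trans with (rpow 2 q * (cmean q c (1 - x) + rpow d q)).
  - unfold cmean. assert (R1' := contR_cmean rho q c (1 - x) Hc ltac:(lra) Hq).
    rewrite <- (avg_const (rpow d q)), <- avg_plus, <- avg_scal by prove_cont.
    apply avg_le; [apply (contR_cmean rho); [easy | lra | easy] | prove_cont | ].
    intros t.
    replace (cps c (circle_pt 1 t)) with (cps c (circle_pt (1 - x) t) +
       (cps c (circle_pt 1 t) - cps c (circle_pt (1 - x) t)))%C by ring.
    eapply Rle_trans; [now apply rpow_Cmod_plus | ].
    apply Rmult_le_compat_l; [lra | ]. apply Rplus_le_compat_l.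
    apply rpow_le; [apply Cmod_ge_0 | | easy].
    eapply Rle_trans; [apply HL; rewrite Cmod_circle; lra | ].
    replace (circle_pt 1 t - circle_pt (1 - x) t)%C with (RtoC x * expi t)%C.
    + rewrite Cmod_mult, Cmod_R, Cmod_expi, Rabs_pos_eq by lra. lra.
    + rewrite !circle_pt_expi, RtoC_minus. ring.
  - unfold d. rewrite rpow_inv_K by (try easy; left; now apply Rdiv_lt_0_compat).
    assert (B := H (1 - x) ltac:(lra)).
    replace (rpow 2 q * X + e) with (rpow 2 q * (X + e / rpow 2 q)) by (field; lra).
    apply Rmult_le_compat_l; lra.
Qed.

Lemma fourier_modulated h k j : fourier h (k + j) = fourier (fun s => h s * Cconj (expi s) ^ k)%C j.
Proof. apply Cavg_ext. intros t. rewrite Cpow_add_r. ring. Qed.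

(** The partial sum of order k is P h - z^k P(e^{-ik.} h), where P is the Riesz projection;
    the modulation does not change moduli. *)
Lemma partial_sums_le2 q : 1 < q <= 2 -> exists K, 0 <= K /\ forall h k, contC h ->
  avg (fun t => rpow (Cmod (tpoly (fourier h) k t)) q) <= K * avg (fun t => rpow (Cmod (h t)) q).
Proof.
  intros Hq. destruct (riesz_projection q Hq) as [K [HK H]].
  assert (P2 := rpow_gt0 2 q Rlt_0_2). assert (Q : 0 < q) by lra.
  exists (rpow 2 q * (rpow 2 q * (K + K))).
  split; [repeat apply Rmult_le_pos; lra | ]. intros h k Hh.
  set (X := avg (fun t => rpow (Cmod (h t)) q)).
  set (h' := fun s => (h s * Cconj (expi s) ^ k)%C).
  assert (Hh' : contC h') by (apply contC_mult; [easy | apply contC_pow, contC_conj, contC_expi]).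
  assert (EX : avg (fun t => rpow (Cmod (h' t)) q) = X).
  { apply avg_ext. intros t. unfold h'. now rewrite Cmod_mult, Cmod_cexpi_pow, Rmult_1_r. }
  destruct (H h Hh) as [Ra1 M1]. destruct (H h' Hh') as [Ra2 M2]. rewrite EX in M2. fold X in M1.
  rewrite (avg_ext _ (fun t => rpow (Cmod (cps (trunc (fourier h) k) (circle_pt 1 t))) q))
    by (intros; now rewrite tpoly_cps).
  rewrite Rmult_assoc.
  apply (cmean_poly_limit q (trunc (fourier h) k) 2); [easy | apply rad_trunc | lra | ].
  intros r Hr. apply Rle_trans with (rpow 2 q * (cmean q (fourier h) r + cmean q (fourier h') r)).
  - unfold cmean.
    assert (R1' := contR_cmean 1 q _ r Ra1 Hr Q). assert (R2' := contR_cmean 1 q _ r Ra2 Hr Q).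
    rewrite <- avg_plus, <- avg_scal by prove_cont.
    apply avg_le; [apply (contR_cmean 2); [apply rad_trunc | lra | easy] | prove_cont | ].
    intros t. assert (Hm : Cmod (circle_pt r t) < 1) by (rewrite Cmod_circle; lra).
    rewrite cps_trunc.
    replace (csum _ k) with (cps (fourier h) (circle_pt r t) + - (circle_pt r t ^ k * cps (fourier h') (circle_pt r t)))%C.
    + eapply Rle_trans; [now apply rpow_Cmod_plus | ]. apply Rmult_le_compat_l; [lra | ].
      apply Rplus_le_compat_l. apply rpow_le; [apply Cmod_ge_0 | | easy].
      rewrite Cmod_opp, Cmod_mult, Cmod_pow, Cmod_circle by lra.
      rewrite <- (Rmult_1_l (Cmod (cps (fourier h') _))) at 2.
      apply Rmult_le_compat_r; [apply Cmod_ge_0 | ]. rewrite <- (pow1 k). apply pow_incr; lra.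
    + rewrite (cps_split (fourier h) _ k) by easy.
      rewrite (cps_ext (fun j => fourier h (k + j)) (fourier h')) by (intros; apply fourier_modulated). ring.
  - rewrite Rmult_assoc. apply Rmult_le_compat_l; [lra | ].
    specialize (M1 r Hr). specialize (M2 r Hr). lra.
Qed.

(** Duality for q > 2. With S the partial sum of h and phi = |S|^{q-2} S, the mean of
    |S|^q is the pairing of phi with S, equal to the pairing of h with the
    partial sum T of phi. For the exponent p = q/(q-1) <= 2, the mean of |T|^p
    is at most K0 times the mean of |phi|^p = |S|^q, and Young's inequality with
    a suitable weight absorbs this into the left-hand side. *)
Lemma partial_sums q : 1 < q -> exists K, 0 <= K /\ forall h k, contC h ->
  avg (fun t => rpow (Cmod (tpoly (fourier h) k t)) q) <= K * avg (fun t => rpow (Cmod (h t)) q).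
Proof.
  intros Hq. destruct (Rle_dec q 2) as [Hq2 | Hq2]; [now apply partial_sums_le2 | ].
  set (p := q / (q - 1)).
  assert (Hp : 1 < p <= 2).
  { unfold p. split; apply Rmult_lt_reg_r with (q - 1) || apply Rmult_le_reg_r with (q - 1); try lra;
    unfold Rdiv; rewrite Rmult_assoc, Rinv_l by lra; lra. }
  destruct (partial_sums_le2 p Hp) as [K0 [HK0 H]].
  set (K := K0 + 1). assert (HK : 0 < K) by (unfold K; lra).
  (* Young's inequality is applied to la |h| and |T| / la; the weight la makes the
     coefficient (q - 1) K0 / K of the absorbed term smaller than q - 1. *)
  set (la := rpow K (/ p)). assert (Hla : 0 < la) by now apply rpow_gt0.
  exists (rpow la q). split; [apply rpow_ge0 | ]. intros h k Hh.
  set (S := tpoly (fourier h) k). assert (HS : contC S) by apply contC_tpoly.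
  set (X := avg (fun t => rpow (Cmod (S t)) q)).
  set (Y := avg (fun t => rpow (Cmod (h t)) q)).
  set (phi := fun t => (RtoC (rpow (Cmod (S t)) (q - 2)) * S t)%C).
  assert (Hphi : contC phi).
  { apply contC_mult; [ | easy]. apply contC_RtoC. apply contR_pow_Cmod; [easy | lra]. }
  assert (Mphi : forall t, Cmod (phi t) = rpow (Cmod (S t)) (q - 1)).
  { intros t. unfold phi. rewrite Cmod_mult, Cmod_R, Rabs_pos_eq by apply rpow_ge0.
    rewrite (rpow_pred _ (q - 1)) by apply Cmod_ge_0. replace (q - 1 - 1) with (q - 2) by ring. ring. }
  set (T := tpoly (fourier phi) k). assert (HT : contC T) by apply contC_tpoly.
  assert (E1 : RtoC X = Cavg (fun t => phi t * Cconj (S t))%C).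
  { unfold X. rewrite <- Cavg_RtoC. apply Cavg_ext. intros t. unfold phi.
    rewrite <- Cmult_assoc, <- Cmod_sqr_conj, <- RtoC_mult. f_equal.
    rewrite (rpow_pred _ q), (rpow_pred _ (q - 1)) by apply Cmod_ge_0.
    replace (q - 1 - 1) with (q - 2) by ring. ring. }
  assert (Gen : forall F b, contC F -> Cavg (fun t => F t * Cconj (tpoly b k t))%C =
     csum (fun j => Cconj (b j) * fourier F j)%C k).
  { intros F b HF.
    assert (HFj : forall j, contC (fun t => F t * Cconj (expi t) ^ j)%C)
      by (intros; apply contC_mult; [easy | apply contC_pow, contC_conj, contC_expi]).
    rewrite (Cavg_ext _ (fun t => csum (fun j => Cconj (b j) * (F t * Cconj (expi t) ^ j)) k)%C).
    - rewrite (Cavg_csum (fun j t => Cconj (b j) * (F t * Cconj (expi t) ^ j))%C).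
      + apply csum_ext. intros j _. now rewrite Cavg_scal.
      + intros j. apply contC_mult; [apply contC_const | easy].
    - intros t. unfold tpoly. rewrite Cconj_csum, <- csum_scal. apply csum_ext. intros j _.
      rewrite Cmult_conj, Cconj_pow. ring. }
  assert (E2 : RtoC X = Cconj (Cavg (fun t => h t * Cconj (T t)))%C).
  { rewrite E1. unfold S, T. rewrite !Gen by easy. rewrite Cconj_csum. apply csum_ext.
    intros j _. rewrite Cmult_conj, Cconj_conj. ring. }
  assert (B : X <= avg (fun t => Cmod (h t) * Cmod (T t))).
  { apply Rle_trans with (Cmod (RtoC X)); [rewrite Cmod_R; apply Rle_abs | ].
    rewrite E2, Cmod_conj. eapply Rle_trans; [apply Cmod_Cavg; apply contC_mult; [easy | now apply contC_conj] | ].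
    right. apply avg_ext. intros t. now rewrite Cmod_mult, Cmod_conj. }
  assert (X0 : 0 <= X) by (apply avg_ge0; [apply contR_pow_Cmod; [easy | lra] | intros; apply rpow_ge0]).
  assert (BT : avg (fun t => rpow (Cmod (T t)) p) <= K0 * X).
  { eapply Rle_trans; [now apply H | ]. right. f_equal. apply avg_ext. intros t.
    rewrite Mphi, rpow_rpow by apply Cmod_ge_0. f_equal. unfold p. field. lra. }
  assert (Rh : contR (fun t => rpow (Cmod (h t)) q)) by (apply contR_pow_Cmod; [easy | lra]).
  assert (RT : contR (fun t => rpow (Cmod (T t)) p)) by (apply contR_pow_Cmod; [easy | lra]).
  assert (RhT : contR (fun t => Cmod (h t) * Cmod (T t))) by (apply contR_mult; now apply contC_Cmod).
  assert (Yg : forall t, q * (Cmod (h t) * Cmod (T t)) <=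
     rpow la q * rpow (Cmod (h t)) q + (q - 1) * / K * rpow (Cmod (T t)) p).
  { intros t. set (x := la * Cmod (h t)). set (y := rpow (Cmod (T t) / la) (/ (q - 1))).
    assert (Hx : 0 <= x) by (apply Rmult_le_pos; [lra | apply Cmod_ge_0]).
    assert (HTl : 0 <= Cmod (T t) / la).
    { apply Rmult_le_pos; [apply Cmod_ge_0 | left; now apply Rinv_0_lt_compat]. }
    assert (Yy := young x y q ltac:(lra) Hx (rpow_ge0 _ _)).
    assert (F1 : rpow y (q - 1) = Cmod (T t) / la) by (apply rpow_inv_K; [easy | lra]).
    assert (F2 : rpow y q = / K * rpow (Cmod (T t)) p).
    { unfold y. rewrite rpow_rpow by easy. replace (/ (q - 1) * q) with p by (unfold p; field; lra).
      unfold Rdiv. rewrite rpow_mult_distr; [ | apply Cmod_ge_0 | left; now apply Rinv_0_lt_compat].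
      rewrite Rmult_comm. f_equal. unfold la.
      rewrite rpow_pos by (apply Rinv_0_lt_compat, rpow_gt0, HK).
      rewrite (rpow_pos K) by easy. unfold Rpower. rewrite ln_Rinv by apply exp_pos.
      rewrite ln_exp. replace (p * - (/ p * ln K)) with (- ln K) by (field; lra).
      rewrite exp_Ropp, exp_ln; easy. }
    rewrite F1, F2 in Yy. unfold x in Yy. rewrite rpow_mult_distr in Yy by (try apply Cmod_ge_0; lra).
    replace (q * (la * Cmod (h t)) * (Cmod (T t) / la)) with (q * (Cmod (h t) * Cmod (T t))) in Yy by (field; lra).
    lra. }
  assert (Z : q * X <= rpow la q * Y + (q - 1) * / K * (K0 * X)).
  { apply Rle_trans with (avg (fun t => q * (Cmod (h t) * Cmod (T t)))).
    - rewrite avg_scal by easy. apply Rmult_le_compat_l; lra.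
    - apply Rle_trans with (avg (fun t => rpow la q * rpow (Cmod (h t)) q + (q - 1) * / K * rpow (Cmod (T t)) p)).
      + apply avg_le; [apply contR_mult; [apply contR_const | easy] | | exact Yg].
        apply contR_plus; apply contR_mult; try easy; apply contR_const.
      + rewrite avg_plus, !avg_scal by (first [easy | apply contR_mult; [apply contR_const | easy]]).
        fold Y. apply Rplus_le_compat_l. apply Rmult_le_compat_l; [ | easy].
        apply Rmult_le_pos; [lra | left; now apply Rinv_0_lt_compat]. }
  assert (W : (q - 1) * / K * (K0 * X) <= (q - 1) * X).
  { rewrite Rmult_assoc. apply Rmult_le_compat_l; [lra | ].
    apply Rmult_le_reg_l with K; [easy | ]. rewrite <- Rmult_assoc, Rinv_r by lra. unfold K. lra. }
  lra.
Qed.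

Lemma tails_bounded q : 1 < q -> exists K, 0 <= K /\ forall c X, mean_bdd q c X ->
  forall k, mean_bdd q (tail c k) (K * X).
Proof.
  intros Hq. destruct (partial_sums q Hq) as [K [HK H]]. assert (Q : 0 < q) by lra.
  assert (P2 := rpow_gt0 2 q Rlt_0_2).
  exists (rpow 2 q * (1 + K)). split; [apply Rmult_le_pos; lra | ]. intros c X [Hc HX] k.
  assert (Ht : rad 1 (tail c k)).
  { apply (rad_le 1 c); [easy | ]. intros n. unfold tail. destruct (Nat.ltb n k); [ | lra].
    rewrite Cmod_0. apply Cmod_ge_0. }
  split; [easy | ]. intros r Hr.
  set (h := fun t => cps c (circle_pt r t)). assert (Hh : contC h) by now apply (contC_cps 1).
  assert (Es : forall t, tpoly (fourier h) k t = cps (trunc c k) (circle_pt r t)).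
  { intros t. rewrite cps_trunc. apply csum_ext. intros j _. unfold fourier, h.
    rewrite (Cavg_cps_coef 1) by easy. rewrite circle_pow. ring. }
  assert (Rh : contR (fun t => rpow (Cmod (h t)) q)) by now apply contR_pow_Cmod.
  assert (Rs := contR_tpoly_pow (fourier h) k q Q).
  apply Rle_trans with (rpow 2 q * (cmean q c r + avg (fun t => rpow (Cmod (tpoly (fourier h) k t)) q))).
  - unfold cmean. fold h. rewrite <- avg_plus, <- avg_scal by prove_cont.
    apply avg_le; [now apply (contR_cmean 1) | prove_cont | ]. intros t.
    assert (Hm : Cmod (circle_pt r t) < 1) by (rewrite Cmod_circle; lra).
    rewrite Es. rewrite <- (Cmod_opp (cps (trunc c k) _)).
    eapply Rle_trans; [ | now apply rpow_Cmod_plus]. right. do 2 f_equal.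
    unfold h. rewrite (cps_ext c (fun n => tail c k n + trunc c k n)%C).
    + rewrite (cps_plus 1) by (first [easy | apply rad_trunc]). ring.
    + intros n. unfold tail, trunc. destruct (Nat.ltb n k); ring.
  - rewrite Rmult_assoc. apply Rmult_le_compat_l; [lra | ].
    assert (B := H h k Hh). fold (cmean q c r) in B. specialize (HX r Hr).
    change (avg (fun t => rpow (Cmod (h t)) q)) with (cmean q c r) in B.
    assert (K * cmean q c r <= K * X) by now apply Rmult_le_compat_l. lra.
Qed.

(** * Uniform convexity of powers *)

Lemma power_midpoint_strict b q : 1 < q -> 0 <= b < 1 ->
  rpow ((1 + b) / 2) q < (1 + rpow b q) / 2.
Proof.
  intros Hq Hb. set (y := (1 + b) / 2).
  assert (Hy : 0 < y) by (unfold y; lra).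
  assert (Y1 := young_strict 1 y q Hq ltac:(lra) Hy ltac:(unfold y; lra)).
  assert (Y2 := young b y q ltac:(lra) (proj1 Hb) ltac:(lra)).
  rewrite rpow_one in Y1. rewrite (rpow_pred y q) in * by lra.
  assert (E : b = 2 * y - 1) by (unfold y; field).
  set (P := rpow y (q - 1)) in *. rewrite E in Y2 at 1. nra.
Qed.

Lemma power_midpoint b q : 1 < q -> 0 <= b <= 1 ->
  rpow ((1 + b) / 2) q <= (1 + rpow b q) / 2.
Proof.
  intros Hq Hb. destruct (Req_dec b 1) as [-> | N].
  - replace ((1 + 1) / 2) with 1 by field. rewrite rpow_one. lra.
  - left. apply power_midpoint_strict; lra.
Qed.

(** In the application b, tau and mu are |b|, |a-b| and |a+b|/2 for complex numbers
    with |a| = 1 >= |b|, and the last hypothesis is the parallelogram law.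
    If tau is at most e1, the first term suffices. Otherwise the convexity gap is
    bounded below: for b close to 1 the parallelogram law makes mu smaller than
    b, and for b <= b0 < 1 strict convexity of the power applies on a
    compact interval. *)
Lemma uniform_convexity_normalized q e : 1 < q -> 0 < e -> exists K, 0 <= K /\
  forall b tau mu, 0 <= b <= 1 -> 0 <= tau -> 0 <= mu -> mu <= (1 + b) / 2 ->
   4 * (mu * mu) + tau * tau = 2 * (1 + b * b) ->
   rpow tau q <= e * (1 + rpow b q) + K * ((1 + rpow b q) / 2 - rpow mu q).
Proof.
  intros Hq He. assert (Q : 0 < q) by lra.
  set (e1 := Rmin 1 (rpow e (/ q))).
  assert (He1 : 0 < e1) by (apply Rmin_glb_lt; [lra | now apply rpow_gt0]).
  assert (He2 : e1 <= 1) by apply Rmin_l.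
  assert (He3 : rpow e1 q <= e).
  { apply rpow_le_inv; try lra. apply Rmin_r. }
  (* If tau > e1, the parallelogram law gives mu <= m0, and m0 < b0. *)
  set (b0 := sqrt (1 - e1 * e1 / 8)).
  assert (Hs : 0 < 1 - e1 * e1 / 8 < 1) by nra.
  assert (Hb0s : b0 * b0 = 1 - e1 * e1 / 8) by (apply sqrt_sqrt; lra).
  assert (Hb0 : 0 < b0) by (apply sqrt_lt_R0; lra).
  assert (Hb01 : b0 < 1) by nra.
  set (m0 := sqrt (1 - e1 * e1 / 4)).
  assert (Hm0s : m0 * m0 = 1 - e1 * e1 / 4) by (apply sqrt_sqrt; nra).
  assert (Hm0 : 0 <= m0) by apply sqrt_pos.
  assert (Hmb : m0 < b0) by nra.
  set (d1 := rpow b0 q - rpow m0 q).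
  assert (Hd1 : 0 < d1) by (unfold d1; generalize (rpow_lt m0 b0 q Hm0 Hmb Q); lra).
  set (g := fun b => (1 + rpow (Rabs b) q) / 2 - rpow (Rabs ((1 + b) / 2)) q).
  assert (Hg : contR g).
  { assert (Hid : contR (fun b : R => b)) by (intros t; apply continuous_id).
    apply contR_minus.
    - apply contR_mult; [ | apply contR_const]. apply contR_plus; [apply contR_const | ].
      apply contR_rpow; [now apply contR_abs | intros; apply Rabs_pos | easy].
    - apply contR_rpow; [ | intros; apply Rabs_pos | easy]. apply contR_abs.
      apply contR_mult; [ | apply contR_const]. apply contR_plus; [apply contR_const | easy]. }
  assert (Eg : forall b, 0 <= b -> g b = (1 + rpow b q) / 2 - rpow ((1 + b) / 2) q).
  { intros b Hb. unfold g. rewrite !Rabs_pos_eq by lra. easy. }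
  destruct (continuity_ab_min g 0 b0) as [x [Hx Hxb]]; [lra | | ].
  { intros c _. apply continuity_pt_filterlim. apply Hg. }
  set (d2 := g x).
  assert (Hd2 : 0 < d2).
  { unfold d2. rewrite Eg by lra. generalize (power_midpoint_strict x q Hq ltac:(lra)). lra. }
  set (d := Rmin d1 d2). assert (Hd : 0 < d) by now apply Rmin_glb_lt.
  assert (P2 := rpow_gt0 2 q Rlt_0_2).
  exists (rpow 2 q / d). split; [left; now apply Rdiv_lt_0_compat | ].
  intros b tau mu Hb Htau Hmu Hmub Epar.
  assert (Pb := rpow_ge0 b q).
  assert (Gap : 0 <= (1 + rpow b q) / 2 - rpow mu q).
  { generalize (power_midpoint b q Hq Hb) (rpow_le mu _ q Hmu Hmub Q). lra. }
  assert (KP : 0 < rpow 2 q / d) by now apply Rdiv_lt_0_compat.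
  destruct (Rle_dec tau e1) as [Ht | Ht].
  - assert (rpow tau q <= rpow e1 q) by now apply rpow_le.
    assert (0 <= rpow 2 q / d * ((1 + rpow b q) / 2 - rpow mu q)) by (apply Rmult_le_pos; lra).
    nra.
  - assert (Ht2 : tau <= 2) by nra.
    assert (T2 : rpow tau q <= rpow 2 q) by now apply rpow_le.
    assert (G : d <= (1 + rpow b q) / 2 - rpow mu q).
    { destruct (Rle_dec b0 b) as [Hbb | Hbb].
      - eapply Rle_trans; [apply Rmin_l | ]. unfold d1.
        assert (mu <= m0) by nra.
        assert (rpow mu q <= rpow m0 q) by now apply rpow_le.
        assert (rpow b0 q <= rpow b q) by (apply rpow_le; lra).
        assert (rpow b q <= 1) by (rewrite <- (rpow_one q); apply rpow_le; lra). lra.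
      - eapply Rle_trans; [apply Rmin_r | ].
        assert (B := Hx b ltac:(lra)). fold d2 in B. rewrite Eg in B by lra.
        generalize (rpow_le mu _ q Hmu Hmub Q). lra. }
    assert (rpow 2 q / d * d <= rpow 2 q / d * ((1 + rpow b q) / 2 - rpow mu q)).
    { apply Rmult_le_compat_l; lra. }
    replace (rpow 2 q / d * d) with (rpow 2 q) in H by (field; lra).
    assert (0 <= e * (1 + rpow b q)) by (apply Rmult_le_pos; lra). lra.
Qed.

Lemma parallelogram (a b : C) : Cmod (a + b) * Cmod (a + b) + Cmod (a - b) * Cmod (a - b) =
  2 * (Cmod a * Cmod a + Cmod b * Cmod b).
Proof.
  assert (E : forall z, Cmod z * Cmod z = Re z * Re z + Im z * Im z).
  { intros z. assert (H := Cmod2_alt z). simpl in H. rewrite !Rmult_1_r in H. easy. }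
  rewrite !E. unfold Re, Im. simpl. ring.
Qed.

(** If the gap in the midpoint convexity of |.|^q is small, then a and b are
    close, with constants that do not depend on a and b. *)
Lemma uniform_convexity q e : 1 < q -> 0 < e -> exists K, 0 <= K /\ forall a b : C,
  rpow (Cmod (a - b)) q <= e * (rpow (Cmod a) q + rpow (Cmod b) q) +
    K * ((rpow (Cmod a) q + rpow (Cmod b) q) / 2 - rpow (Cmod ((a + b) / 2)) q).
Proof.
  intros Hq He. destruct (uniform_convexity_normalized q e Hq He) as [K [HK H]].
  exists K. split; [easy | ].
  assert (D2 : forall z : C, Cmod (z / 2) = Cmod z / 2).
  { intros z. rewrite Cmod_div by (intros E; apply RtoC_inj in E; lra).
    now rewrite Cmod_R, Rabs_pos_eq by lra. }
  assert (Main : forall a b : C, Cmod b <= Cmod a ->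
   rpow (Cmod (a - b)) q <= e * (rpow (Cmod a) q + rpow (Cmod b) q) +
    K * ((rpow (Cmod a) q + rpow (Cmod b) q) / 2 - rpow (Cmod ((a + b) / 2)) q)).
  { intros a b Hab. rewrite D2.
    assert (Pa := Cmod_ge_0 a). assert (Pb := Cmod_ge_0 b).
    assert (Pp := Cmod_ge_0 (a + b)). assert (Pm := Cmod_ge_0 (a - b)).
    assert (Par := parallelogram a b). assert (Tri := Cmod_triangle a b).
    set (A := Cmod a) in *. set (B := Cmod b) in *.
    set (U := Cmod (a + b)) in *. set (V := Cmod (a - b)) in *.
    destruct Pa as [Pa | Pa].
    2: { assert (B = 0) by lra. assert (V = 0) by nra. assert (U = 0) by nra.
         rewrite <- Pa, H0, H1, H2. replace (0 / 2) with 0 by field. rewrite rpow_0. lra. }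
    assert (D : forall x, 0 <= x -> 0 <= x / A).
    { intros x Hx. apply Rmult_le_pos; [easy | left; now apply Rinv_0_lt_compat]. }
    assert (HH := H (B / A) (V / A) (U / 2 / A)).
    assert (EV : rpow V q = rpow A q * rpow (V / A) q).
    { rewrite <- rpow_mult_distr by (try apply D; lra). f_equal. field. lra. }
    assert (EB : rpow B q = rpow A q * rpow (B / A) q).
    { rewrite <- rpow_mult_distr by (try apply D; lra). f_equal. field. lra. }
    assert (EU : rpow (U / 2) q = rpow A q * rpow (U / 2 / A) q).
    { rewrite <- rpow_mult_distr by (try apply D; lra). f_equal. field. lra. }
    rewrite EV, EB, EU. assert (PA := rpow_ge0 A q).
    apply Rmult_le_compat_l with (r := rpow A q) in HH; [lra | easy | | | | | ]; clear EV EB EU.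
    - split; [now apply D | ]. apply Rmult_le_reg_r with A; [easy | ]. field_simplify; lra.
    - now apply D.
    - apply D; lra.
    - apply Rmult_le_reg_r with A; [easy | ]. field_simplify; lra.
    - apply Rmult_eq_reg_r with (A * A); [ | nra]. field_simplify; [ | lra | lra]. nra. }
  intros a b. destruct (Rle_dec (Cmod b) (Cmod a)) as [Hab | Hab]; [now apply Main | ].
  assert (Hba : Cmod a <= Cmod b) by lra.
  specialize (Main b a Hba). rewrite (Cplus_comm a b).
  replace (a - b)%C with (- (b - a))%C by ring. rewrite Cmod_opp. lra.
Qed.

(** * Dilations converge, tails vanish *)

Definition dilate (rho : R) (c : nat -> C) (n : nat) : C := (c n * RtoC (rho ^ n))%C.

Lemma cps_dilate_circle c rho r t : cps (dilate rho c) (circle_pt r t) = cps c (circle_pt (rho * r) t).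
Proof.
  unfold dilate. rewrite cps_dilate. f_equal. rewrite !circle_pt_expi, RtoC_mult. ring.
Qed.

Lemma rad_dilate_inv rho c : 0 < rho < 1 -> rad 1 c -> rad (/ rho) (dilate rho c).
Proof.
  intros Hr Hc x Hx. destruct (Hc (rho * x)) as [K HK].
  - split; [nra | ]. apply Rmult_lt_reg_l with (/ rho); [apply Rinv_0_lt_compat; lra | ].
    rewrite <- Rmult_assoc, Rinv_l by lra. lra.
  - exists K. intros n. unfold dilate. rewrite Cmod_mult, Cmod_R, Rabs_pos_eq by (apply pow_le; lra).
    rewrite Rmult_assoc, <- Rpow_mult_distr. apply HK.
Qed.

Lemma inv_gt1 r : 0 < r < 1 -> 1 < / r.
Proof. intros Hr. rewrite <- Rinv_1. apply Rinv_lt_contravar; lra. Qed.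

(** The mean of (F(r.) + F(s.))/2 on the unit circle is at least its mean on the
    circle of radius r0, where both dilations are close to F by the Lipschitz
    bound. *)
Lemma midpoint_lower q c r0 : 1 < q -> rad 1 c -> 0 < r0 < 1 -> forall e, 0 < e ->
  exists r1, 0 < r1 < 1 /\ forall r s, r1 <= r < 1 -> r1 <= s < 1 ->
   cmean q c r0 - e <= avg (fun t => rpow (Cmod ((cps c (circle_pt r t) + cps c (circle_pt s t)) / 2)) q).
Proof.
  intros Hq Hc Hr0 e He. assert (Q : 0 < q) by lra.
  destruct (cps_lip (/ r0) (dilate r0 c)) as [L [HL0 HL]]; [now apply rad_dilate_inv | now apply inv_gt1 | ].
  destruct (contR_bounded _ (contC_Cmod _ (contC_cps 1 c r0 Hc ltac:(lra)))) as [B HB].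
  assert (HB0 : 0 <= B).
  { eapply Rle_trans; [apply Cmod_ge_0 | apply (HB 0)]. generalize two_pi_gt0. lra. }
  set (W := q * rpow B (q - 1) * L).
  assert (HW : 0 <= W) by (unfold W; repeat apply Rmult_le_pos; try lra; apply rpow_ge0).
  set (x := Rmin (/ 2) (e / (W + 1))).
  assert (Hx : 0 < x) by (apply Rmin_glb_lt; [lra | apply Rdiv_lt_0_compat; lra]).
  assert (Hx2 : x <= / 2) by apply Rmin_l.
  assert (Hx3 : x <= e / (W + 1)) by apply Rmin_r.
  assert (HWx : W * x <= e).
  { apply Rle_trans with ((W + 1) * (e / (W + 1))); [ | right; field; lra].
    apply Rmult_le_compat; lra. }
  exists (1 - x). split; [lra | ]. intros r s Hr Hs.
  (* The midpoint is analytic across the unit circle, so that its means are monotone up to 1. *)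
  set (m := fun n => (RtoC (/ 2) * (dilate r c n + dilate s c n))%C).
  set (rho := / Rmax r s).
  assert (Hmax : 0 < Rmax r s < 1).
  { split; [eapply Rlt_le_trans; [ | apply Rmax_l]; lra | apply Rmax_lub_lt; lra]. }
  assert (Hrho : 1 < rho) by now apply inv_gt1.
  assert (Rr : forall y, 0 < y <= Rmax r s -> rad rho (dilate y c)).
  { intros y Hy z Hz. apply (rad_dilate_inv y c); [lra | easy | ]. split; [lra | ].
    eapply Rlt_le_trans; [apply Hz | ]. apply Rinv_le_contravar; lra. }
  assert (Rr1 : rad rho (dilate r c)) by (apply Rr; split; [lra | apply Rmax_l]).
  assert (Rs1 : rad rho (dilate s c)) by (apply Rr; split; [lra | apply Rmax_r]).
  assert (Rm : rad rho m) by (apply rad_scal; now apply rad_plus).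
  assert (Em : forall y t, 0 <= y <= 1 -> cps m (circle_pt y t) =
    ((cps c (circle_pt (r * y) t) + cps c (circle_pt (s * y) t)) / 2)%C).
  { intros y t Hy. assert (Hmod : Cmod (circle_pt y t) < rho) by (rewrite Cmod_circle; lra).
    unfold m. rewrite (cps_scal rho) by (try easy; now apply rad_plus).
    rewrite (cps_plus rho) by easy. rewrite !cps_dilate_circle.
    rewrite RtoC_inv by lra. unfold Cdiv. ring. }
  apply Rle_trans with (cmean q m r0).
  2: { eapply Rle_trans; [apply (cmean_mono rho q m r0 1); try easy; lra | ].
       right. apply avg_ext. intros t. rewrite Em by lra. now rewrite !Rmult_1_r. }
  assert (Rm0 : contR (fun t => rpow (Cmod (cps m (circle_pt r0 t))) q)).
  { apply (contR_cmean rho); [easy | lra | easy]. }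
  assert (Rc0 := contR_cmean 1 q c r0 Hc ltac:(lra) Q).
  unfold cmean. rewrite <- (avg_const e), <- avg_minus by prove_cont.
  apply avg_le_loc; [ | easy | ].
  - apply contR_minus; [easy | apply contR_const].
  - intros t Ht. set (y := Cmod (cps c (circle_pt r0 t))).
    set (X := Cmod (cps m (circle_pt r0 t))).
    assert (Hy : 0 <= y) by apply Cmod_ge_0. assert (HX : 0 <= X) by apply Cmod_ge_0.
    assert (D : y <= X + L * x).
    { assert (Dr : forall r, 1 - x <= r < 1 -> Cmod (cps c (circle_pt r0 t) - cps c (circle_pt (r * r0) t)) <= L * x).
      { intros r' Hr'. replace (cps c (circle_pt r0 t)) with (cps (dilate r0 c) (circle_pt 1 t))
          by now rewrite cps_dilate_circle, Rmult_1_r.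
        rewrite (Rmult_comm r'), <- cps_dilate_circle.
        eapply Rle_trans; [apply HL; rewrite Cmod_circle; lra | ].
        replace (circle_pt 1 t - circle_pt r' t)%C with (RtoC (1 - r') * expi t)%C.
        - rewrite Cmod_mult, Cmod_R, Cmod_expi, Rabs_pos_eq by lra. nra.
        - rewrite !circle_pt_expi, RtoC_minus. ring. }
      assert (D1 := Dr r Hr). assert (D2 := Dr s Hs).
      unfold X, y. rewrite Em by lra.
      set (f0 := cps c (circle_pt r0 t)) in *. set (f1 := cps c (circle_pt (r * r0) t)) in *.
      set (f2 := cps c (circle_pt (s * r0) t)) in *.
      replace f0 with ((f1 + f2) / 2 + ((f0 - f1) + (f0 - f2)) / 2)%C at 1.
      2: { field. }
      eapply Rle_trans; [apply Cmod_triangle | ]. apply Rplus_le_compat_l.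
      rewrite Cmod_div by (intros E; apply RtoC_inj in E; lra).
      rewrite Cmod_R, Rabs_pos_eq by lra.
      assert (T := Cmod_triangle (f0 - f1) (f0 - f2)). lra. }
    assert (Y := young X y q ltac:(lra) HX Hy).
    assert (PB : rpow y (q - 1) <= rpow B (q - 1)) by (apply rpow_le; [easy | now apply HB | lra]).
    assert (P0 := rpow_ge0 y (q - 1)).
    rewrite (rpow_pred y q) in * by easy.
    assert (q * (y - X) * rpow y (q - 1) <= W * x).
    { apply Rle_trans with (q * (L * x) * rpow y (q - 1)).
      - apply Rmult_le_compat_r; [easy | ]. apply Rmult_le_compat_l; lra.
      - replace (W * x) with (q * (L * x) * rpow B (q - 1)) by (unfold W; ring).
        apply Rmult_le_compat_l; [ | easy]. repeat apply Rmult_le_pos; lra. }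
    lra.
Qed.

(** Let N be the supremum of the means. For r and s near 1 the means of
    the dilations are at most N and that of their midpoint is almost N, so
    that uniform convexity makes F(r.) - F(s.) small. Monotonicity of the means
    extends this to all circles. *)
Lemma dilations_converge q c X : 1 < q -> mean_bdd q c X -> forall e, 0 < e ->
  exists rho, 0 < rho < 1 /\ mean_bdd q (fun n => c n + - (1) * dilate rho c n)%C e.
Proof.
  intros Hq [Hc HX] e He. assert (Q : 0 < q) by lra.
  destruct (completeness (fun y => exists r, 0 < r < 1 /\ y = cmean q c r)) as [N [HN1 HN2]].
  { exists X. intros y [r [Hr ->]]. apply HX. lra. }
  { exists (cmean q c (/ 2)), (/ 2). split; [lra | easy]. }
  assert (N0 : 0 <= N).
  { apply Rle_trans with (cmean q c (/ 2)); [ | apply HN1; exists (/ 2); split; [lra | easy]].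
    apply avg_ge0; [apply (contR_cmean 1); [easy | lra | easy] | intros; apply rpow_ge0]. }
  assert (HN : forall r, 0 < r < 1 -> cmean q c r <= N) by (intros r Hr; apply HN1; now exists r).
  destruct (uniform_convexity q (e / (4 * (N + 1))) Hq) as [K [HK UC]].
  { apply Rdiv_lt_0_compat; lra. }
  set (e' := e / (4 * (K + 1))). assert (He' : 0 < e') by (apply Rdiv_lt_0_compat; lra).
  assert (exists r0, 0 < r0 < 1 /\ N - e' <= cmean q c r0) as [r0 [Hr0 Hr0N]].
  { destruct (Classical_Prop.classic (exists r0, 0 < r0 < 1 /\ N - e' <= cmean q c r0)) as [H | H]; [easy | ].
    exfalso. assert (N <= N - e'); [ | lra]. apply HN2. intros y [r [Hr ->]].
    apply Rnot_lt_le. intros Hlt. apply H. exists r. split; [easy | lra]. }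
  destruct (midpoint_lower q c r0 Hq Hc Hr0 e' He') as [r1 [Hr1 ML]].
  assert (Cauchy : forall r s, r1 <= r < 1 -> r1 <= s < 1 ->
    avg (fun t => rpow (Cmod (cps c (circle_pt r t) - cps c (circle_pt s t))) q) <= e).
  { intros r s Hr Hs. assert (M := ML r s Hr Hs).
    assert (Cr := contC_cps 1 c r Hc ltac:(lra)). assert (Cs := contC_cps 1 c s Hc ltac:(lra)).
    assert (Rr := contR_cmean 1 q c r Hc ltac:(lra) Q). assert (Rs := contR_cmean 1 q c s Hc ltac:(lra) Q).
    assert (Rmid : contR (fun t => rpow (Cmod ((cps c (circle_pt r t) + cps c (circle_pt s t)) / 2)) q)).
    { apply contR_pow_Cmod; [ | easy]. apply contC_mult; [now apply contC_plus | apply contC_const]. }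
    set (a := e / (4 * (N + 1))) in *. set (m := avg (fun t => rpow (Cmod (_ / 2)) q)) in *.
    apply Rle_trans with (avg (fun t => (a + K / 2) * (rpow (Cmod (cps c (circle_pt r t))) q + rpow (Cmod (cps c (circle_pt s t))) q)
       + (- K) * rpow (Cmod ((cps c (circle_pt r t) + cps c (circle_pt s t)) / 2)) q)).
    - apply avg_le; [apply contR_pow_Cmod; [now apply contC_minus | easy] | prove_cont | ].
      intros t. generalize (UC (cps c (circle_pt r t)) (cps c (circle_pt s t))). lra.
    - rewrite avg_plus, avg_scal, avg_scal, avg_plus by prove_cont.
      fold (cmean q c r) (cmean q c s). fold m.
      assert (B1 := HN r ltac:(lra)). assert (B2 := HN s ltac:(lra)).
      assert (Pa : 0 < a) by (apply Rdiv_lt_0_compat; lra).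
      assert (Ea : a * (N + 1) = e / 4) by (unfold a; field; lra).
      assert (Ee : e' * (K + 1) = e / 4) by (unfold e'; field; lra).
      assert (S1 : (a + K / 2) * (cmean q c r + cmean q c s) <= (a + K / 2) * (2 * N)).
      { apply Rmult_le_compat_l; lra. }
      assert (S2 : K * (N - 2 * e') <= K * m) by (apply Rmult_le_compat_l; lra).
      nra. }
  (* A circle of radius s >= rho is mapped by the dilation to the radius rho s >= rho^2 >= r1. *)
  set (rho := (1 + r1) / 2). assert (Hrho : 0 < rho < 1) by (unfold rho; lra).
  exists rho. split; [easy | ].
  assert (Rd : rad 1 (dilate rho c)) by (apply (rad_dilate 1); [easy | lra]).
  assert (Rdd : rad 1 (fun n => c n + - (1) * dilate rho c n)%C) by (apply rad_plus; [easy | now apply rad_scal]).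
  split; [easy | ]. intros r Hr. set (s := Rmax r rho).
  assert (Hs : rho <= s < 1) by (split; [apply Rmax_r | apply Rmax_lub_lt; lra]).
  assert (Hrs : r <= s) by apply Rmax_l.
  eapply Rle_trans; [apply (cmean_mono 1 q _ r s Rdd); lra | ].
  eapply Rle_trans; [ | apply (Cauchy s (rho * s)); [unfold rho in *; lra | ]].
  - right. apply avg_ext. intros t. assert (Hm : Cmod (circle_pt s t) < 1) by (rewrite Cmod_circle; lra).
    rewrite (cps_plus 1) by (try easy; now apply rad_scal). rewrite (cps_scal 1) by easy.
    rewrite cps_dilate_circle. do 2 f_equal. ring.
  - split; [ | nra]. assert (rho * rho <= rho * s) by (apply Rmult_le_compat_l; lra).
    assert (r1 <= rho * rho) by (unfold rho; nra). lra.
Qed.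

Lemma rad_tail rho c k : rad rho c -> rad rho (tail c k).
Proof.
  intros Hc. apply (rad_le rho c); [easy | ]. intros n. unfold tail.
  destruct (Nat.ltb n k); [rewrite Cmod_0; apply Cmod_ge_0 | lra].
Qed.

Lemma rsum_tail_coef (c : nat -> C) k r n : 0 <= r ->
  rsum (fun j => Cmod (tail c k j) * r ^ j) n <=
  rsum (fun j => Cmod (c (k + j)%nat) * r ^ (k + j)) n.
Proof.
  intros Hr.
  assert (P : forall j, 0 <= Cmod (tail c k j) * r ^ j).
  { intros j. apply Rmult_le_pos; [apply Cmod_ge_0 | now apply pow_le]. }
  eapply Rle_trans; [apply (rsum_incr _ n (k + n) P); lia | ].
  rewrite rsum_add. rewrite (rsum_ext _ (fun _ => 0 * 0)).
  - rewrite rsum_scal, Rmult_0_l, Rplus_0_l. right. apply rsum_ext. intros j _.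
    unfold tail. now rewrite (proj2 (Nat.ltb_ge (k + j) k)) by lia.
  - intros j Hj. unfold tail. rewrite (proj2 (Nat.ltb_lt j k) Hj), Cmod_0. ring.
Qed.

(** Split F into a dilation and the difference. The tails of the difference are
    small by [tails_bounded]; the dilation has absolutely summable coefficients
    on the closed disc, so that its tails are uniformly small. *)
Lemma tails_vanish q c X : 1 < q -> mean_bdd q c X -> forall e, 0 < e ->
  exists M, forall m, (M <= m)%nat -> mean_bdd q (tail c m) e.
Proof.
  intros Hq HM e He. assert (Q : 0 < q) by lra. assert (Hc := proj1 HM).
  destruct (tails_bounded q Hq) as [K [HK TB]].
  assert (P2 := rpow_gt0 2 q Rlt_0_2).
  set (e1 := e / (2 * rpow 2 q * (K + 1))).
  assert (He1 : 0 < e1).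
  { apply Rdiv_lt_0_compat; [easy | ]. apply Rmult_lt_0_compat; lra. }
  destruct (dilations_converge q c X Hq HM e1 He1) as [rho [Hrho D]].
  set (e2 := rpow (e / (2 * rpow 2 q)) (/ q)).
  assert (He2' : 0 < e / (2 * rpow 2 q)) by (apply Rdiv_lt_0_compat; lra).
  assert (He2 : 0 < e2) by now apply rpow_gt0.
  destruct (rad_summable 1 c rho Hc ltac:(lra)) as [B HB].
  destruct (rsum_tail (fun k => Cmod (c k) * rho ^ k) B) with (e := e2) as [M HMt]; try easy.
  { intros k. apply Rmult_le_pos; [apply Cmod_ge_0 | apply pow_le; lra]. }
  exists M. intros m Hm.
  assert (T1 := TB _ _ D m).
  assert (T2 : mean_bdd q (tail (dilate rho c) m) (e / (2 * rpow 2 q))).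
  { assert (Rt : rad (/ rho) (tail (dilate rho c) m)) by (apply rad_tail; now apply rad_dilate_inv).
    assert (I1 := inv_gt1 rho Hrho).
    split.
    - intros x Hx. apply Rt. lra.
    - intros r Hr. apply Rle_trans with (avg (fun _ => rpow e2 q)).
      + apply avg_le; [apply (contR_cmean (/ rho)); [easy | lra | easy] | apply contR_const | ].
        intros t. apply rpow_le; [apply Cmod_ge_0 | | easy].
        apply (cser_abs_bound (fun n => tail (dilate rho c) m n * circle_pt r t ^ n)%C).
        * apply (cps_cser (/ rho)); [easy | rewrite Cmod_circle; lra].
        * intros n. eapply Rle_trans; [ | apply (HMt m n Hm)].
          eapply Rle_trans; [ | eapply Rle_trans; [apply (rsum_tail_coef (dilate rho c) m 1 n); lra | ]].
          -- apply rsum_le. intros k _. rewrite Cmod_mult, Cmod_pow, Cmod_circle by lra.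
             apply Rmult_le_compat_l; [apply Cmod_ge_0 | apply pow_incr; lra].
          -- right. apply rsum_ext. intros k _. unfold dilate.
             rewrite Cmod_mult, Cmod_R, pow1, Rabs_pos_eq by (apply pow_le; lra). ring.
      + rewrite avg_const. unfold e2. rewrite rpow_inv_K by lra. lra. }
  eapply mean_bdd_ext; [ | eapply mean_bdd_le; [exact (mean_bdd_plus q _ _ _ _ Q T1 T2) | ]].
  - intros n. cbv beta. unfold tail. destruct (Nat.ltb n m); ring.
  - assert (K * e1 <= e / (2 * rpow 2 q)).
    { apply Rle_trans with ((K + 1) * e1); [nra | ]. right. unfold e1. field. lra. }
    apply Rle_trans with (rpow 2 q * (e / (2 * rpow 2 q) + e / (2 * rpow 2 q))).
    + apply Rmult_le_compat_l; lra.
    + right. field. lra.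
Qed.

(** * Absolutely summable combinations of tails *)

Lemma contR_rsum (a : nat -> R -> R) n : (forall k, contR (a k)) -> contR (fun t => rsum (fun k => a k t) n).
Proof. intros H. induction n; simpl; [apply contR_const | now apply contR_plus]. Qed.

Lemma avg_rsum (a : nat -> R -> R) n : (forall k, contR (a k)) ->
  avg (fun t => rsum (fun k => a k t) n) = rsum (fun k => avg (a k)) n.
Proof.
  intros H. induction n; simpl; [apply avg_const | ].
  rewrite avg_plus by (try easy; now apply contR_rsum). now rewrite IHn.
Qed.

Lemma jensen_rsum (w x : nat -> R) S q n : 1 <= q -> 0 < S -> (forall k, 0 <= w k) ->
  (forall k, 0 <= x k) -> rsum w n <= S ->
  rpow (rsum (fun k => w k * x k) n) q <= rpow S (q - 1) * rsum (fun k => w k * rpow (x k) q) n.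
Proof.
  intros Hq HS Hw Hx HwS.
  set (y := rsum (fun k => w k * x k) n / S).
  assert (Hs0 : 0 <= rsum (fun k => w k * x k) n) by (apply rsum_ge0; intros; now apply Rmult_le_pos).
  assert (Hy : 0 <= y).
  { apply Rmult_le_pos; [easy | left; now apply Rinv_0_lt_compat]. }
  assert (E : rsum (fun k => w k * x k) n = S * y) by (unfold y; field; lra).
  rewrite E, rpow_mult_distr, (rpow_pred S q), (Rmult_comm S), Rmult_assoc by lra.
  apply Rmult_le_compat_l; [apply rpow_ge0 | ].
  apply Rle_trans with (rsum (fun k => q * rpow y (q - 1) * (w k * x k) + - ((q - 1) * rpow y q) * w k) n).
  - rewrite rsum_plus, !rsum_scal, E. rewrite (rpow_pred y q) by easy.
    assert (0 <= (q - 1) * (y * rpow y (q - 1))).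
    { apply Rmult_le_pos; [lra | ]. apply Rmult_le_pos; [easy | apply rpow_ge0]. }
    nra.
  - apply rsum_le. intros k _. assert (Y := young (x k) y q Hq (Hx k) Hy). specialize (Hw k). nra.
Qed.

Lemma cps_csum (a : nat -> nat -> C) M z : (forall m, rad 1 (a m)) -> Cmod z < 1 ->
  rad 1 (fun n => csum (fun m => a m n) M) /\
  cps (fun n => csum (fun m => a m n) M) z = csum (fun m => cps (a m) z) M.
Proof.
  intros Ha Hz. induction M.
  - split.
    + apply (rad_poly _ 0). easy.
    + simpl. now rewrite (cps_poly _ 0).
  - destruct IHM as [R0 E]. split.
    + apply (rad_plus 1 (fun n => csum (fun m => a m n) M) (a M)); easy.
    + simpl. rewrite <- E. now apply (cps_plus 1 (fun n => csum (fun m => a m n) M) (a M)).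
Qed.

(** By exchanging the summations, the function with coefficients
    (alpha_0 + ... + alpha_n) c_n is sum_m alpha_m T_m, with T_m the tail of c
    from m on, and Jensen's inequality with the weights |alpha_m| bounds its
    mean. The case distinction on alpha_m = 0 lets the bound be applied to
    sequences supported at high frequencies, where only the high tails have to
    be small. *)
Lemma weighted_bound q c (al : nat -> C) S Y : 1 < q -> rad 1 c -> 0 < S ->
  (forall n, rsum (fun m => Cmod (al m)) n <= S) -> 0 <= Y ->
  (forall m, al m = 0 \/ mean_bdd q (tail c m) Y) ->
  mean_bdd q (fun n => csum al (Datatypes.S n) * c n)%C (rpow 2 q * (rpow S q * Y)).
Proof.
  intros Hq Hc HS Hal HY HT. assert (Q : 0 < q) by lra.
  assert (P2 := rpow_gt0 2 q Rlt_0_2).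
  assert (Hrad : rad 1 (fun n => csum al (Datatypes.S n) * c n)%C).
  { apply (rad_bmul 1 _ S); [ | easy]. intros n. eapply Rle_trans; [apply Cmod_csum | apply Hal]. }
  split; [easy | ]. intros r Hr.
  destruct (rad_summable 1 c r Hc Hr) as [B HB].
  assert (HB0 : 0 <= B) by exact (HB 0%nat).
  apply le_all_eps. intros e He.
  set (eta := rpow (e / rpow 2 q) (/ q)).
  assert (He' : 0 < e / rpow 2 q) by now apply Rdiv_lt_0_compat.
  assert (Heta : 0 < eta) by now apply rpow_gt0.
  destruct (rsum_tail (fun m => Cmod (al m)) S) with (e := eta / (B + 1)) as [M HM]; try easy.
  { intros k; apply Cmod_ge_0. } { apply Rdiv_lt_0_compat; lra. }
  set (a := fun m n => (al m * tail c m n)%C).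
  assert (Ha : forall m, rad 1 (a m)) by (intros m; apply rad_scal; now apply rad_tail).
  (* Truncating alpha at M changes the function by at most eta on the circle, and leaves a
     finite sum of tails. *)
  set (d := fun n => csum (fun m => a m n) M).
  assert (Hd : rad 1 d) by (apply (cps_csum a M 0 Ha); rewrite Cmod_0; lra).
  assert (Ed : forall z, Cmod z < 1 -> cps d z = csum (fun m => al m * cps (tail c m) z)%C M).
  { intros z Hz. unfold d. rewrite (proj2 (cps_csum a M z Ha Hz)). apply csum_ext. intros m _.
    apply (cps_scal 1); [now apply rad_tail | easy]. }

  assert (Md : cmean q d r <= rpow S q * Y).
  { set (x := fun m t => Cmod (cps (tail c m) (circle_pt r t))).
    assert (Rx : forall m, contR (fun t => Cmod (al m) * rpow (x m t) q)).
    { intros m. apply contR_mult; [apply contR_const | ]. apply (contR_cmean 1); [now apply rad_tail | easy | easy]. }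
    apply Rle_trans with (avg (fun t => rpow S (q - 1) * rsum (fun m => Cmod (al m) * rpow (x m t) q) M)).
    - apply avg_le; [now apply (contR_cmean 1) | | ].
      + apply contR_mult; [apply contR_const | ]. now apply (contR_rsum (fun m t => Cmod (al m) * rpow (x m t) q)).
      + intros t. rewrite Ed by (rewrite Cmod_circle; lra).
        eapply Rle_trans; [ | apply jensen_rsum; try easy; try lra; intros; apply Cmod_ge_0].
        apply rpow_le; [apply Cmod_ge_0 | | easy].
        eapply Rle_trans; [apply Cmod_csum | ]. right. apply rsum_ext. intros m _. apply Cmod_mult.
    - rewrite avg_scal by now apply (contR_rsum (fun m t => Cmod (al m) * rpow (x m t) q)).
      rewrite (avg_rsum (fun m t => Cmod (al m) * rpow (x m t) q)) by easy.
      rewrite (rpow_pred S q), (Rmult_comm S), Rmult_assoc by lra.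
      apply Rmult_le_compat_l; [apply rpow_ge0 | ].
      apply Rle_trans with (rsum (fun m => Y * Cmod (al m)) M).
      + apply rsum_le. intros m _. rewrite avg_scal.
        * fold (cmean q (tail c m) r). destruct (HT m) as [E | [_ HTm]].
          -- rewrite E, Cmod_0. lra.
          -- rewrite Rmult_comm. apply Rmult_le_compat_r; [apply Cmod_ge_0 | now apply HTm].
        * apply (contR_cmean 1); [now apply rad_tail | easy | easy].
      + rewrite rsum_scal, Rmult_comm. apply Rmult_le_compat_r; [easy | apply Hal]. }

  assert (Rem : forall t, Cmod (cps (fun n => csum al (Datatypes.S n) * c n)%C (circle_pt r t)
       - cps d (circle_pt r t)) <= eta).
  { intros t. assert (Hm : Cmod (circle_pt r t) < 1) by (rewrite Cmod_circle; lra).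
    assert (Sr : cser (fun n => (csum al (Datatypes.S n) * c n * circle_pt r t ^ n) + (- (1)) * (d n * circle_pt r t ^ n))%C
      (cps (fun n => csum al (Datatypes.S n) * c n)%C (circle_pt r t) + (- (1)) * cps d (circle_pt r t))).
    { apply cser_plus; [ | apply cser_scal]; now apply (cps_cser 1). }
    replace (_ - _)%C with (cps (fun n => csum al (Datatypes.S n) * c n)%C (circle_pt r t) + (- (1)) * cps d (circle_pt r t))%C by ring.
    apply (cser_abs_bound _ _ _ Sr). intros n.
    apply Rle_trans with (rsum (fun k => eta / (B + 1) * (Cmod (c k) * r ^ k)) n).
    - apply rsum_le. intros k _.
      assert (Dk : Cmod (csum al (Datatypes.S k) * c k - d k) <= eta / (B + 1) * Cmod (c k)).
      { assert (Pe : 0 < eta / (B + 1)) by (apply Rdiv_lt_0_compat; lra).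
        destruct (Nat.le_gt_cases M k) as [Hk | Hk].
        - replace (d k) with (csum al M * c k)%C.
          + replace (Datatypes.S k) with (M + (Datatypes.S k - M))%nat by lia. rewrite csum_add.
            replace (_ - _)%C with (csum (fun j => al (M + j)%nat) (Datatypes.S k - M) * c k)%C by ring.
            rewrite Cmod_mult. apply Rmult_le_compat_r; [apply Cmod_ge_0 | ].
            eapply Rle_trans; [apply Cmod_csum | apply (HM M); lia].
          + unfold d, a. rewrite Cmult_comm, <- csum_scal. apply csum_ext. intros m Hm'.
            unfold tail. rewrite (proj2 (Nat.ltb_ge k m)) by lia. ring.
        - replace (d k) with (csum al (Datatypes.S k) * c k)%C.
          + replace (_ - _)%C with (RtoC 0) by ring. rewrite Cmod_0.
            apply Rmult_le_pos; [lra | apply Cmod_ge_0].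
          + unfold d, a. replace M with (Datatypes.S k + (M - Datatypes.S k))%nat by lia.
            rewrite csum_add.
            rewrite (csum_ext (fun j => al (Datatypes.S k + j)%nat * tail c (Datatypes.S k + j)%nat k)%C (fun _ => 0 * 0)%C).
            * rewrite csum_scal, Cmult_0_l, Cplus_0_r, Cmult_comm, <- csum_scal. apply csum_ext.
              intros m Hm'. unfold tail. rewrite (proj2 (Nat.ltb_ge k m)) by lia. ring.
            * intros j _. unfold tail. rewrite (proj2 (Nat.ltb_lt k (Datatypes.S k + j))) by lia. ring. }
      replace (csum al (Datatypes.S k) * c k * circle_pt r t ^ k + - (1) * (d k * circle_pt r t ^ k))%C
        with ((csum al (Datatypes.S k) * c k - d k) * circle_pt r t ^ k)%C by ring.
      rewrite Cmod_mult, Cmod_pow, Cmod_circle, <- Rmult_assoc by lra.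
      apply Rmult_le_compat_r; [apply pow_le; lra | easy].
    - rewrite rsum_scal. apply Rle_trans with (eta / (B + 1) * (B + 1)); [ | right; field; lra].
      apply Rmult_le_compat_l; [left; apply Rdiv_lt_0_compat; lra | ]. generalize (HB n). lra. }
  apply Rle_trans with (rpow 2 q * (cmean q d r + rpow eta q)).
  - assert (Rd := contR_cmean 1 q d r Hd Hr Q). unfold cmean.
    rewrite <- (avg_const (rpow eta q)), <- avg_plus, <- avg_scal by prove_cont.
    apply avg_le; [now apply (contR_cmean 1) | prove_cont | ]. intros t.
    eapply Rle_trans; [ | apply Rmult_le_compat_l; [lra | apply Rplus_le_compat_l, rpow_le; [apply Cmod_ge_0 | apply (Rem t) | easy]]].
    eapply Rle_trans; [ | now apply rpow_Cmod_plus]. right. do 2 f_equal. ring.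
  - unfold eta. rewrite rpow_inv_K by lra.
    replace (rpow 2 q * (rpow S q * Y) + e) with (rpow 2 q * (rpow S q * Y + e / rpow 2 q)) by (field; lra).
    apply Rmult_le_compat_l; lra.
Qed.

(** * Hardy norms and S^p in terms of Taylor coefficients *)

(** Coefficients of z F(z). *)
Definition shiftr (c : nat -> C) (n : nat) : C := match n with O => 0 | S m => c m end.

Lemma rad_shiftr c : rad 1 c -> rad 1 (shiftr c).
Proof.
  intros Hc r Hr. destruct (Hc r Hr) as [B HB].
  assert (0 <= B) by (eapply Rle_trans; [ | apply (HB 0%nat)]; simpl; generalize (Cmod_ge_0 (c 0%nat)); lra).
  exists B. intros [ | n]; simpl.
  - rewrite Cmod_0. lra.
  - assert (Cmod (c n) * (r * r ^ n) <= Cmod (c n) * r ^ n); [ | specialize (HB n); lra].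
    apply Rmult_le_compat_l; [apply Cmod_ge_0 | ].
    assert (0 <= r ^ n) by (apply pow_le; lra). nra.
Qed.

Lemma cps_shiftr c z : rad 1 c -> Cmod z < 1 -> cps (shiftr c) z = (z * cps c z)%C.
Proof.
  intros Hc Hz. rewrite (cps_shift 1) by (try easy; now apply rad_shiftr).
  simpl. rewrite (cps_ext (fun n => c n) c) by easy. ring.
Qed.

Lemma cmean_shiftr q c r : 0 < q -> rad 1 c -> 0 <= r < 1 -> cmean q (shiftr c) r = rpow r q * cmean q c r.
Proof.
  intros Hq Hc Hr. unfold cmean. rewrite <- avg_scal by now apply (contR_cmean 1).
  apply avg_ext. intros t. rewrite cps_shiftr by (try easy; rewrite Cmod_circle; lra).
  rewrite Cmod_mult, Cmod_circle, rpow_mult_distr by (try apply Cmod_ge_0; lra). easy.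
Qed.

Lemma cmean_ge0 q c r : 0 < q -> rad 1 c -> 0 <= r < 1 -> 0 <= cmean q c r.
Proof. intros Hq Hc Hr. apply avg_ge0; [now apply (contR_cmean 1) | intros; apply rpow_ge0]. Qed.

Lemma mean_bdd_shiftr q c X : 0 < q -> mean_bdd q c X -> mean_bdd q (shiftr c) X.
Proof.
  intros Hq [Hc HX]. split; [now apply rad_shiftr | ]. intros r Hr.
  rewrite cmean_shiftr by easy.
  assert (rpow r q <= 1) by (rewrite <- (rpow_one q); apply rpow_le; lra).
  specialize (HX r Hr). assert (P := cmean_ge0 q c r Hq Hc Hr). nra.
Qed.

(** Division by z costs at most the factor 2 on circles of radius at least 1/2,
    and the means increase with the radius. *)
Lemma mean_bdd_unshiftr q c X : 1 <= q -> rad 1 c -> mean_bdd q (shiftr c) X -> mean_bdd q c (rpow 2 q * X).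
Proof.
  intros Hq Hc [_ HX]. split; [easy | ]. intros r Hr. set (s := Rmax r (/ 2)).
  assert (Hs : / 2 <= s < 1) by (split; [apply Rmax_r | apply Rmax_lub_lt; lra]).
  assert (Hrs : r <= s) by apply Rmax_l.
  eapply Rle_trans; [apply (cmean_mono 1 q c r s Hc); lra | ].
  specialize (HX s ltac:(lra)). rewrite cmean_shiftr in HX by (try easy; lra).
  assert (P := cmean_ge0 q c s ltac:(lra) Hc ltac:(lra)).
  assert (1 <= rpow 2 q * rpow s q).
  { rewrite <- rpow_mult_distr by lra. rewrite <- (rpow_one q). apply rpow_le; lra. }
  assert (P2 := rpow_gt0 2 q Rlt_0_2).
  apply Rle_trans with (rpow 2 q * (rpow s q * cmean q c s)); [nra | ].
  apply Rmult_le_compat_l; lra.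
Qed.

Lemma integral_mean_cps p F c r : 0 <= r < 1 -> (forall z, Cmod z < 1 -> F z = cps c z) ->
  integral_mean p F r = rpow (cmean p c r) (/ p).
Proof.
  intros Hr HF. unfold integral_mean, cmean, avg. do 2 f_equal. apply RInt_ext. intros t _.
  rewrite HF by (rewrite Cmod_circle; lra). easy.
Qed.

Lemma hardy_norm_le p F c X : 0 < p -> rad 1 c -> (forall z, Cmod z < 1 -> F z = cps c z) -> 0 <= X ->
  (forall r, 0 < r < 1 -> cmean p c r <= X) ->
  Rbar_lt (hardy_norm p F) p_infty /\ 0 <= real (hardy_norm p F) <= rpow X (/ p).
Proof.
  intros Hp Hc HF HX H. unfold hardy_norm.
  set (E := fun y => exists r, 0 < r < 1 /\ y = integral_mean p F r).
  destruct (Lub_Rbar_correct E) as [U L].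
  assert (L1 : Rbar_le (Lub_Rbar E) (Finite (rpow X (/ p)))).
  { apply L. intros y [r [Hr ->]]. simpl. rewrite (integral_mean_cps p F c) by (try easy; lra).
    apply rpow_inv_le; try easy.
    - apply rpow_ge0.
    - rewrite rpow_inv_K by (try easy; apply cmean_ge0; try easy; lra). now apply H. }
  assert (U1 : Rbar_le (Finite 0) (Lub_Rbar E)).
  { apply Rbar_le_trans with (Finite (integral_mean p F (/ 2))).
    - simpl. apply rpow_ge0.
    - apply U. exists (/ 2). split; [lra | easy]. }
  destruct (Lub_Rbar E) as [x | | ]; simpl in *; try easy.
Qed.

Lemma hardy_norm_ge p F c : 0 < p -> rad 1 c -> (forall z, Cmod z < 1 -> F z = cps c z) ->
  Rbar_lt (hardy_norm p F) p_infty -> 0 <= real (hardy_norm p F) /\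
  forall r, 0 <= r < 1 -> 1 <= p -> cmean p c r <= rpow (real (hardy_norm p F)) p.
Proof.
  intros Hp Hc HF Hfin. unfold hardy_norm in *.
  set (E := fun y => exists r, 0 < r < 1 /\ y = integral_mean p F r) in *.
  destruct (Lub_Rbar_correct E) as [U _].
  assert (U1 : Rbar_le (Finite (integral_mean p F (/ 2))) (Lub_Rbar E)).
  { apply U. exists (/ 2). split; [lra | easy]. }
  assert (P0 : 0 <= integral_mean p F (/ 2)) by apply rpow_ge0.
  destruct (Lub_Rbar E) as [x | | ]; simpl in *; try easy.
  split; [lra | ].
  assert (M : forall r, 0 < r < 1 -> cmean p c r <= rpow x p).
  { intros r Hr. assert (B : integral_mean p F r <= x) by (apply (U (integral_mean p F r)); now exists r).
    rewrite (integral_mean_cps p F c) in B by (try easy; lra).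
    rewrite <- (rpow_inv_K (cmean p c r) p) by (try easy; apply cmean_ge0; try easy; lra).
    apply rpow_le; [apply rpow_ge0 | easy | easy]. }
  intros r Hr H1. destruct (Req_dec r 0) as [-> | N].
  - eapply Rle_trans; [apply (cmean_mono 1 p c 0 (/ 2) Hc); lra | apply M; lra].
  - apply M. lra.
Qed.

Lemma Hol_cps f c : rad 1 c -> (forall z, Cmod z < 1 -> f z = cps c z) ->
  Hol f /\ forall z, Cmod z < 1 -> C_derive f z = cps (deriv_coef c) z.
Proof.
  intros Hc Hf.
  assert (D : forall z, Cmod z < 1 -> cderiv f z (cps (deriv_coef c) z)).
  { intros z Hz. apply (cderiv_ext_loc (cps c) _ z _ (1 - Cmod z)); [lra | | now apply (cps_derive 1)].
    intros w Hw. symmetry. apply Hf.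
    replace w with ((w - z) + z)%C by ring. eapply Rle_lt_trans; [apply Cmod_triangle | lra]. }
  split.
  - intros z Hz. exists (cps (deriv_coef c) z). now apply cderiv_is_derive, D.
  - intros z Hz. now apply C_derive_unique, D.
Qed.

Lemma S_intro q f d X : 0 < q -> rad 1 d -> (forall z, Cmod z < 1 -> f z = cps d z) -> 0 <= X ->
  mean_bdd q (deriv_coef d) X -> fs_mem (S_space q) f /\ 0 <= fs_norm (S_space q) f <= Cmod (d O) + rpow X (/ q).
Proof.
  intros Hq Hd Hf HX [Rd HM]. destruct (Hol_cps f d Hd Hf) as [H1 H2].
  destruct (Hol_cps (C_derive f) (deriv_coef d) Rd H2) as [H3 _].
  destruct (hardy_norm_le q (C_derive f) (deriv_coef d) X Hq Rd H2 HX) as [N1 N2].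
  { intros r Hr. apply HM. lra. }
  split; [easy | ]. simpl. rewrite Hf by (rewrite Cmod_0; lra). rewrite cps_0.
  generalize (Cmod_ge_0 (d O)). lra.
Qed.

Lemma S_holC1 p f : fs_mem (S_space p) f -> holC1 f (C_derive f).
Proof.
  intros [H1 [H2 _]] z Hz. split.
  - apply cderiv_is_derive. apply C_derive_correct; [exact 0 | now apply H1].
  - apply (cderiv_cont _ _ (C_derive (C_derive f) z)). apply cderiv_is_derive.
    apply C_derive_correct; [exact 0 | now apply H2].
Qed.

Lemma S_elim p f d : 1 <= p -> fs_mem (S_space p) f -> rad 1 d -> (forall z, Cmod z < 1 -> f z = cps d z) ->
  0 <= real (hardy_norm p (C_derive f)) /\
  mean_bdd p (deriv_coef d) (rpow (real (hardy_norm p (C_derive f))) p).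
Proof.
  intros Hp [_ [_ H]] Hd Hf. destruct (Hol_cps f d Hd Hf) as [_ H2].
  destruct (hardy_norm_ge p (C_derive f) (deriv_coef d) ltac:(lra) (rad_deriv_coef 1 d Hd) H2 H) as [N1 N2].
  split; [easy | ]. split; [now apply rad_deriv_coef | ]. intros r Hr. now apply N2.
Qed.

Lemma avg_jensen u p : 1 <= p -> contR u -> (forall t, 0 <= u t) ->
  rpow (avg u) p <= avg (fun t => rpow (u t) p).
Proof.
  intros Hp Hu Hpos. set (y := avg u). assert (Hy : 0 <= y) by now apply avg_ge0.
  assert (Hr : contR (fun s => rpow (u s) p)) by (apply contR_rpow; try easy; lra).
  apply Rle_trans with (avg (fun s => (p * rpow y (p - 1)) * u s + - ((p - 1) * rpow y p))).
  - rewrite avg_plus, avg_scal, avg_const by prove_cont. fold y. rewrite (rpow_pred y p) by easy. lra.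
  - apply avg_le; [prove_cont | easy | ]. intros s. generalize (young (u s) y p Hp (Hpos s) Hy). lra.
Qed.

(** Hardy's inequality for f': the coefficient of z^k in f', divided by k + 1, is
    the coefficient of z^(k+1) in f. The constant is pi rounded up. *)
Lemma S_l1 p f : 1 <= p -> fs_mem (S_space p) f -> forall n,
  rsum (fun k => Cmod (taylor_coef f k)) n <= 4 * fs_norm (S_space p) f.
Proof.
  intros Hp Hf. destruct (holC1_taylor f _ (S_holC1 p f Hf)) as [Ra E].
  set (a := taylor_coef f) in *.
  destruct (S_elim p f a Hp Hf Ra E) as [N0 [Rd M]].
  set (N := real (hardy_norm p (C_derive f))) in *.
  assert (H : forall n, rsum (fun k => Cmod (deriv_coef a k) / INR (S k)) n <= PI * N).
  { apply hardy_inequality; [easy | ]. intros r Hr.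
    assert (Rc : contR (fun s => Cmod (cps (deriv_coef a) (circle_pt r s)))) by (apply contC_Cmod, (contC_cps 1); [easy | lra]).
    assert (J := avg_jensen _ p Hp Rc ltac:(intros; apply Cmod_ge_0)).
    specialize (M r ltac:(lra)). unfold cmean in M.
    rewrite <- (rpow_K_inv N p) by lra. apply rpow_inv_le; try lra.
    - apply avg_ge0; [easy | intros; apply Cmod_ge_0].
    - apply rpow_ge0. }
  assert (P4 := PI_4). assert (A0 := Cmod_ge_0 (a 0%nat)).
  assert (Nf : fs_norm (S_space p) f = Cmod (a 0%nat) + N).
  { simpl. rewrite E by (rewrite Cmod_0; lra). now rewrite cps_0. }
  rewrite Nf. intros n.
  apply Rle_trans with (rsum (fun k => Cmod (a k)) (S n)).
  { apply rsum_incr; [intros; apply Cmod_ge_0 | lia]. }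
  rewrite rsum_S. rewrite (rsum_ext _ (fun k => Cmod (deriv_coef a k) / INR (S k))).
  - specialize (H n). nra.
  - intros k _. unfold deriv_coef. rewrite Cmod_mult, Cmod_R, Rabs_pos_eq by apply pos_INR.
    field. apply not_0_INR. lia.
Qed.

(** * Diagonal extraction *)

Definition strictly_incr (phi : nat -> nat) : Prop := forall n, (phi n < phi (S n))%nat.

Lemma strictly_incr_mono phi n m : strictly_incr phi -> (n < m)%nat -> (phi n < phi m)%nat.
Proof. intros H Hnm. induction Hnm; [apply H | specialize (H m); lia]. Qed.

Lemma strictly_incr_ge phi n : strictly_incr phi -> (n <= phi n)%nat.
Proof. intros H. induction n; [lia | specialize (H n); lia]. Qed.

Lemma strictly_incr_comp phi psi : strictly_incr phi -> strictly_incr psi -> strictly_incr (fun n => phi (psi n)).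
Proof. intros H1 H2 n. apply strictly_incr_mono; [easy | apply H2]. Qed.

Definition conv_to (u : nat -> R) (l : R) : Prop :=
  forall e, 0 < e -> exists N, forall n, (N <= n)%nat -> Rabs (u n - l) < e.

Lemma bolzano_weierstrass (u : nat -> R) B : (forall n, Rabs (u n) <= B) ->
  exists psi, strictly_incr psi /\ exists l, conv_to (fun n => u (psi n)) l.
Proof.
  intros HB.
  destruct (Bolzano_Weierstrass u (fun c => - B <= c <= B) (compact_P3 (- B) B)) as [l Hl].
  { intros n. now apply Rabs_le_between. }
  assert (H : forall n N, exists p, (N <= p)%nat /\ Rabs (u p - l) < / INR (S n)).
  { intros n N. assert (P : 0 < / INR (S n)) by (apply Rinv_0_lt_compat, (lt_0_INR (S n)); lia).
    destruct (Hl (disc l (mkposreal _ P)) N) as [k [Hk1 Hk2]].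
    - exists (mkposreal _ P). intros x Hx. exact Hx.
    - exists k. split; [easy | exact Hk2]. }
  set (F := fun n N => proj1_sig (constructive_indefinite_description _ (H n N))).
  assert (HF : forall n N, (N <= F n N)%nat /\ Rabs (u (F n N) - l) < / INR (S n)).
  { intros n N. exact (proj2_sig (constructive_indefinite_description _ (H n N))). }
  set (psi := fix psi n := match n with O => F O O | S m => F (S m) (S (psi m)) end).
  exists psi. split.
  - intros n. simpl. generalize (proj1 (HF (S n) (S (psi n)))). lia.
  - exists l. intros e He.
    destruct (nfloor_ex (/ e)) as [N HN]; [left; now apply Rinv_0_lt_compat | ].
    exists N. intros n Hn.
    assert (Q : Rabs (u (psi n) - l) < / INR (S n)) by (destruct n; apply HF).
    eapply Rlt_le_trans; [apply Q | ].
    rewrite <- (Rinv_inv e). apply Rinv_le_contravar; [now apply Rinv_0_lt_compat | ].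
    apply Rle_trans with (INR (S N)); [rewrite S_INR; lra | apply le_INR; lia].
Qed.

(** [Phi (S m)] refines [Phi m] along a subsequence on which the m-th row converges;
    the diagonal is eventually a subsequence of each of them. *)
Lemma diagonal_extraction (x : nat -> nat -> R) B : (forall m n, Rabs (x m n) <= B) ->
  exists phi, strictly_incr phi /\ forall m, exists l, conv_to (fun n => x m (phi n)) l.
Proof.
  intros HB.
  set (E := fun m Phi => constructive_indefinite_description _
     (bolzano_weierstrass (fun n => x m (Phi n)) B (fun n => HB m (Phi n)))).
  set (Phi := fix Phi m := match m with O => fun n => n
     | S k => fun n => Phi k (proj1_sig (E k (Phi k)) n) end).
  assert (HS : forall m, strictly_incr (Phi m)).
  { induction m; [intros n; simpl; lia | ]. simpl.
    apply (strictly_incr_comp (Phi m)); [easy | ]. apply (proj2_sig (E m (Phi m))). }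
  assert (HC : forall m, exists l, conv_to (fun n => x m (Phi (S m) n)) l).
  { intros m. apply (proj2_sig (E m (Phi m))). }
  assert (HK : forall m j n, exists k, (n <= k)%nat /\ Phi (m + j)%nat n = Phi m k).
  { intros m j. induction j; intros n.
    - exists n. now rewrite Nat.add_0_r.
    - rewrite Nat.add_succ_r. simpl.
      destruct (IHj (proj1_sig (E (m + j)%nat (Phi (m + j)%nat)) n)) as [k [Hk1 Hk2]].
      exists k. split; [ | easy]. eapply Nat.le_trans; [ | apply Hk1]. apply strictly_incr_ge.
      apply (proj2_sig (E (m + j)%nat (Phi (m + j)%nat))). }
  exists (fun n => Phi n n). split.
  - intros n. simpl. apply strictly_incr_mono; [apply HS | ].
    assert (Q := strictly_incr_ge _ (S n) (proj1 (proj2_sig (E n (Phi n))))). lia.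
  - intros m. destruct (HC m) as [l Hl]. exists l. intros e He. destruct (Hl e He) as [N HN].
    exists (N + S m)%nat. intros n Hn.
    destruct (HK (S m) (n - S m)%nat n) as [k [Hk1 Hk2]].
    replace (S m + (n - S m))%nat with n in Hk2 by lia. rewrite Hk2. apply HN. lia.
Qed.

Definition cconv (u : nat -> C) (l : C) : Prop :=
  forall e, 0 < e -> exists N, forall n, (N <= n)%nat -> Cmod (u n - l) < e.

Lemma diagonal_extraction_C (x : nat -> nat -> C) B : (forall m n, Cmod (x m n) <= B) ->
  exists phi beta, strictly_incr phi /\ forall m, cconv (fun n => x m (phi n)) (beta m).
Proof.
  intros HB.
  destruct (diagonal_extraction (fun m n => Re (x m n)) B) as [p1 [S1 C1]].
  { intros m n. eapply Rle_trans; [apply Re_le_Cmod | apply HB]. }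
  destruct (diagonal_extraction (fun m n => Im (x m (p1 n))) B) as [p2 [S2 C2]].
  { intros m n. eapply Rle_trans; [apply Im_le_Cmod | apply HB]. }
  set (phi := fun n => p1 (p2 n)).
  assert (H : forall m, exists l, cconv (fun n => x m (phi n)) l).
  { intros m. destruct (C1 m) as [a Ha]. destruct (C2 m) as [b Hb]. exists (a, b).
    intros e He. destruct (Ha (e / 2)) as [N1 K1]; [lra | ]. destruct (Hb (e / 2)) as [N2 K2]; [lra | ].
    exists (N1 + N2)%nat. intros n Hn.
    assert (Q := strictly_incr_ge p2 n S2).
    specialize (K1 (p2 n) ltac:(lia)). specialize (K2 n ltac:(lia)).
    eapply Rle_lt_trans; [apply Cmod_le_ReIm | ].
    replace (Re (x m (phi n) - (a, b))) with (Re (x m (phi n)) - a) by (unfold Re; simpl; ring).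
    replace (Im (x m (phi n) - (a, b))) with (Im (x m (phi n)) - b) by (unfold Im; simpl; ring).
    unfold phi in *. lra. }
  exists phi, (fun m => proj1_sig (constructive_indefinite_description _ (H m))).
  split; [apply (strictly_incr_comp p1 p2 S1 S2) | ]. intros m.
  exact (proj2_sig (constructive_indefinite_description _ (H m))).
Qed.

Lemma cconv_rsum (x : nat -> nat -> C) (beta : nat -> C) : (forall m, cconv (x m) (beta m)) ->
  forall M e, 0 < e -> exists N, forall n, (N <= n)%nat -> rsum (fun m => Cmod (x m n - beta m)) M <= e.
Proof.
  intros H M. induction M; intros e He.
  - exists O. intros n _. simpl. lra.
  - destruct (IHM (e / 2)) as [N1 K1]; [lra | ]. destruct (H M (e / 2)) as [N2 K2]; [lra | ].
    exists (N1 + N2)%nat. intros n Hn. simpl. specialize (K1 n ltac:(lia)). specialize (K2 n ltac:(lia)). lra.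
Qed.

(** * Operators given by partial sums of weights *)

(** Coefficients of the operators of the theorem: [h] is the multiplier and [al]
    the sequence of weights attached to the argument. *)
Definition wcoef (h al : nat -> C) (n : nat) : C := (h n * csum al (S n))%C.

(** Coefficients of z F'(z). *)
Definition ncoef (h : nat -> C) (n : nat) : C := (RtoC (INR n) * h n)%C.

(** A multiplier [h] with z h' in H^q, where X0 bounds the q-th powers of the means
    of z h'. *)
Section Core.
Variables (q : R) (h : nat -> C) (X0 : R).
Hypothesis Hq : 1 < q.
Hypothesis Hh : rad 1 h.
Hypothesis HX0 : 0 <= X0.
Hypothesis HM : mean_bdd q (ncoef h) X0.

Lemma rad_wcoef al S : (forall n, rsum (fun m => Cmod (al m)) n <= S) -> rad 1 (wcoef h al).
Proof.
  intros H. apply (rad_le 1 (fun n => csum al (Datatypes.S n) * h n)%C).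
  - apply (rad_bmul 1 _ S); [ | easy]. intros n. eapply Rle_trans; [apply Cmod_csum | apply H].
  - intros n. unfold wcoef. rewrite Cmult_comm. lra.
Qed.

(** z times the derivative of the image has the coefficients
    n h_n (alpha_0 + ... + alpha_n), so [weighted_bound] applies to z h'. *)
Lemma core_mean_bdd al S Y : 0 < S -> 0 <= Y -> (forall n, rsum (fun m => Cmod (al m)) n <= S) ->
  (forall m, al m = 0 \/ mean_bdd q (tail (ncoef h) m) Y) ->
  mean_bdd q (deriv_coef (wcoef h al)) (rpow 2 q * (rpow 2 q * (rpow S q * Y))).
Proof.
  intros HS HY Hal HT.
  apply mean_bdd_unshiftr; [lra | apply rad_deriv_coef; now apply (rad_wcoef al S) | ].
  eapply mean_bdd_ext; [ | exact (weighted_bound q (ncoef h) al S Y Hq (proj1 HM) HS Hal HY HT)].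
  intros [ | n]; unfold shiftr, deriv_coef, wcoef, ncoef.
  - simpl. ring.
  - ring.
Qed.

Lemma core_bound : exists K, 0 <= K /\ forall al S f, 0 < S ->
  (forall n, rsum (fun m => Cmod (al m)) n <= S) ->
  (forall z, Cmod z < 1 -> f z = cps (wcoef h al) z) ->
  fs_mem (S_space q) f /\ fs_norm (S_space q) f <= K * S.
Proof.
  destruct (tails_bounded q Hq) as [K0 [HK0 TB]].
  assert (P2 := rpow_gt0 2 q Rlt_0_2). assert (PY : 0 <= K0 * X0) by now apply Rmult_le_pos.
  set (Z := rpow 2 q * (rpow 2 q * (K0 * X0))).
  assert (HZ : 0 <= Z) by (unfold Z; repeat apply Rmult_le_pos; lra).
  exists (Cmod (h O) + rpow Z (/ q)). split; [generalize (Cmod_ge_0 (h O)) (rpow_ge0 Z (/ q)); lra | ].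
  intros al S f HS Hal Hf.
  assert (M := core_mean_bdd al S (K0 * X0) HS PY Hal ltac:(intros m; right; now apply TB)).
  replace (rpow 2 q * (rpow 2 q * (rpow S q * (K0 * X0)))) with (rpow S q * Z) in M by (unfold Z; ring).
  assert (PS : 0 <= rpow S q * Z) by (apply Rmult_le_pos; [apply rpow_ge0 | easy]).
  destruct (S_intro q f (wcoef h al) _ ltac:(lra) (rad_wcoef al S Hal) Hf PS M) as [I1 [_ I2]].
  split; [easy | ]. eapply Rle_trans; [apply I2 | ].
  rewrite rpow_mult_distr, rpow_K_inv by (try easy; try apply rpow_ge0; lra).
  assert (Cmod (wcoef h al 0) <= Cmod (h O) * S).
  { unfold wcoef. rewrite Cmod_mult. apply Rmult_le_compat_l; [apply Cmod_ge_0 | ].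
    eapply Rle_trans; [apply Cmod_csum | apply Hal]. }
  lra.
Qed.

(** After the extraction, the difference D of the weights and of their limit is
    split at a frequency M: from M on the tails of z h' are small while D stays
    bounded in l^1, and below M the finitely many weights tend to 0. *)
Lemma core_compact (al : nat -> nat -> C) S : 0 < S ->
  (forall n m, rsum (fun k => Cmod (al n k)) m <= S) ->
  exists phi beta, strictly_incr phi /\ (forall m, rsum (fun k => Cmod (beta k)) m <= S) /\
  forall e, 0 < e -> exists N, forall n f, (N <= n)%nat ->
   (forall z, Cmod z < 1 -> f z = (cps (wcoef h (al (phi n))) z - cps (wcoef h beta) z)%C) ->
   0 <= fs_norm (S_space q) f <= e.
Proof.
  intros HS Hal. assert (Q : 0 < q) by lra.
  destruct (diagonal_extraction_C (fun m n => al n m) S) as [phi [beta [Hphi Hc]]].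
  { intros m n. eapply Rle_trans; [ | apply (Hal n (Datatypes.S m))]. simpl.
    generalize (rsum_ge0 (fun k => Cmod (al n k)) m ltac:(intros; apply Cmod_ge_0)). lra. }
  assert (Hsum := cconv_rsum _ _ Hc). cbv beta in Hsum.
  assert (Hbeta : forall m, rsum (fun k => Cmod (beta k)) m <= S).
  { intros m. apply le_all_eps. intros e He. destruct (Hsum m e He) as [N HN].
    specialize (HN N ltac:(lia)).
    apply Rle_trans with (rsum (fun k => Cmod (al (phi N) k) + Cmod (al (phi N) k - beta k)) m).
    - apply rsum_le. intros k _.
      replace (beta k) with (al (phi N) k + - (al (phi N) k - beta k))%C at 1 by ring.
      eapply Rle_trans; [apply Cmod_triangle | ]. rewrite Cmod_opp. lra.
    - rewrite rsum_plus. specialize (Hal (phi N) m). lra. }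
  exists phi, beta. split; [easy | ]. split; [easy | ]. intros e He.
  destruct (tails_bounded q Hq) as [K0 [HK0 TB]].
  assert (P2 := rpow_gt0 2 q Rlt_0_2). assert (PY : 0 <= K0 * X0) by now apply Rmult_le_pos.
  set (W := rpow (e / 2) q / (2 * rpow 2 q)).
  assert (HW : 0 < W) by (apply Rdiv_lt_0_compat; [apply rpow_gt0; lra | lra]).

  set (S2 := 2 * S). assert (HS2 : 0 < S2) by (unfold S2; lra).
  assert (PS2 := rpow_gt0 S2 q HS2).
  (* High frequencies: the tails from M on have means at most Y2. *)
  set (Y2 := W / (rpow 2 q * (rpow 2 q * rpow S2 q))).
  assert (HY2 : 0 < Y2) by (apply Rdiv_lt_0_compat; [easy | repeat apply Rmult_lt_0_compat; lra]).
  destruct (tails_vanish q (ncoef h) X0 Hq HM Y2 HY2) as [M TV].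

  set (Z1 := rpow 2 q * (rpow 2 q * (K0 * X0)) + 1).
  assert (HZ1 : 0 < Z1).
  { unfold Z1. assert (0 <= rpow 2 q * (rpow 2 q * (K0 * X0))) by (repeat apply Rmult_le_pos; lra). lra. }
  (* Low frequencies: the weights below M have l^1 norm at most S1. *)
  set (S1 := rpow (W / Z1) (/ q)).
  assert (HWZ : 0 < W / Z1) by now apply Rdiv_lt_0_compat.
  assert (HS1 : 0 < S1) by now apply rpow_gt0.
  destruct (Hsum M S1 HS1) as [N1 HN1].
  set (e3 := e / 2 / (Cmod (h O) + 1)).
  assert (Ph := Cmod_ge_0 (h O)).
  assert (He3 : 0 < e3) by (apply Rdiv_lt_0_compat; lra).
  destruct (Hc O e3 He3) as [N2 HN2].
  exists (N1 + N2)%nat. intros n f Hn Hf.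
  specialize (HN1 n ltac:(lia)). specialize (HN2 n ltac:(lia)). cbv beta in HN2.
  set (D := fun k => (al (phi n) k - beta k)%C).
  set (D1 := trunc D M). set (D2 := tail D M).
  assert (HD1 : forall m, rsum (fun k => Cmod (D1 k)) m <= S1).
  { intros m. apply Rle_trans with (rsum (fun k => Cmod (D1 k)) (M + m)).
    - apply rsum_incr; [intros; apply Cmod_ge_0 | lia].
    - rewrite rsum_add. rewrite (rsum_ext (fun k => Cmod (D1 (M + k)%nat)) (fun _ => 0 * 0)).
      + rewrite rsum_scal, Rmult_0_l, Rplus_0_r. eapply Rle_trans; [ | apply HN1].
        apply rsum_le. intros k Hk. unfold D1, trunc. rewrite (proj2 (Nat.ltb_lt k M) Hk). unfold D. lra.
      + intros k _. unfold D1. rewrite trunc_high by lia. rewrite Cmod_0. ring. }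
  assert (HDD : forall m, rsum (fun k => Cmod (D k)) m <= S2).
  { intros m. apply Rle_trans with (rsum (fun k => Cmod (al (phi n) k) + Cmod (beta k)) m).
    - apply rsum_le. intros k _. unfold D, Cminus. eapply Rle_trans; [apply Cmod_triangle | ].
      rewrite Cmod_opp. lra.
    - rewrite rsum_plus. specialize (Hal (phi n) m). specialize (Hbeta m). unfold S2. lra. }
  assert (HD2 : forall m, rsum (fun k => Cmod (D2 k)) m <= S2).
  { intros m. eapply Rle_trans; [ | apply (HDD m)]. apply rsum_le. intros k _. unfold D2, tail.
    destruct (Nat.ltb k M); [rewrite Cmod_0; apply Cmod_ge_0 | lra]. }
  assert (M1 := core_mean_bdd D1 S1 (K0 * X0) HS1 PY HD1 ltac:(intros m; right; now apply TB)).
  assert (M2 := core_mean_bdd D2 S2 Y2 HS2 (Rlt_le _ _ HY2) HD2).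
  assert (M2' : mean_bdd q (deriv_coef (wcoef h D2)) W).
  { eapply mean_bdd_le; [apply M2 | ].
    - intros m. unfold D2, tail. destruct (Nat.ltb m M) eqn:E; [now left | right].
      apply TV. now apply Nat.ltb_ge.
    - right. unfold Y2. field. repeat split; lra. }
  assert (M1' : mean_bdd q (deriv_coef (wcoef h D1)) W).
  { eapply mean_bdd_le; [apply M1 | ]. unfold S1. rewrite rpow_inv_K by lra.
    apply Rle_trans with (W / Z1 * (rpow 2 q * (rpow 2 q * (K0 * X0)))); [right; ring | ].
    apply Rle_trans with (W / Z1 * Z1); [ | right; field; lra].
    apply Rmult_le_compat_l; [lra | unfold Z1; lra]. }
  assert (MD : mean_bdd q (deriv_coef (wcoef h D)) (rpow (e / 2) q)).
  { eapply mean_bdd_ext; [ | eapply mean_bdd_le; [exact (mean_bdd_plus q _ _ _ _ Q M1' M2') | ]].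
    - intros k. unfold deriv_coef, wcoef.
      rewrite (csum_ext D (fun j => D1 j + D2 j)%C).
      + rewrite csum_plus. ring.
      + intros j _. unfold D1, D2, trunc, tail. destruct (Nat.ltb j M); ring.
    - right. unfold W. field. lra. }
  assert (Rw : rad 1 (wcoef h D)) by now apply (rad_wcoef D S2).
  assert (Hf' : forall z, Cmod z < 1 -> f z = cps (wcoef h D) z).
  { intros z Hz. rewrite Hf by easy.
    assert (Ra : rad 1 (wcoef h (al (phi n)))) by (apply (rad_wcoef _ S); apply Hal).
    assert (Rb : rad 1 (wcoef h beta)) by (now apply (rad_wcoef _ S)).
    rewrite (cps_ext (wcoef h D) (fun k => wcoef h (al (phi n)) k + - (1) * wcoef h beta k)%C).
    - rewrite (cps_plus 1), (cps_scal 1) by (try easy; now apply rad_scal). ring.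
    - intros k. unfold wcoef, D.
      rewrite (csum_ext _ (fun j => al (phi n) j + - (1) * beta j)%C) by (intros; ring).
      rewrite csum_plus, csum_scal. ring. }
  destruct (S_intro q f (wcoef h D) _ Q Rw Hf' (rpow_ge0 _ _) MD) as [_ [I1 I2]].
  split; [easy | ]. eapply Rle_trans; [apply I2 | ]. rewrite rpow_K_inv by lra.
  assert (Cmod (wcoef h D 0) <= e / 2); [ | lra].
  unfold wcoef. rewrite Cmod_mult. simpl. rewrite Cplus_0_l.
  apply Rle_trans with ((Cmod (h O) + 1) * e3); [ | right; unfold e3; field; lra].
  apply Rmult_le_compat; try apply Cmod_ge_0; [lra | unfold D; lra].
Qed.
End Core.

Lemma S_taylor p f : fs_mem (S_space p) f -> rad 1 (taylor_coef f) /\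
  forall z, Cmod z < 1 -> f z = cps (taylor_coef f) z.
Proof. intros Hf. exact (holC1_taylor f _ (S_holC1 p f Hf)). Qed.

Lemma S_norm_ge0 p f : 1 <= p -> fs_mem (S_space p) f -> 0 <= fs_norm (S_space p) f.
Proof.
  intros Hp Hf. destruct (S_taylor p f Hf) as [Ra E].
  destruct (S_elim p f _ Hp Hf Ra E) as [N _]. simpl. generalize (Cmod_ge_0 (f 0)). lra.
Qed.

Lemma taylor_plus p f g n : fs_mem (S_space p) f -> fs_mem (S_space p) g ->
  taylor_coef (fun w => f w + g w)%C n = (taylor_coef f n + taylor_coef g n)%C.
Proof.
  intros Hf Hg. destruct (S_taylor p f Hf) as [Ra E]. destruct (S_taylor p g Hg) as [Rb F].
  apply (taylor_cps _ (fun n => taylor_coef f n + taylor_coef g n)%C 1); [lra | now apply rad_plus | ].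
  intros z Hz. rewrite (cps_plus 1), E, F by easy. easy.
Qed.

Lemma taylor_scal p f k n : fs_mem (S_space p) f ->
  taylor_coef (fun w => k * f w)%C n = (k * taylor_coef f n)%C.
Proof.
  intros Hf. destruct (S_taylor p f Hf) as [Ra E].
  apply (taylor_cps _ (fun n => k * taylor_coef f n)%C 1); [lra | now apply rad_scal | ].
  intros z Hz. rewrite (cps_scal 1), E by easy. easy.
Qed.

Lemma S_mem_plus p f g : 1 <= p -> fs_mem (S_space p) f -> fs_mem (S_space p) g ->
  fs_mem (S_space p) (fun w => f w + g w)%C.
Proof.
  intros Hp Hf Hg. destruct (S_taylor p f Hf) as [Ra E]. destruct (S_taylor p g Hg) as [Rb F].
  destruct (S_elim p f _ Hp Hf Ra E) as [_ M1]. destruct (S_elim p g _ Hp Hg Rb F) as [_ M2].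
  assert (Pp : 0 < p) by lra. assert (M := mean_bdd_plus p _ _ _ _ Pp M1 M2).
  refine (proj1 (S_intro p _ (fun n => taylor_coef f n + taylor_coef g n)%C _ Pp _ _ _ (mean_bdd_ext p _ _ _ _ M))).
  - now apply rad_plus.
  - intros z Hz. rewrite (cps_plus 1), E, F by easy. easy.
  - apply Rmult_le_pos; [apply rpow_ge0 | ].
    generalize (rpow_ge0 (real (hardy_norm p (C_derive f))) p) (rpow_ge0 (real (hardy_norm p (C_derive g))) p). lra.
  - intros n. unfold deriv_coef. ring.
Qed.

Lemma S_mem_scal p k f : 1 <= p -> fs_mem (S_space p) f -> fs_mem (S_space p) (fun w => k * f w)%C.
Proof.
  intros Hp Hf. destruct (S_taylor p f Hf) as [Ra E].
  destruct (S_elim p f _ Hp Hf Ra E) as [_ M1].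
  assert (Pp : 0 < p) by lra. assert (M := mean_bdd_scal p k _ _ Pp M1).
  refine (proj1 (S_intro p _ (fun n => k * taylor_coef f n)%C _ Pp _ _ _ (mean_bdd_ext p _ _ _ _ M))).
  - now apply rad_scal.
  - intros z Hz. rewrite (cps_scal 1), E by easy. easy.
  - apply Rmult_le_pos; apply rpow_ge0.
  - intros n. unfold deriv_coef. ring.
Qed.

(** In [A f] only linearity and the l^1 bound matter, so that the Rhaly and the
    Hilbert operator can be treated at once. *)
Lemma weighted_operator p q h X0 C0 (A : (C -> C) -> nat -> C) (T : (C -> C) -> C -> C) :
  1 <= p -> 1 < q -> rad 1 h -> 0 <= X0 -> mean_bdd q (ncoef h) X0 -> 0 <= C0 ->
  (forall f, fs_mem (S_space p) f -> forall z, Cmod z < 1 -> T f z = cps (wcoef h (A f)) z) ->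
  (forall f, fs_mem (S_space p) f -> forall n,
     rsum (fun k => Cmod (A f k)) n <= C0 * fs_norm (S_space p) f) ->
  (forall f g, fs_mem (S_space p) f -> fs_mem (S_space p) g -> forall n,
     A (fun w => f w + g w)%C n = (A f n + A g n)%C) ->
  (forall k f, fs_mem (S_space p) f -> forall n, A (fun w => k * f w)%C n = (k * A f n)%C) ->
  bounded_op (S_space p) (S_space q) T /\ compact_op (S_space p) (S_space q) T.
Proof.
  intros Hp Hq Hh HX0 HM HC0 HT HA HAp HAs.
  destruct (core_bound q h X0 Hq Hh HX0 HM) as [K [HK CB]].
  assert (RW : forall f, fs_mem (S_space p) f -> rad 1 (wcoef h (A f))).
  { intros f Hf. apply (rad_wcoef h Hh _ (C0 * fs_norm (S_space p) f)). now apply HA. }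
  assert (CB' : forall f e, fs_mem (S_space p) f -> 0 < e ->
     fs_mem (S_space q) (T f) /\ fs_norm (S_space q) (T f) <= K * (C0 * fs_norm (S_space p) f + e)).
  { intros f e Hf He. assert (N := S_norm_ge0 p f Hp Hf).
    apply (CB (A f)); [ | | now apply HT].
    - assert (0 <= C0 * fs_norm (S_space p) f) by now apply Rmult_le_pos. lra.
    - intros n. specialize (HA f Hf n). lra. }
  assert (Lin : linear_op (S_space p) (S_space q) T).
  { split; [ | split].
    - intros f Hf. now apply (CB' f 1 Hf Rlt_0_1).
    - intros f g Hf Hg z Hz. rewrite !HT by (try easy; now apply S_mem_plus).
      rewrite <- (cps_plus 1) by (try easy; now apply RW). apply cps_ext. intros n. unfold wcoef.
      rewrite (csum_ext _ (fun j => A f j + A g j)%C) by (intros; now apply HAp).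
      rewrite csum_plus. ring.
    - intros k f Hf z Hz. rewrite !HT by (try easy; now apply S_mem_scal).
      rewrite <- (cps_scal 1) by (try easy; now apply RW). apply cps_ext. intros n. unfold wcoef.
      rewrite (csum_ext _ (fun j => k * A f j)%C) by (intros; now apply HAs).
      rewrite csum_scal. ring. }
  split; (split; [easy | ]).
  - exists (K * C0). intros f Hf. apply le_all_eps. intros e He.
    eapply Rle_trans; [apply (CB' f (e / (K + 1)) Hf); apply Rdiv_lt_0_compat; lra | ].
    rewrite Rmult_plus_distr_l, Rmult_assoc. apply Rplus_le_compat_l.
    apply Rle_trans with ((K + 1) * (e / (K + 1))); [ | right; field; lra].
    apply Rmult_le_compat_r; [left; apply Rdiv_lt_0_compat | ]; lra.
  - intros u M Hu.
    set (S := C0 * Rabs M + 1).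
    assert (HS : 0 < S).
    { unfold S. assert (0 <= C0 * Rabs M) by (apply Rmult_le_pos; [easy | apply Rabs_pos]). lra. }
    assert (Hal : forall n m, rsum (fun k => Cmod (A (u n) k)) m <= S).
    { intros n m. destruct (Hu n) as [U1 U2]. eapply Rle_trans; [now apply HA | ].
      assert (C0 * fs_norm (S_space p) (u n) <= C0 * Rabs M).
      { apply Rmult_le_compat_l; [easy | ]. generalize (Rle_abs M). lra. }
      unfold S. lra. }
    destruct (core_compact q h X0 Hq Hh HX0 HM (fun n => A (u n)) S HS Hal) as [phi [beta [Hphi [Hbeta Hlim]]]].
    exists phi, (cps (wcoef h beta)). split; [exact Hphi | ]. split.
    + now apply (CB beta S).
    + apply is_lim_seq_spec. intros e. assert (E2 : 0 < e / 2) by (generalize (cond_pos e); lra).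
      destruct (Hlim (e / 2) E2) as [N HN]. exists N. intros n Hn.
      destruct (HN n (fun z => T (u (phi n)) z - cps (wcoef h beta) z)%C Hn) as [I1 I2].
      * intros z Hz. rewrite HT; [easy | apply Hu | easy].
      * rewrite Rminus_0_r, Rabs_pos_eq by easy. generalize (cond_pos e). lra.
Qed.

(** * The weights of the Hilbert operator *)

Lemma is_pseries_cser (eta : nat -> C) (z l : C) : is_pseries eta z l ->
  cser (fun n => eta n * z ^ n)%C l.
Proof.
  intros H e He. assert (E2 : 0 < e / 2) by lra.
  assert (H' := proj1 (filterlim_locally _ _) H (mkposreal _ E2)).
  destruct H' as [N HN]. exists (S N). intros n Hn. destruct n as [ | n]; [lia | ].
  destruct (HN n ltac:(lia)) as [B1 B2].
  assert (E : sum_n (fun k => z ^ k * eta k)%C n = csum (fun n => eta n * z ^ n)%C (S n)).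
  { rewrite sum_n_csum. apply csum_ext. intros k _. apply Cmult_comm. }
  change (Rabs (Re (sum_n (fun k => z ^ k * eta k)%C n) - Re l) < e / 2) in B1.
  change (Rabs (Im (sum_n (fun k => z ^ k * eta k)%C n) - Im l) < e / 2) in B2.
  rewrite E in B1, B2.
  eapply Rle_lt_trans; [apply Cmod_le_ReIm | ].
  assert (F1 : Re (csum (fun n => eta n * z ^ n)%C (S n) - l) = Re (csum (fun n => eta n * z ^ n)%C (S n)) - Re l) by easy.
  assert (F2 : Im (csum (fun n => eta n * z ^ n)%C (S n) - l) = Im (csum (fun n => eta n * z ^ n)%C (S n)) - Im l) by easy.
  rewrite F1, F2. lra.
Qed.

Lemma cser_terms_bounded a l : cser a l -> exists B, forall n, Cmod (a n) <= B.
Proof.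
  intros H. destruct (H 1 Rlt_0_1) as [N HN].
  assert (P : forall k, 0 <= Cmod (a k)) by (intros; apply Cmod_ge_0).
  exists (rsum (fun k => Cmod (a k)) N + 2). intros n. destruct (Nat.le_gt_cases N n) as [Hn | Hn].
  - assert (Q1 := HN n Hn). assert (Q2 := HN (S n) ltac:(lia)).
    replace (a n) with ((csum a (S n) - l) + - (csum a n - l))%C by (simpl; ring).
    eapply Rle_trans; [apply Cmod_triangle | ]. rewrite Cmod_opp.
    generalize (rsum_ge0 (fun k => Cmod (a k)) N P). lra.
  - assert (Q := rsum_incr (fun k => Cmod (a k)) (S n) N P ltac:(lia)). simpl in Q.
    generalize (rsum_ge0 (fun k => Cmod (a k)) n P). lra.
Qed.

Lemma rad_of_convergence (c : nat -> C) : (forall z, Cmod z < 1 -> exists l, cser (fun n => c n * z ^ n)%C l) ->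
  rad 1 c.
Proof.
  intros H r Hr. destruct (H (RtoC r)) as [l Hl].
  { rewrite Cmod_R, Rabs_pos_eq; lra. }
  destruct (cser_terms_bounded _ _ Hl) as [B HB]. exists B. intros n.
  specialize (HB n). rewrite Cmod_mult, Cmod_pow, Cmod_R, Rabs_pos_eq in HB by lra. easy.
Qed.

(** For n >= 1 this is n times the entry 1/(n+k+1) of the Hilbert matrix; for n = 0
    the entry itself, since the factor 0 would lose it. The factor n is
    compensated in [hil_symbol]. *)
Definition omega (n k : nat) : R :=
  match n with O => / INR (S k) | S _ => INR n / INR (n + k + 1) end.

Lemma omega_bounds n k : 0 <= omega n k <= 1.
Proof.
  unfold omega. destruct n as [ | n].
  - assert (1 <= INR (S k)) by (rewrite S_INR; generalize (pos_INR k); lra).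
    split; [left; apply Rinv_0_lt_compat; lra | ]. rewrite <- Rinv_1. apply Rinv_le_contravar; lra.
  - rewrite !plus_INR. assert (P := pos_INR k). assert (Q := pos_INR (S n)).
    change (INR 1) with 1. split.
    + apply Rmult_le_pos; [easy | left; apply Rinv_0_lt_compat; lra].
    + apply Rmult_le_reg_r with (INR (S n) + INR k + 1); [lra | ]. field_simplify; lra.
Qed.

Lemma omega_incr n k : omega (S n) k <= omega (S (S n)) k.
Proof.
  unfold omega. rewrite !plus_INR. change (INR 1) with 1. rewrite !S_INR.
  assert (P := pos_INR k). assert (Q := pos_INR n).
  set (x := INR n) in *. set (y := INR k) in *.
  replace ((x + 1 + 1) / (x + 1 + 1 + y + 1)) with
    ((x + 1) / (x + 1 + y + 1) + (y + 1) / ((x + 1 + y + 1) * (x + 1 + 1 + y + 1))) by (field; lra).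
  assert (0 < (y + 1) / ((x + 1 + y + 1) * (x + 1 + 1 + y + 1))).
  { apply Rdiv_lt_0_compat; [lra | apply Rmult_lt_0_compat; lra]. }
  lra.
Qed.

Definition omega_diff (n k : nat) : R := match n with O => omega O k | S m => omega (S m) k - omega m k end.

(** From n = 1 on, omega(n,k) increases in n and stays in [0,1], so that its
    increments telescope; the first two terms are at most 1 each. *)
Lemma omega_diff_sum k N : rsum (fun n => Rabs (omega_diff n k)) N <= 3.
Proof.
  eapply Rle_trans; [apply (rsum_incr _ N (S (S N))); [intros; apply Rabs_pos | lia] | ].
  assert (E : forall M, rsum (fun n => Rabs (omega_diff n k)) (S (S M)) =
    Rabs (omega 0 k) + Rabs (omega 1 k - omega 0 k) + (omega (S M) k - omega 1 k)).
  { intros M. induction M.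
    - simpl. ring.
    - change (rsum (fun n => Rabs (omega_diff n k)) (S (S M)) + Rabs (omega_diff (S (S M)) k) =
        Rabs (omega 0 k) + Rabs (omega 1 k - omega 0 k) + (omega (S (S M)) k - omega 1 k)).
      rewrite IHM. change (omega_diff (S (S M)) k) with (omega (S (S M)) k - omega (S M) k).
      rewrite (Rabs_pos_eq (omega (S (S M)) k - omega (S M) k)) by (generalize (omega_incr M k); lra). ring. }
  rewrite E. assert (B0 := omega_bounds 0 k). assert (B1 := omega_bounds 1 k).
  assert (B2 := omega_bounds (S N) k). rewrite Rabs_pos_eq by lra.
  assert (Rabs (omega 1 k - omega 0 k) <= 1) by (apply Rabs_le; lra). lra.
Qed.

(** Schur's test for kernels acting on l^1. *)
Lemma l1_kernel (a : nat -> C) (w : nat -> nat -> R) L B : (forall n, rsum (fun k => Cmod (a k)) n <= L) ->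
  (forall k N, rsum (fun n => Rabs (w n k)) N <= B) ->
  (forall n, cser (fun k => a k * RtoC (w n k))%C (C_series (fun k => a k * RtoC (w n k))%C)) /\
  forall N, rsum (fun n => Cmod (C_series (fun k => a k * RtoC (w n k))%C)) N <= B * L.
Proof.
  intros HL HB.
  assert (HB0 : 0 <= B) by (eapply Rle_trans; [ | apply (HB O O)]; simpl; lra).
  assert (Hw : forall n k, Rabs (w n k) <= B).
  { intros n k. eapply Rle_trans; [ | apply (HB k (S n))]. simpl.
    generalize (rsum_ge0 (fun n => Rabs (w n k)) n ltac:(intros; apply Rabs_pos)). lra. }
  assert (Hs : forall n, cser (fun k => a k * RtoC (w n k))%C (C_series (fun k => a k * RtoC (w n k))%C)).
  { intros n. apply (cser_exists _ (B * L)). intros m.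
    eapply Rle_trans; [ | apply Rmult_le_compat_l; [easy | apply (HL m)]].
    rewrite <- rsum_scal. apply rsum_le. intros k _. rewrite Cmod_mult, Cmod_R, Rmult_comm.
    apply Rmult_le_compat_r; [apply Cmod_ge_0 | apply Hw]. }
  split; [easy | ]. intros N. apply le_all_eps. intros e He.
  set (e' := e / (B + 1) / (INR N + 1)). assert (PN := pos_INR N).
  assert (He' : 0 < e') by (repeat apply Rdiv_lt_0_compat; lra).
  destruct (rsum_tail (fun k => Cmod (a k)) L (fun k => Cmod_ge_0 (a k)) HL e' He') as [M HM].
  apply Rle_trans with (rsum (fun n => rsum (fun k => Cmod (a k) * Rabs (w n k)) M + B * e') N).
  - apply rsum_le. intros n _.
    replace (C_series _) with (csum (fun k => a k * RtoC (w n k)) M +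
      (C_series (fun k => a k * RtoC (w n k)) - csum (fun k => a k * RtoC (w n k)) M))%C by ring.
    eapply Rle_trans; [apply Cmod_triangle | ]. apply Rplus_le_compat.
    + eapply Rle_trans; [apply Cmod_csum | ]. right. apply rsum_ext. intros k _.
      now rewrite Cmod_mult, Cmod_R.
    + apply (cser_abs_bound _ _ _ (cser_shift _ _ M (Hs n))). intros m.
      eapply Rle_trans; [ | apply Rmult_le_compat_l; [easy | apply (HM M m); lia]].
      rewrite <- rsum_scal. apply rsum_le. intros k _. rewrite Cmod_mult, Cmod_R, Rmult_comm.
      apply Rmult_le_compat_r; [apply Cmod_ge_0 | apply Hw].
  - rewrite rsum_plus, rsum_swap. apply Rplus_le_compat.
    + eapply Rle_trans; [ | apply Rmult_le_compat_l; [easy | apply (HL M)]].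
      rewrite <- rsum_scal. apply rsum_le. intros k _. rewrite rsum_scal, Rmult_comm.
      apply Rmult_le_compat_r; [apply Cmod_ge_0 | apply HB].
    + rewrite (rsum_ext _ (fun n => B * e' * 1)) by (intros; ring). rewrite rsum_scal.
      assert (E1 : rsum (fun _ => 1) N = INR N).
      { clear. induction N; [easy | ]. simpl rsum. rewrite IHN, S_INR. ring. }
      rewrite E1. apply Rle_trans with ((B + 1) * e' * (INR N + 1)).
      * apply Rmult_le_compat; try nra.
      * right. unfold e'. field. lra.
Qed.

(** By telescoping, the partial sums of these weights are
    sum_k a_k omega(n,k). *)
Definition hil_weight (f : C -> C) (n : nat) : C :=
  C_series (fun k => taylor_coef f k * RtoC (omega_diff n k))%C.

Definition hil_symbol (eta : nat -> C) (n : nat) : C :=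
  match n with O => eta 1%nat | S _ => (RtoC (INR (n + 1)) * eta (n + 1)%nat / RtoC (INR n))%C end.

Section Hilbert.
Variables (p : R) (f : C -> C).
Hypothesis Hp : 1 <= p.
Hypothesis Hf : fs_mem (S_space p) f.

Let L := 4 * fs_norm (S_space p) f.

Lemma hil_weight_l1 n : rsum (fun k => Cmod (hil_weight f k)) n <= 12 * fs_norm (S_space p) f.
Proof.
  eapply Rle_trans; [apply (l1_kernel (taylor_coef f) omega_diff L 3 (S_l1 p f Hp Hf) omega_diff_sum) | ].
  unfold L. lra.
Qed.

Lemma hil_weight_cser n :
  cser (fun k => taylor_coef f k * RtoC (omega_diff n k))%C (hil_weight f n).
Proof. apply (l1_kernel (taylor_coef f) omega_diff L 3 (S_l1 p f Hp Hf) omega_diff_sum). Qed.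

Lemma hil_weight_sum n :
  cser (fun k => taylor_coef f k * RtoC (omega n k))%C (csum (hil_weight f) (S n)).
Proof.
  induction n.
  - simpl. rewrite Cplus_0_l. exact (hil_weight_cser 0).
  - change (csum (hil_weight f) (S (S n))) with (csum (hil_weight f) (S n) + hil_weight f (S n))%C.
    apply (cser_ext (fun k => taylor_coef f k * RtoC (omega n k) + taylor_coef f k * RtoC (omega_diff (S n) k))%C).
    + intros k. change (omega_diff (S n) k) with (omega (S n) k - omega n k). rewrite RtoC_minus. ring.
    + apply cser_plus; [easy | apply hil_weight_cser].
Qed.

Lemma gen_Hilbert_weights eta z : gen_Hilbert eta f z = cps (wcoef (hil_symbol eta) (hil_weight f)) z.
Proof.
  unfold gen_Hilbert, cps. apply C_series_ext. intros n. f_equal.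
  assert (HS := hil_weight_sum n). unfold wcoef. destruct n as [ | n].
  - rewrite (cser_C_series (fun k => taylor_coef f k / RtoC (INR (0 + k + 1)))%C (csum (hil_weight f) 1)).
    + change (0 + 1)%nat with 1%nat. change (INR 1) with 1. unfold hil_symbol. ring.
    + eapply cser_ext; [ | exact HS]. intros k. unfold omega.
      rewrite RtoC_inv by (apply not_0_INR; lia). replace (0 + k + 1)%nat with (S k) by lia. easy.
  - assert (Hn : RtoC (INR (S n)) <> 0).
    { intros E. apply RtoC_inj in E. apply not_0_INR in E; [easy | lia]. }
    rewrite (cser_C_series (fun k => taylor_coef f k / RtoC (INR (S n + k + 1)))%C
      (/ RtoC (INR (S n)) * csum (hil_weight f) (S (S n)))%C).
    + unfold hil_symbol. field. easy.
    + apply (cser_ext (fun k => / RtoC (INR (S n)) * (taylor_coef f k * RtoC (omega (S n) k)))%C).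
      * intros k. unfold omega. assert (INR (S n + k + 1) <> 0) by (apply not_0_INR; lia).
        unfold Rdiv. rewrite RtoC_mult, RtoC_inv by easy. field. split; [ | easy].
        intros E. now apply RtoC_inj in E.
      * apply cser_scal. exact HS.
Qed.
End Hilbert.

Lemma rad_hil_symbol eta : rad 1 eta -> rad 1 (hil_symbol eta).
Proof.
  intros H. apply (rad_le 1 (fun n => 2 * eta (S n))%C).
  - apply rad_scal. now apply rad_shift.
  - intros [ | n]; unfold hil_symbol.
    + rewrite Cmod_mult, Cmod_R, Rabs_pos_eq by lra. generalize (Cmod_ge_0 (eta 1%nat)). lra.
    + replace (S n + 1)%nat with (S (S n)) by lia.
      assert (P := pos_INR n).
      rewrite Cmod_div by (intros E; apply RtoC_inj in E; rewrite S_INR in E; lra).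
      rewrite !Cmod_mult, !Cmod_R, !Rabs_pos_eq by (try apply pos_INR; lra).
      rewrite !S_INR. set (E := Cmod _). assert (0 <= E) by apply Cmod_ge_0.
      apply Rmult_le_reg_r with (INR n + 1); [lra | ]. field_simplify; [nra | lra].
Qed.

(** * Necessity and sufficiency of the condition on the symbol *)

Lemma fs_mem_one p : 1 <= p -> fs_mem (S_space p) (fun _ => RtoC 1).
Proof.
  intros Hp. refine (proj1 (S_intro p _ (delta0 1) 0 _ _ _ _ _)); try lra.
  - apply (rad_poly _ 1). intros [ | n] Hn; [lia | easy].
  - intros z _. now rewrite cps_delta0.
  - split.
    + apply (rad_poly _ 0). intros n _. unfold deriv_coef, delta0. ring.
    + intros r Hr. right. transitivity (avg (fun _ => 0)); [ | apply avg_const].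
      apply avg_ext. intros t. rewrite (cps_poly _ 0).
      * simpl. now rewrite Cmod_0, rpow_0.
      * intros n _. unfold deriv_coef, delta0. ring.
Qed.

Lemma taylor_one n : taylor_coef (fun _ => RtoC 1) n = delta0 1 n.
Proof.
  apply (taylor_cps _ _ 1); [lra | | ].
  - apply (rad_poly _ 1). intros [ | k] Hk; [lia | easy].
  - intros z _. now rewrite cps_delta0.
Qed.

Lemma csum_delta0 k n : csum (delta0 k) (S n) = k.
Proof. induction n; [simpl; ring | ]. change (csum (delta0 k) (S n) + 0 = k)%C. rewrite IHn. ring. Qed.

Lemma Rhaly_one eta z : Rhaly eta (fun _ => RtoC 1) z = cps eta z.
Proof.
  apply C_series_ext. intros n. f_equal. rewrite sum_n_csum.
  rewrite (csum_ext _ (delta0 1)) by (intros; apply taylor_one). rewrite csum_delta0. ring.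
Qed.

Lemma gen_Hilbert_one eta z : gen_Hilbert eta (fun _ => RtoC 1) z = cps (fun n => eta (S n)) z.
Proof.
  apply C_series_ext. intros n. f_equal.
  assert (Hn : INR (n + 1) <> 0) by (apply not_0_INR; lia).
  assert (HnC : RtoC (INR (n + 1)) <> 0) by (intros E; now apply RtoC_inj in E).
  rewrite (cser_C_series _ (1 / RtoC (INR (n + 1)))%C).
  - replace (n + 1)%nat with (S n) in * by lia. field. easy.
  - assert (Sg := cser_single (fun k => taylor_coef (fun _ => RtoC 1) k / RtoC (INR (n + k + 1)))%C O).
    cbv beta in Sg. rewrite taylor_one, Nat.add_0_r in Sg. apply Sg.
    intros [ | k] Hk; [easy | ]. rewrite taylor_one. simpl delta0. unfold Cdiv. ring.
Qed.

Section Symbol.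
Variables (eta : nat -> C) (g : C -> C) (q : R).
Hypothesis Heta : rad 1 eta.
Hypothesis Hg : forall z, Cmod z < 1 -> g z = cps eta z.
Hypothesis Hq : 1 < q.

Lemma symbol_of_Rhaly : fs_mem (S_space q) (Rhaly eta (fun _ => RtoC 1)) -> fs_mem (S_space q) g.
Proof.
  intros H. assert (Q : 0 < q) by lra.
  destruct (S_elim q _ eta (Rlt_le _ _ Hq) H Heta (fun z _ => Rhaly_one eta z)) as [N M].
  apply (S_intro q g eta _ Q Heta Hg) with (2 := M). apply rpow_ge0.
Qed.

(** Let h be the image of 1, so that g = g(0) + z h and g' = h + z h'. Membership of
    h in S^q gives h' in H^q, and also summable coefficients, hence a bounded h. *)
Lemma symbol_of_Hilbert : fs_mem (S_space q) (gen_Hilbert eta (fun _ => RtoC 1)) -> fs_mem (S_space q) g.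
Proof.
  intros H. assert (Q : 0 < q) by lra.
  set (d := fun n => eta (S n)). assert (Rd : rad 1 d) by now apply rad_shift.
  assert (Ed : forall z, Cmod z < 1 -> gen_Hilbert eta (fun _ => RtoC 1) z = cps d z).
  { intros z _. apply gen_Hilbert_one. }
  destruct (S_elim q _ d (Rlt_le _ _ Hq) H Rd Ed) as [N M].
  set (X := rpow (real (hardy_norm q (C_derive (gen_Hilbert eta (fun _ => RtoC 1))))) q) in M.
  set (L := 4 * fs_norm (S_space q) (gen_Hilbert eta (fun _ => RtoC 1))).
  assert (HL : forall n, rsum (fun k => Cmod (d k)) n <= L).
  { intros n. rewrite (rsum_ext _ (fun k => Cmod (taylor_coef (gen_Hilbert eta (fun _ => RtoC 1)) k))).
    - apply S_l1; [lra | easy].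
    - intros k _. now rewrite (taylor_cps _ d 1) by (try lra; easy). }
  assert (M0 : mean_bdd q d (rpow L q)).
  { split; [easy | ]. intros r Hr. rewrite <- (avg_const (rpow L q)).
    apply avg_le; [now apply (contR_cmean 1) | apply contR_const | ]. intros t.
    apply rpow_le; [apply Cmod_ge_0 | | easy].
    apply (cser_abs_bound (fun n => d n * circle_pt r t ^ n)%C).
    - apply (cps_cser 1); [easy | rewrite Cmod_circle; lra].
    - intros n. eapply Rle_trans; [ | apply (HL n)]. apply rsum_le. intros k _.
      rewrite Cmod_mult, Cmod_pow, Cmod_circle by lra.
      rewrite <- (Rmult_1_r (Cmod (d k))) at 2. apply Rmult_le_compat_l; [apply Cmod_ge_0 | ].
      rewrite <- (pow1 k). apply pow_incr; lra. }
  assert (Ms := mean_bdd_plus q _ _ _ _ Q M0 (mean_bdd_shiftr q _ _ Q M)).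
  assert (Mg : mean_bdd q (deriv_coef eta) (rpow 2 q * (rpow L q + X))).
  { eapply mean_bdd_ext; [ | exact Ms]. intros [ | n]; unfold d, shiftr, deriv_coef.
    - simpl. ring.
    - rewrite (S_INR (S n)), RtoC_plus. ring. }
  apply (S_intro q g eta _ Q Heta Hg) with (2 := Mg).
  apply Rmult_le_pos; [apply rpow_ge0 | ]. generalize (rpow_ge0 L q). unfold X.
  generalize (rpow_ge0 (real (hardy_norm q (C_derive (gen_Hilbert eta (fun _ => RtoC 1))))) q). lra.
Qed.

Variable p : R.
Hypothesis Hp : 1 <= p.
Hypothesis Hgq : fs_mem (S_space q) g.

Lemma Rhaly_bounded_compact :
  bounded_op (S_space p) (S_space q) (Rhaly eta) /\ compact_op (S_space p) (S_space q) (Rhaly eta).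
Proof.
  destruct (S_elim q g eta (Rlt_le _ _ Hq) Hgq Heta Hg) as [N M].
  assert (Mn : mean_bdd q (ncoef eta) (rpow (real (hardy_norm q (C_derive g))) q)).
  { eapply mean_bdd_ext; [ | exact (mean_bdd_shiftr q _ _ ltac:(lra) M)].
    intros [ | n]; unfold shiftr, ncoef, deriv_coef; [simpl; ring | easy]. }
  apply (weighted_operator p q eta _ 4 taylor_coef (Rhaly eta) Hp Hq Heta (rpow_ge0 _ _) Mn); [lra | | | | ].
  - intros f Hf z Hz. apply C_series_ext. intros n. now rewrite sum_n_csum.
  - intros f Hf n. now apply S_l1.
  - intros f h Hf Hh n. now apply (taylor_plus p).
  - intros k f Hf n. now apply (taylor_scal p).
Qed.

(** For the multiplier h of the Hilbert operator, z h' is g' without its constant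
    term, a tail of g'. *)
Lemma gen_Hilbert_bounded_compact :
  bounded_op (S_space p) (S_space q) (gen_Hilbert eta) /\ compact_op (S_space p) (S_space q) (gen_Hilbert eta).
Proof.
  destruct (S_elim q g eta (Rlt_le _ _ Hq) Hgq Heta Hg) as [N M].
  destruct (tails_bounded q Hq) as [K [HK TB]].
  assert (Mn : mean_bdd q (ncoef (hil_symbol eta)) (K * rpow (real (hardy_norm q (C_derive g))) q)).
  { eapply mean_bdd_ext; [ | exact (TB _ _ M 1%nat)].
    intros [ | n]; unfold tail, ncoef, hil_symbol, deriv_coef.
    - simpl. ring.
    - change (Nat.ltb (S n) 1) with false. cbv iota. replace (S n + 1)%nat with (S (S n)) by lia. field.
      intros E. apply RtoC_inj in E. apply not_0_INR in E; [easy | lia]. }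
  apply (weighted_operator p q (hil_symbol eta) _ 12 hil_weight (gen_Hilbert eta) Hp Hq
     (rad_hil_symbol _ Heta)) with (2 := Mn); [ | lra | | | | ].
  - apply Rmult_le_pos; [easy | apply rpow_ge0].
  - intros f Hf z Hz. now apply (gen_Hilbert_weights p).
  - intros f Hf n. now apply hil_weight_l1.
  - intros f h Hf Hh n. apply cser_C_series.
    apply (cser_ext (fun k => taylor_coef f k * RtoC (omega_diff n k) + taylor_coef h k * RtoC (omega_diff n k))%C).
    + intros k. rewrite (taylor_plus p) by easy. ring.
    + apply cser_plus; now apply (hil_weight_cser p).
  - intros c f Hf n. apply cser_C_series.
    apply (cser_ext (fun k => c * (taylor_coef f k * RtoC (omega_diff n k)))%C).
    + intros k. rewrite (taylor_scal p) by easy. ring.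
    + apply cser_scal. now apply (hil_weight_cser p).
Qed.
End Symbol.

Theorem corollary3 (eta : nat -> C) (g : C -> C) (p q : R)
  (hg : Hol g)
  (heta : forall z : C, in_disc z -> is_pseries eta z (g z))
  (hp : 1 <= p) (hq : 1 < q) :
  (bounded_op (S_space p) (S_space q) (gen_Hilbert eta) <->
   bounded_op (S_space p) (S_space q) (Rhaly eta)) /\
  (bounded_op (S_space p) (S_space q) (Rhaly eta) <->
   compact_op (S_space p) (S_space q) (gen_Hilbert eta)) /\
  (compact_op (S_space p) (S_space q) (gen_Hilbert eta) <->
   compact_op (S_space p) (S_space q) (Rhaly eta)) /\
  (compact_op (S_space p) (S_space q) (Rhaly eta) <->
   fs_mem (S_space q) g).
Proof.
  assert (Heta : rad 1 eta).
  { apply rad_of_convergence. intros z Hz. exists (g z). now apply is_pseries_cser, heta. }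
  assert (Hg : forall z, Cmod z < 1 -> g z = cps eta z).
  { intros z Hz. symmetry. apply cser_C_series. now apply is_pseries_cser, heta. }
  assert (H1 := fs_mem_one p hp).
  assert (FromR : linear_op (S_space p) (S_space q) (Rhaly eta) -> fs_mem (S_space q) g).
  { intros [L _]. apply (symbol_of_Rhaly eta g q Heta Hg hq), L, H1. }
  assert (FromH : linear_op (S_space p) (S_space q) (gen_Hilbert eta) -> fs_mem (S_space q) g).
  { intros [L _]. apply (symbol_of_Hilbert eta g q Heta Hg hq), L, H1. }
  assert (ToR := Rhaly_bounded_compact eta g q Heta Hg hq p hp).
  assert (ToH := gen_Hilbert_bounded_compact eta g q Heta Hg hq p hp).
  split; [ | split; [ | split]]; split; intros H.
  - apply ToR, FromH, H.
  - apply ToH, FromR, H.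
  - apply ToH, FromR, H.
  - apply ToR, FromH, H.
  - apply ToR, FromH, H.
  - apply ToH, FromR, H.
  - apply FromR, H.
  - apply ToR, H.
Qed.
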